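(* If the scattering filters $\Psi$ are wavelet-generated, then for every $g\in L^2(\mathbb{R}^d)$ there exists a universal constant $C_g>0$ with the following property: for any nonincreasing null-sequence $E=(E_N)_{N\in\mathbb{N}}\in\mathbb{R}_{>0}^{\mathbb{N}}$ there exists $f_{g,E}\in L^2(\mathbb{R}^d)$ such that a) $\|f_{g,E}\|_2^2\le C_g\cdot(1+E_1)$, b) $\|f_{g,E}-g\|_2^2\le C_g\cdot E_1$, and c) $W_N(f_{g,E})\ge\frac{\|g\|_2^2}{8}\cdot E_N$ for all $N\in\mathbb{N}$. Furthermore, for any such sequence $E$, the set $Y_E:=\{f\in L^2(\mathbb{R}^d): W_N(f)\in\mathcal{O}(E_N)\}$ is a countable union of nowhere dense sets in $L^2(\mathbb{R}^d)$. In particular, $L^2(\mathbb{R}^d)\setminus Y_E$ is dense in $L^2(\mathbb{R}^d)$.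
   Context: Fix $d\in\mathbb{N}=\{1,2,\dots\}$. Fourier transform: $\widehat f(\xi)=\int_{\mathbb{R}^d}f(x)e^{-2\pi i\langle x,\xi\rangle}\,dx$. Wavelet-generated filters: let $a>1$ and let $G$ be a finite subgroup of $O_d(\mathbb{R})$ with $-I\in G$. A pair $(\psi,\phi)\in(L^1(\mathbb{R}^d)\cap L^2(\mathbb{R}^d))^2$ is admissible for $(a,G)$-wavelet scattering if $|\widehat\phi(\xi)|^2+\sum_{j=1}^\infty\sum_{M\in G}|\widehat\psi(a^{-j}M^{-1}\xi)|^2=1$ for a.e. $\xi\in\mathbb{R}^d$. For $J\in\mathbb{Z}$ let $\Lambda(a,G,J):=\{a^jM: j\in\mathbb{Z},\ j>-J,\ M\in G\}$; for $\lambda=a^jM\in\Lambda(a,G,J)$ let $\psi_\lambda:=a^{dj}\psi(a^jM^{-1}\,\cdot)$; let $\mathrm{Wav}(\psi,a,G,J):=\{\psi_\lambda:\lambda\in\Lambda(a,G,J)\}$ and $\phi_J:=a^{-dJ}\phi(a^{-J}\,\cdot)$. The filters $\Psi$ are wavelet-generated if $\Psi=\mathrm{Wav}(\psi,a,G,J)$ for some such $a,G,J$ and admissible pair $(\psi,\phi)$; the low-pass filter is then $\chi:=\phi_J$. Standing assumption: $\{\chi\}\cup\Psi$ is countably infinite and satisfies $|\widehat\chi(\xi)|^2+\sum_{\psi'\in\Psi}|\widehat{\psi'}(\xi)|^2=1$ for a.e. $\xi$, where each element of the set $\Psi$ is counted once (multiple occurrences of the same filter $\psi_\lambda$ for different $\lambda$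 are precluded). Energy remainder: for a path $p=(\psi_1,\dots,\psi_N)\in\Psi^N$ set $U[p]f:=|\dots||f*\psi_1|*\psi_2|\dots*\psi_N|$ (convolve, take the pointwise modulus, iterate); $W_N(f):=\sum_{p\in\Psi^N}\|U[p]f\|_2^2$. A null-sequence is a sequence converging to $0$. $W_N\in\mathcal{O}(E_N)$ means: there exist $C>0$, $N_0\in\mathbb{N}$ with $W_N\le CE_N$ for all $N\ge N_0$. *)

(* Defs.v *)
From HB Require Import structures.
From mathcomp Require Import all_boot all_order all_algebra.
From mathcomp Require Import all_classical all_reals all_analysis.
From mathcomp Require Import measurable_realfun complex.

Set Implicit Arguments.
Unset Strict Implicit.
Unset Printing Implicit Defensive.
Import Order.TTheory GRing.Theory Num.Theory.
Import numFieldNormedType.Exports.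
Local Open Scope classical_set_scope.
Local Open Scope ring_scope.
Local Open Scope complex_scope.

Notation Rn R n := ('cV[R]_n).
Notation cabs := ComplexField.Normc.normc.

(* The Borel sigma-algebra of R[i], generated by the real and imaginary parts. *)
Section complex_measurable.
Context {R : realType}.

Definition complex_measurable : set (set R[i]) :=
  g_sigma_preimageU (@complex.Re R) (@complex.Im R).

HB.instance Definition _ := isPointed.Build R[i] 0.

Let complex0 : complex_measurable set0. Proof. exact: sigma_algebra0. Qed.

Let complexC A : complex_measurable A -> complex_measurable (~` A).
Proof. exact: sigma_algebraC. Qed.

Let complex_bigcup (F : (set R[i])^nat) :
  (forall k, complex_measurable (F k)) -> complex_measurable (\bigcup_k F k).
Proof. exact: sigma_algebra_bigcup. Qed.

HB.instance Definition _ := @isMeasurable.Build default_measure_display R[i]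
  complex_measurable complex0 complexC complex_bigcup.

End complex_measurable.

(* The Borel sigma-algebra of R^n, generated by the coordinates. *)
Section Rn_measurable.
Context {R : realType} (n : nat).

Definition coords (i : 'I_n) (x : Rn R n) : measurableTypeR R := x i ord0.

Let Rn0 : g_sigma_preimage coords set0. Proof. exact: sigma_algebra0. Qed.

Let RnC A : g_sigma_preimage coords A -> g_sigma_preimage coords (~` A).
Proof. exact: sigma_algebraC. Qed.

Let Rn_bigcup (F : (set (Rn R n))^nat) :
  (forall k, g_sigma_preimage coords (F k)) ->
  g_sigma_preimage coords (\bigcup_k F k).
Proof. exact: sigma_algebra_bigcup. Qed.

HB.instance Definition _ := @isMeasurable.Build default_measure_display
  (Rn R n) (g_sigma_preimage coords) Rn0 RnC Rn_bigcup.

Lemma measurable_coords i : measurable_fun [set: Rn R n] (coords i).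
Proof.
move=> _ Y mY; rewrite setTI; apply: sub_sigma_algebra => /=.
rewrite -bigcup_seq/=; exists i => /=; first by rewrite mem_index_enum.
by exists Y => //; rewrite setTI.
Qed.

Lemma measurable_fun_coordsP d (T : measurableType d) (f : T -> Rn R n) :
  (forall i, measurable_fun [set: T] (coords i \o f)) ->
  measurable_fun [set: T] f.
Proof.
move=> mf _ A mA; rewrite setTI.
pose F : set_system (Rn R n) := image_set_system setT f measurable.
suff : g_sigma_preimage coords `<=` F.
  by move=> /(_ A mA); rewrite /F /image_set_system/= setTI.
apply: smallest_sub.
  exact/sigma_algebra_image/sigma_algebra_measurable.
move=> B; rewrite -bigcup_seq => -[i _] [C mC <-].
rewrite /F /image_set_system /= !setTI.
by have := mf i measurableT _ mC; rewrite setTI.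
Qed.

End Rn_measurable.

(* Lebesgue measure on R^n by recursion on n: R^0 is a point of mass 1 and
   lambda_{n+1} is the image of lambda_1 x lambda_n under (t, x) |-> (t; x). *)
Section lebesgue_measure_Rn.
Context {R : realType}.

Definition consRn n (p : measurableTypeR R * Rn R n) : Rn R n.+1 :=
  col_mx (p.1)%:M p.2.

Lemma measurable_consRn n : measurable_fun setT (@consRn n).
Proof.
apply: measurable_fun_coordsP => i.
case: (split_ordP (i : 'I_(1 + n))) => j ->.
  rewrite (_ : _ \o _ = fst) //; apply/funext => p /=.
  by apply: etrans (col_mxEu _ _ _ _) _; rewrite ord1 mxE eqxx mulr1n.
rewrite (_ : _ \o _ = coords j \o snd); last first.
  by apply/funext => p; exact: col_mxEd.
by apply: measurableT_comp => //; exact: measurable_coords.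
Qed.

Definition unconsRn n (x : Rn R n.+1) : measurableTypeR R * Rn R n :=
  (coords ord0 x, @dsubmx R 1 n 1 x).

Lemma measurable_unconsRn n : measurable_fun setT (@unconsRn n).
Proof.
apply/measurable_fun_pairP; split; first exact: measurable_coords.
apply: measurable_fun_coordsP => i.
rewrite (_ : _ \o _ = coords (rshift 1 i : 'I_n.+1)).
  exact: measurable_coords.
by apply/funext => x; rewrite /coords /= mxE.
Qed.

Lemma consRnK n : cancel (@consRn n) (@unconsRn n).
Proof.
move=> [t x]; rewrite /unconsRn /consRn /= col_mxKd; congr pair.
rewrite /coords (_ : ord0 = lshift n (ord0 : 'I_1)); last exact/val_inj.
by apply: etrans (col_mxEu _ _ _ _) _; rewrite mxE.
Qed.

Section step.
Variables (n : nat) (mu : {sigma_finite_measure set (Rn R n) -> \bar R}).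

Definition lebesgue_Rn_step : set (Rn R n.+1) -> \bar R :=
  pushforward (lebesgue_measure \x mu)%E (@consRn n).

Let preimage_consRn A : measurable A -> measurable (@consRn n @^-1` A).
Proof.
by move=> mA; rewrite -[X in measurable X]setTI; exact: measurable_consRn.
Qed.

Let step0 : lebesgue_Rn_step set0 = 0%E.
Proof. by rewrite /lebesgue_Rn_step /pushforward preimage_set0 measure0. Qed.

Let step_ge0 A : (0 <= lebesgue_Rn_step A)%E.
Proof. by rewrite /lebesgue_Rn_step /pushforward measure_ge0. Qed.

Let step_sigma_additive : semi_sigma_additive lebesgue_Rn_step.
Proof.
move=> F mF tF mUF; rewrite /lebesgue_Rn_step /pushforward preimage_bigcup.
apply: measure_semi_sigma_additive.
- by move=> k; exact: preimage_consRn.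
- apply/trivIsetP => i j _ _ ij; rewrite -preimage_setI.
  by move/trivIsetP : tF => -> //; rewrite preimage_set0.
- by rewrite -preimage_bigcup; exact: preimage_consRn.
Qed.

HB.instance Definition _ := isMeasure.Build _ _ _
  lebesgue_Rn_step step0 step_ge0 step_sigma_additive.

Let step_sigma_finite : sigma_finite setT lebesgue_Rn_step.
Proof.
have /sigma_finiteP[F [TF ndF Foo]] :=
  sigma_finiteT (lebesgue_measure : {sigma_finite_measure set _ -> \bar R}).
have /sigma_finiteP[G [TG ndG Goo]] := sigma_finiteT mu.
exists (fun k => @unconsRn n @^-1` (F k `*` G k)).
  rewrite -preimage_bigcup (_ : \bigcup_k _ = setT) ?preimage_setT//.
  rewrite -subTset => -[x y] _.
  have [k _ Fkx] : (\bigcup_k F k) x by rewrite -TF.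
  have [l _ Gly] : (\bigcup_k G k) y by rewrite -TG.
  exists (maxn k l) => //; split => /=.
  - by move: x Fkx; exact/subsetPset/ndF/leq_maxl.
  - by move: y Gly; exact/subsetPset/ndG/leq_maxr.
move=> k; have [mF Fk] := Foo k; have [mG Gk] := Goo k; split.
  rewrite -[X in measurable X]setTI.
  by apply: measurable_unconsRn => //; exact: measurableX.
rewrite /lebesgue_Rn_step /pushforward -comp_preimage.
rewrite (_ : _ \o _ = id); last by apply/funext => p /=; rewrite consRnK.
by rewrite preimage_id product_measure1E// lte_mul_pinfty// ge0_fin_numE.
Qed.

HB.instance Definition _ :=
  Measure_isSigmaFinite.Build _ _ _ lebesgue_Rn_step step_sigma_finite.

End step.

Fixpoint lebesgue_Rn n : {sigma_finite_measure set (Rn R n) -> \bar R} :=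
  if n is m.+1 then [the {sigma_finite_measure set _ -> \bar R} of
                       lebesgue_Rn_step (lebesgue_Rn m)]
  else [the {sigma_finite_measure set _ -> \bar R} of \d_(0 : Rn R 0)].

End lebesgue_measure_Rn.

Section complex_fun.
Context {R : realType} {d : nat}.
Local Notation V := (Rn R d).
Local Notation mu := (@lebesgue_Rn R d).
Implicit Types f g : V -> R[i].

Definition Lnormc (p : \bar R) f : \bar R :=
  Lnorm mu p (fun x => (cabs (f x))%:E).

Definition cintegral f : R[i] :=
  (\int[mu]_x (complex.Re (f x))) +i* (\int[mu]_x (complex.Im (f x))).

Definition dotv (x y : V) : R := \sum_(k < d) x k ord0 * y k ord0.

(* e^{i t} *)
Definition cexpi (t : R) : R[i] := cos t +i* sin t.

(* The Fourier transform of f in L^1; the value is irrelevant otherwise. *)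
Definition fourier f (xi : V) : R[i] :=
  cintegral (fun x => f x * cexpi (- (2 * pi * dotv x xi))).

(* For f in L^2 and g in L^1 the integral converges for almost every x; the
   values on the remaining null set are irrelevant. *)
Definition conv f g (x : V) : R[i] := cintegral (fun y => f y * g (x - y)).

End complex_fun.

(* Measurable functions R^d -> C modulo equality almost everywhere; elements
   coerce to functions through a choice of representative. *)
Notation L0 R d := {mfun_ (@lebesgue_Rn R d), Rn R d >-> R[i]}.

Definition in_Lp (R : realType) (d : nat) (p : \bar R) (f : L0 R d) : Prop :=
  (Lnormc p f < +oo)%E.

Record L2 (R : realType) (d : nat) := MkL2 {
  L2val :> L0 R d ;
  L2valP : `[< in_Lp 2%:E L2val >] }.

HB.instance Definition _ (R : realType) (d : nat) := [isSub for @L2val R d].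
HB.instance Definition _ (R : realType) (d : nat) :=
  [Choice of L2 R d by <:].

Section L2_metric.
Context {R : realType} {d : nat}.
Local Notation V := (Rn R d).
Local Notation mu := (@lebesgue_Rn R d).
Implicit Types f g h : L2 R d.

Definition L2dist f g : R := fine (Lnormc 2%:E (fun x => f x - g x)).

Lemma measurable_Re : measurable_fun setT (@complex.Re R).
Proof. by move=> _ A mA; apply: sub_sigma_algebra; left; exists A. Qed.

Lemma measurable_Im : measurable_fun setT (@complex.Im R).
Proof. by move=> _ A mA; apply: sub_sigma_algebra; right; exists A. Qed.

Let measurable_sqrt : measurable_fun setT (@Num.sqrt R).
Proof. exact: (continuous_measurable_fun (@sqrt_continuous R)). Qed.

Lemma measurable_cabs : measurable_fun setT (@cabs R).
Proof.
rewrite (_ : @cabs R = fun z : R[i] =>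
    Num.sqrt (complex.Re z ^+ 2 + complex.Im z ^+ 2)); last first.
  by apply/funext => -[].
apply: measurableT_comp; first exact: measurable_sqrt.
by apply: measurable_funD; apply: measurable_funX;
  [exact: measurable_Re|exact: measurable_Im].
Qed.

Let mL0 f : measurable_fun setT (f : V -> R[i]).
Proof. exact: measurable_funP. Qed.

Let mabs f : measurable_fun setT (fun x => cabs (f x)).
Proof. by apply: measurableT_comp; [exact: measurable_cabs|exact: mL0]. Qed.

Let mdiff f g : measurable_fun setT (fun x => cabs (f x - g x)).
Proof.
rewrite (_ : (fun _ => _) = fun x => Num.sqrt
   ((complex.Re (f x) - complex.Re (g x)) ^+ 2 +
    (complex.Im (f x) - complex.Im (g x)) ^+ 2)); last first.
  by apply/funext => x; case: (f x) => a b; case: (g x).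
apply: measurableT_comp; first exact: measurable_sqrt.
apply: measurable_funD; apply: measurable_funX; apply: measurable_funB.
- by apply: measurableT_comp; [exact: measurable_Re|exact: mL0].
- by apply: measurableT_comp; [exact: measurable_Re|exact: mL0].
- by apply: measurableT_comp; [exact: measurable_Im|exact: mL0].
- by apply: measurableT_comp; [exact: measurable_Im|exact: mL0].
Qed.

Let cabs_ge0 (z : R[i]) : 0 <= cabs z.
Proof. by case: z => a b; exact: sqrtr_ge0. Qed.

Let le_LnormD (u v w : V -> R) : measurable_fun setT u ->
  measurable_fun setT v -> measurable_fun setT w ->
  (forall x, 0 <= w x <= u x + v x) ->
  (Lnorm mu 2%:E (EFin \o w) <=
   Lnorm mu 2%:E (EFin \o u) + Lnorm mu 2%:E (EFin \o v))%E.
Proof.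
move=> m_u m_v m_w wuv.
apply: (@le_trans _ _ (Lnorm mu 2%:E (EFin \o (u \+ v)))); last first.
  by apply: minkowski_EFin => //; rewrite ler1n.
have int_ge0 (t : V -> R) : (0 <= \int[mu]_x `|(t x)%:E| `^ 2)%E.
  by apply: integral_ge0 => x _; exact: poweR_ge0.
rewrite unlock /Lnorm; apply: gt0_ler_poweR.
- by rewrite invr_ge0.
- by rewrite in_itv/= int_ge0 leey.
- by rewrite in_itv/= int_ge0 leey.
apply: ge0_le_integral => //.
- by move=> x _; exact: poweR_ge0.
- apply: (measurableT_comp (measurable_poweR _)).
  by apply: measurableT_comp => //; exact/measurable_EFinP.
- apply: (measurableT_comp (measurable_poweR _)).
  by apply: measurableT_comp => //; apply/measurable_EFinP/measurable_funD.
move=> x _; have /andP[w0 wle] := wuv x.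
rewrite !abse_EFin !poweR_EFin lee_fin ge0_ler_powR ?nnegrE//=.
by rewrite !ger0_norm ?(le_trans w0).
Qed.

Let Lnormc_ge0 p (u : V -> R[i]) : (0 <= Lnormc p u)%E.
Proof. exact: Lnorm_ge0. Qed.

Let L2_fin f : (Lnormc 2%:E f < +oo)%E.
Proof. exact/asboolP/L2valP. Qed.

Let L2dist_fin f g : Lnormc 2%:E (fun x => f x - g x) \is a fin_num.
Proof.
rewrite ge0_fin_numE//; apply: (@le_lt_trans _ _
    (Lnormc 2%:E f + Lnormc 2%:E g)%E); last first.
  by rewrite lte_add_pinfty.
apply: le_LnormD; [exact: mabs|exact: mabs|exact: mdiff|] => x.
rewrite cabs_ge0/=.
apply: le_trans (le_normcD _ _) _.
by rewrite normcN.
Qed.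

Let L2distxx f : L2dist f f = 0.
Proof.
rewrite /L2dist /Lnormc (_ : (fun _ => _) = cst 0%E) ?Lnorm0 ?eqe//.
by apply/funext => x; rewrite subrr ComplexField.Normc.normc0.
Qed.

Let L2dist_sym f g : L2dist f g = L2dist g f.
Proof.
congr fine; apply: eq_Lnorm => x /=.
by rewrite -opprB normcN.
Qed.

Let L2dist_triangle g f h : L2dist f h <= L2dist f g + L2dist g h.
Proof.
rewrite -lee_fin EFinD /L2dist !fineK//.
apply: le_LnormD; [exact: mdiff|exact: mdiff|exact: mdiff|] => x.
rewrite cabs_ge0/= -(subrKA (g x)).
exact: le_normcD.
Qed.

Let L2dist_eq0 f g : L2dist f g = 0 -> f = g.
Proof.
move=> /eqP; rewrite -eqe /L2dist fineK// => /eqP.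
have mfg : measurable_fun setT (fun x => (cabs (f x - g x))%:E).
  by apply: (measurableT_comp (g := fun x => cabs (f x - g x))) => //; exact: mdiff.
move=> /(Lnorm_eq0_eq0 mfg) fg0; apply/val_inj.
suff /ae_eqP/eqP : L2val f = L2val g %[ae mu] by rewrite !reprK.
apply: filterS (fg0 _) => // x /(_ I) [fgx] _.
by apply/eqP; rewrite -subr_eq0; apply/eqP/ComplexField.Normc.eq0_normc.
Qed.

HB.instance Definition _ := isMetric.Build R (L2 R d)
  L2distxx L2dist_eq0 L2dist_sym L2dist_triangle.

End L2_metric.

Section scattering.
Context {R : realType} {d : nat}.
Local Notation V := (Rn R d).
Local Notation mu := (@lebesgue_Rn R d).
Implicit Types (psi phi chi : L0 R d) (Psi : set (L0 R d)).
Implicit Types (a : R) (G : set 'M[R]_d) (J : int).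

Definition finite_orthogonal_group G : Prop :=
  [/\ finite_set G, forall M, G M -> M *m M^T = 1%:M, G 1%:M,
      forall M N, G M -> G N -> G (M *m N)
    & forall M, G M -> G (invmx M)].

Definition admissible a G psi phi : Prop :=
  [/\ in_Lp 1%E psi /\ in_Lp 2%:E psi, in_Lp 1%E phi /\ in_Lp 2%:E phi &
    {ae mu, forall xi : V,
      ((cabs (fourier phi xi) ^+ 2)%:E +
       \sum_(1 <= j <oo) \sum_(M \in G)
         (cabs (fourier psi (a ^- j *: (invmx M *m xi))) ^+ 2)%:E = 1)%E}].

(* psi_lambda for lambda = a^j M *)
Definition dilate psi a (j : int) (M : 'M[R]_d) (x : V) : R[i] :=
  (a ^ (d%:Z * j))%:C * psi (a ^ j *: (invmx M *m x)).

(* A set of classes, so that filters equal almost everywhere are identified. *)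
Definition Wav psi a G J : set (L0 R d) :=
  [set F : L0 R d | exists (j : int) M, [/\ - J < j, G M &
     (F : V -> R[i]) = dilate psi a j M %[ae mu]]].

Definition low_pass phi a J (x : V) : R[i] :=
  (a ^ (- (d%:Z * J)))%:C * phi (a ^ (- J) *: x).

Definition wavelet_generated chi Psi : Prop :=
  exists a G J psi phi,
    [/\ 1 < a, finite_orthogonal_group G /\ G (- 1%:M),
        admissible a G psi phi, Psi = Wav psi a G J
      & (chi : V -> R[i]) = low_pass phi a J %[ae mu]].

Definition scattering_filters chi Psi : Prop :=
  (chi |` Psi #= [set: nat])%card /\
  {ae mu, forall xi : V,
    ((cabs (fourier chi xi) ^+ 2)%:E +
     \esum_(F in Psi) (cabs (fourier (F : L0 R d) xi) ^+ 2)%:E = 1)%E}.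

(* U[p]f for p = (psi_1, ..., psi_N), psi_1 being applied first. *)
Definition propagate (p : seq (L0 R d)) (f : V -> R[i]) : V -> R[i] :=
  foldl (fun h psi x => (cabs (conv h psi x))%:C) f p.

Definition energy_remainder Psi (N : nat) (f : V -> R[i]) : \bar R :=
  \esum_(p in [set p : N.-tuple (L0 R d) | forall k, Psi (tnth p k)])
    (Lnormc 2%:E (propagate p f) ^+ 2)%E.

End scattering.

(* Sequences are indexed by N >= 1; the value at 0 is ignored. *)
Definition decreasing_null_seq (R : realType) (E : nat -> R) : Prop :=
  [/\ forall N, (0 < N)%N -> 0 < E N,
      forall N, (0 < N)%N -> E N.+1 <= E N
    & E @ \oo --> (0 : R)].

Definition is_bigO (R : realType) (W : nat -> \bar R) (E : nat -> R) : Prop :=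
  exists C N0, [/\ 0 < C, (0 < N0)%N &
    forall N, (N0 <= N)%N -> (W N <= (C * E N)%:E)%E].

Definition nowhere_dense (T : topologicalType) (A : set T) : Prop :=
  (closure A)° = set0.

Definition countable_union_nowhere_dense (T : topologicalType) (A : set T) :
    Prop :=
  exists F : nat -> set T,
    (forall n, nowhere_dense (F n)) /\ A = \bigcup_n F n.

(* Main.v *)
Require Import Defs.
From HB Require Import structures.
From mathcomp Require Import all_boot all_order all_algebra.
From mathcomp Require Import all_classical all_reals all_analysis.
From mathcomp Require Import measurable_realfun complex.
From mathcomp Require Import ring lra.

(** Write D_c f for the dilation f(c .) normalised in L2 and W_N for the energy
    of the N-th layer. The whole statement rests on one fact
    (energy_perturbation): for all x and u in L2, every N >= 1 and every e > 0,

      W_N (x + D_(a^k) u) >= |u|^2 - e   for all large k.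

    The set of wavelet filters is stable under the dilation F |-> a^(dk) F(a^k .),
    and convolution intertwines the two dilations (Wav_dil, conv_dil). As k grows,
    D_(a^k) u moves to high frequencies, where the low-pass filter captures
    nothing, so the filters of some dilate of u capture almost all of its energy
    in finitely many pieces h = D_(a^l) u * F (first_layer_full). For these F
    the dilated filters F_k turn D_(a^(k+l)) u into D_(a^k) h, whereas x * F_k tends
    to 0: unless F is null, the F_k are distinct filters and Bessel's inequality
    makes the energies of the x * F_k summable (dilated_filter_vanishes). Modulus and induction on N
    then give the claim. What makes the induction work is that sqrt W_N is
    1-Lipschitz, used in the weighted form of energy_weighted.

    Slow decay is a gliding hump (gliding_hump): bumps D_(a^k_m) (sqrt e_m g) are
    added to g successively, where e_m is the value of E at the first layer that
    the m-th bump has to serve and e_(m+1) <= e_m / 100, so that neither the earlier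
    nor the later bumps destroy more than a fraction of the energy of the m-th one.
    For the topological part, the set of f with W_N f = O(E_N) is the union of the
    sets Y_n of all f with W_N f <= n E_N for N >= n. On the closure of Y_n the
    same bound holds with 2 n, but a small bump added to any point violates it
    for some large N; hence Y_n is nowhere dense. A gliding hump for a small
    multiple of sqrt E, started at an arbitrary point, gives the density of the
    complement.

    Bessel's inequality and the capture of energy come from the frame identity
    |f * chi|^2 + sum_F |f * F|^2 = |f|^2 (frame_identity), that is, from
    Plancherel's identity and the hypothesis on the transforms of the filters.
    Plancherel's identity is proved on the line by damping the transform
    with exp(- e |xi|), which yields an exact identity between the damped energy,
    the energy and the Poisson average of |f - f(. - s)|^2
    (regularised_plancherel), and then on R^d by induction on d. Young's inequality
    and the invariance of Lebesgue measure under dilations and orthogonal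
    maps provide the rest. *)

Set Implicit Arguments.
Unset Strict Implicit.
Unset Printing Implicit Defensive.
Import Order.TTheory GRing.Theory Num.Theory.
Import numFieldNormedType.Exports.
Local Open Scope classical_set_scope.
Local Open Scope ring_scope.
Local Open Scope complex_scope.
Local Notation conv := Defs.conv.

(** * Complex-valued measurable functions *)

Section complex_facts.
Context {R : realType}.
Implicit Types z w : R[i].

Lemma sqr_cabs z : cabs z ^+ 2 = complex.Re z ^+ 2 + complex.Im z ^+ 2.
Proof. by case: z => a b; rewrite sqr_sqrtr// addr_ge0 ?sqr_ge0. Qed.

Lemma cabs_ge0 z : 0 <= cabs z.
Proof. by case: z => a b; exact: sqrtr_ge0. Qed.

Lemma Re_le_cabs z : `|complex.Re z| <= cabs z.
Proof.
rewrite -(ler_pXn2r (n:=2))// ?nnegrE ?cabs_ge0//.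
by rewrite sqr_cabs real_normK ?num_real// lerDl sqr_ge0.
Qed.

Lemma Im_le_cabs z : `|complex.Im z| <= cabs z.
Proof.
rewrite -(ler_pXn2r (n:=2))// ?nnegrE ?cabs_ge0//.
by rewrite sqr_cabs real_normK ?num_real// lerDr sqr_ge0.
Qed.

Lemma cabs_le_ReIm z : cabs z <= `|complex.Re z| + `|complex.Im z|.
Proof.
rewrite -(ler_pXn2r (n:=2))// ?nnegrE ?cabs_ge0// ?addr_ge0//.
rewrite sqr_cabs sqrrD !real_normK ?num_real//.
by rewrite -addrA lerD2l lerDr mulrn_wge0// mulr_ge0.
Qed.

Lemma cabs_real (x : R) : cabs (x%:C) = `|x|.
Proof. by rewrite /= expr0n addr0 sqrtr_sqr. Qed.

Lemma cabs_conj z : cabs (conjc z) = cabs z.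
Proof. by case: z => a b /=; rewrite sqrrN. Qed.

Lemma cabsM z w : cabs (z * w) = cabs z * cabs w.
Proof. exact: ComplexField.Normc.normcM. Qed.

Lemma cabsN z : cabs (- z) = cabs z.
Proof. exact: normcN. Qed.

Lemma cabsD z w : cabs (z + w) <= cabs z + cabs w.
Proof. exact: le_normcD. Qed.

Lemma cabsB z w : cabs (z - w) <= cabs z + cabs w.
Proof. by rewrite -(cabsN w); exact: cabsD. Qed.

Lemma cabs0 : cabs (0 : R[i]) = 0.
Proof. exact: ComplexField.Normc.normc0. Qed.

Lemma cabs_dist z w : `|cabs z - cabs w| <= cabs (z - w).
Proof.
have h (a b : R[i]) : cabs a - cabs b <= cabs (a - b).
  by rewrite lerBlDr; have := cabsD (a - b) b; rewrite subrK.
by rewrite ler_norml h lerNl opprB -(cabsN (z - w)) opprB h.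
Qed.

Lemma cReD z w : complex.Re (z + w) = complex.Re z + complex.Re w.
Proof. by case: z w => a b [c d]. Qed.
Lemma cImD z w : complex.Im (z + w) = complex.Im z + complex.Im w.
Proof. by case: z w => a b [c d]. Qed.
Lemma cReN z : complex.Re (- z) = - complex.Re z.
Proof. by case: z. Qed.
Lemma cImN z : complex.Im (- z) = - complex.Im z.
Proof. by case: z. Qed.
Lemma cReM z w : complex.Re (z * w) =
  complex.Re z * complex.Re w - complex.Im z * complex.Im w.
Proof. by case: z w => a b [c d]. Qed.
Lemma cImM z w : complex.Im (z * w) =
  complex.Re z * complex.Im w + complex.Im z * complex.Re w.
Proof. by case: z w => a b [c d]. Qed.
Lemma cRe_conj z : complex.Re (conjc z) = complex.Re z. Proof. by case: z. Qed.
Lemma cIm_conj z : complex.Im (conjc z) = - complex.Im z. Proof. by case: z. Qed.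

Lemma complexP z w : complex.Re z = complex.Re w ->
  complex.Im z = complex.Im w -> z = w.
Proof. by case: z w => a b [c d] /= -> ->. Qed.

Lemma cconjM z w : conjc (z * w) = conjc z * conjc w.
Proof.
by apply: complexP; rewrite ?(cRe_conj, cIm_conj, cReM, cImM); ring.
Qed.

Lemma cconj_real (x : R) : conjc (x%:C) = x%:C.
Proof. by apply: complexP; rewrite /= ?oppr0. Qed.

Lemma mul_conj z : conjc z * z = (cabs z ^+ 2)%:C.
Proof.
by rewrite sqr_cabs; case: z => a b; apply: complexP; rewrite /=; ring.
Qed.

Lemma cabs_cexpi (t : R) : cabs (cexpi t) = 1.
Proof. by rewrite /= cos2Dsin2 sqrtr1. Qed.

Lemma cexpiD (s t : R) : cexpi (s + t) = cexpi s * cexpi t.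
Proof. by apply: complexP => /=; rewrite ?cosD ?sinD; ring. Qed.

Lemma cexpi0 : cexpi 0 = 1 :> R[i].
Proof. by rewrite /cexpi cos0 sin0. Qed.

Lemma cexpiN (t : R) : cexpi (- t) = conjc (cexpi t).
Proof. by rewrite /cexpi cosN sinN. Qed.

(** The coefficient of |w|^2 can be taken arbitrarily close to 1, at the price of
    a large factor on the error. Once |z| is replaced by |w| + |z - w|, the two
    sides differ by the square (t |w| - |z - w|)^2 / t. *)
Lemma sqr_cabs_le_weighted (t : R) z w : 0 < t ->
  cabs z ^+ 2 <= (1 + t) * cabs w ^+ 2 + (1 + t^-1) * cabs (z - w) ^+ 2.
Proof.
move=> t0.
have h : cabs z <= cabs w + cabs (z - w).
  by have := cabsD w (z - w); rewrite addrC subrK.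
apply: (@le_trans _ _ ((cabs w + cabs (z - w)) ^+ 2)).
  by rewrite ler_pXn2r// nnegrE ?addr_ge0 ?cabs_ge0.
rewrite -subr_ge0; set a := cabs w; set b := cabs (z - w).
rewrite (_ : _ - _ = t^-1 * (t * a - b) ^+ 2).
  by rewrite mulr_ge0 ?sqr_ge0// invr_ge0 ltW.
by field; rewrite gt_eqF.
Qed.

End complex_facts.

Section measurability.
Context {R : realType} {d : measure_display} {T : measurableType d}.
Implicit Types f g : T -> R[i].

Lemma measurable_complexP f : measurable_fun setT f <->
  measurable_fun setT (fun x => complex.Re (f x)) /\
  measurable_fun setT (fun x => complex.Im (f x)).
Proof.
split=> [mf|[mr mi]].
  by split; apply: measurableT_comp mf; [exact: measurable_Re|exact: measurable_Im].
move=> _ A mA; rewrite setTI.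
pose F : set_system R[i] := image_set_system setT f measurable.
suff : complex_measurable `<=` F.
  by move=> /(_ A mA); rewrite /F /image_set_system/= setTI.
apply: smallest_sub.
  exact/sigma_algebra_image/sigma_algebra_measurable.
move=> B [] [C mC <-]; rewrite /F /image_set_system /= !setTI.
- by have := mr measurableT _ mC; rewrite setTI.
- by have := mi measurableT _ mC; rewrite setTI.
Qed.

Lemma measurable_cplx (u v : T -> R) : measurable_fun setT u ->
  measurable_fun setT v -> measurable_fun setT (fun x => u x +i* v x).
Proof. by move=> mu_ mv; apply/measurable_complexP. Qed.

Lemma measurable_realC (u : T -> R) : measurable_fun setT u ->
  measurable_fun setT (fun x => (u x)%:C).
Proof. by move=> mu_; apply/measurable_complexP; split. Qed.

Lemma measurable_ReT f : measurable_fun setT f ->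
  measurable_fun setT (fun x => complex.Re (f x)).
Proof. by move/measurable_complexP => -[]. Qed.

Lemma measurable_ImT f : measurable_fun setT f ->
  measurable_fun setT (fun x => complex.Im (f x)).
Proof. by move/measurable_complexP => -[]. Qed.

Lemma measurable_cadd f g : measurable_fun setT f -> measurable_fun setT g ->
  measurable_fun setT (fun x => f x + g x).
Proof.
move=> mf mg; apply/measurable_complexP; split.
- under eq_fun do rewrite cReD.
  by apply: measurable_funD; exact: measurable_ReT.
- under eq_fun do rewrite cImD.
  by apply: measurable_funD; exact: measurable_ImT.
Qed.

Lemma measurable_copp f : measurable_fun setT f ->
  measurable_fun setT (fun x => - f x).
Proof.
move=> mf; apply/measurable_complexP; split.
- under eq_fun do rewrite cReN.
  by apply: measurableT_comp; [exact: oppr_measurable|exact: measurable_ReT].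
- under eq_fun do rewrite cImN.
  by apply: measurableT_comp; [exact: oppr_measurable|exact: measurable_ImT].
Qed.

Lemma measurable_csub f g : measurable_fun setT f -> measurable_fun setT g ->
  measurable_fun setT (fun x => f x - g x).
Proof. by move=> mf mg; apply: measurable_cadd => //; exact: measurable_copp. Qed.

Lemma measurable_cmul f g : measurable_fun setT f -> measurable_fun setT g ->
  measurable_fun setT (fun x => f x * g x).
Proof.
move=> mf mg; apply/measurable_complexP; split.
- under eq_fun do rewrite cReM.
  by apply: measurable_funB; apply: measurable_funM;
    (exact: measurable_ImT || exact: measurable_ReT).
- under eq_fun do rewrite cImM.
  by apply: measurable_funD; apply: measurable_funM;
    (exact: measurable_ImT || exact: measurable_ReT).
Qed.

Lemma measurable_cconj f : measurable_fun setT f ->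
  measurable_fun setT (fun x => conjc (f x)).
Proof.
move=> mf; apply/measurable_complexP; split.
- by under eq_fun do rewrite cRe_conj; exact: measurable_ReT.
- under eq_fun do rewrite cIm_conj.
  by apply: measurableT_comp; [exact: oppr_measurable|exact: measurable_ImT].
Qed.

Lemma measurable_cabsT f : measurable_fun setT f ->
  measurable_fun setT (fun x => cabs (f x)).
Proof. by move=> mf; apply: measurableT_comp; first exact: measurable_cabs. Qed.

Lemma measurable_cexpi (t : T -> R) : measurable_fun setT t ->
  measurable_fun setT (fun x => cexpi (t x)).
Proof.
move=> mt; apply: measurable_cplx; apply: measurableT_comp mt.
- exact: continuous_measurable_fun (@continuous_cos R).
- exact: continuous_measurable_fun (@continuous_sin R).
Qed.

End measurability.

(** * Integration of complex-valued functions *)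

Section cint.
Context {R : realType} {d : measure_display} {T : measurableType d}.
Variable mu : {measure set T -> \bar R}.
Implicit Types f g : T -> R[i].

(** On R^d this is convertible to the integral that convolutions and Fourier
    transforms are made of; it is needed on the line and on products as well. *)
Definition Cint f : R[i] :=
  (\int[mu]_x (complex.Re (f x))) +i* (\int[mu]_x (complex.Im (f x))).

Definition norm1 f : \bar R := (\int[mu]_x (cabs (f x))%:E)%E.

Definition sqnorm f : \bar R := (\int[mu]_x (cabs (f x) ^+ 2)%:E)%E.

Definition cintegrable f := measurable_fun setT f /\ (norm1 f < +oo)%E.

Lemma measurable_ecabs f : measurable_fun setT f ->
  measurable_fun setT (fun x => (cabs (f x))%:E).
Proof. by move=> mf; apply/measurable_EFinP; exact: measurable_cabsT. Qed.

Lemma measurable_esqcabs f : measurable_fun setT f ->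
  measurable_fun setT (fun x => (cabs (f x) ^+ 2)%:E).
Proof.
by move=> mf; apply/measurable_EFinP/measurable_funX; exact: measurable_cabsT.
Qed.

Lemma norm1_ge0 f : (0 <= norm1 f)%E.
Proof. by apply: integral_ge0 => x _; rewrite lee_fin cabs_ge0. Qed.

Lemma sqnorm_ge0 f : (0 <= sqnorm f)%E.
Proof. by apply: integral_ge0 => x _; rewrite lee_fin sqr_ge0. Qed.

Lemma cintegrable_cabs f : cintegrable f ->
  mu.-integrable setT (fun x => (cabs (f x))%:E).
Proof.
move=> [mf foo]; apply/integrableP; split; first exact: measurable_ecabs.
by under eq_integral do rewrite /= ger0_norm ?cabs_ge0//.
Qed.

Lemma cintegrable_le f (u : T -> R) : measurable_fun setT f ->
  mu.-integrable setT (EFin \o u) -> (forall x, cabs (f x) <= `|u x|) ->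
  cintegrable f.
Proof.
move=> mf /integrableP[mu_ uoo] fu; split => //; apply: le_lt_trans uoo.
apply: ge0_le_integral => //=.
- by move=> x _; rewrite lee_fin cabs_ge0.
- exact: measurable_ecabs.
- by apply/measurable_EFinP; apply: measurableT_comp => //; exact/measurable_EFinP.
- by move=> x _; rewrite lee_fin.
Qed.

Lemma cintegrable_Re f : cintegrable f ->
  mu.-integrable setT (EFin \o (fun x => complex.Re (f x))).
Proof.
move=> fi; have [mf _] := fi.
apply: le_integrable (cintegrable_cabs fi) => //.
  by apply/measurable_EFinP; exact: measurable_ReT.
by move=> x _; rewrite /= lee_fin (le_trans (Re_le_cabs _))// ler_norm.
Qed.

Lemma cintegrable_Im f : cintegrable f ->
  mu.-integrable setT (EFin \o (fun x => complex.Im (f x))).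
Proof.
move=> fi; have [mf _] := fi.
apply: le_integrable (cintegrable_cabs fi) => //.
  by apply/measurable_EFinP; exact: measurable_ImT.
by move=> x _; rewrite /= lee_fin (le_trans (Im_le_cabs _))// ler_norm.
Qed.

Lemma eq_cint f g : f =1 g -> Cint f = Cint g.
Proof. by move=> /funext ->. Qed.

Lemma Re_Cint f : complex.Re (Cint f) = \int[mu]_x (complex.Re (f x)).
Proof. by []. Qed.

Lemma Im_Cint f : complex.Im (Cint f) = \int[mu]_x (complex.Im (f x)).
Proof. by []. Qed.

Lemma CintD f g : cintegrable f -> cintegrable g ->
  Cint (fun x => f x + g x) = Cint f + Cint g.
Proof.
move=> fi gi; apply: complexP; rewrite ?(cReD, cImD, cRe_conj, cIm_conj) ?Re_Cint ?Im_Cint.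
- under eq_Rintegral do rewrite cReD.
  by rewrite RintegralD//; exact: cintegrable_Re.
- under eq_Rintegral do rewrite cImD.
  by rewrite RintegralD//; exact: cintegrable_Im.
Qed.

Lemma CintZ (c : R[i]) f : cintegrable f ->
  Cint (fun x => c * f x) = c * Cint f.
Proof.
move=> fi; have ri := cintegrable_Re fi; have ii := cintegrable_Im fi.
have iZ (k : R) (u : T -> R) : mu.-integrable setT (EFin \o u) ->
    mu.-integrable setT (EFin \o (fun x => k * u x)).
  move=> ui; rewrite (_ : _ \o _ = fun x => (k%:E * (EFin \o u) x)%E)//.
  exact: integrableZl.
apply: complexP; rewrite ?cReM ?cImM ?Re_Cint ?Im_Cint.
- under eq_Rintegral do rewrite cReM.
  by rewrite RintegralB//; [rewrite !RintegralZl//|exact: iZ|exact: iZ].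
- under eq_Rintegral do rewrite cImM.
  by rewrite RintegralD//; [rewrite !RintegralZl//|exact: iZ|exact: iZ].
Qed.

Lemma Cint_conj f : cintegrable f ->
  Cint (fun x => conjc (f x)) = conjc (Cint f).
Proof.
move=> fi; apply: complexP; rewrite ?cRe_conj ?cIm_conj ?Re_Cint ?Im_Cint.
- by under eq_Rintegral do rewrite cRe_conj.
- under eq_Rintegral do rewrite cIm_conj -mulN1r.
  by rewrite RintegralZl ?mulN1r//; exact: cintegrable_Im.
Qed.

Lemma CintZr (c : R[i]) f : cintegrable f ->
  Cint (fun x => f x * c) = Cint f * c.
Proof. by move=> fi; rewrite mulrC -CintZ//; apply: eq_cint => x; rewrite mulrC. Qed.

Lemma cintegrableZ (c : R[i]) f : cintegrable f -> cintegrable (fun x => c * f x).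
Proof.
move=> fi; apply: (@cintegrable_le _ (fun x => cabs c * cabs (f x))).
- by apply: measurable_cmul => //; have [] := fi.
- rewrite (_ : _ \o _ = fun x => ((cabs c)%:E * (cabs (f x))%:E)%E)//.
  by apply: integrableZl => //; exact: cintegrable_cabs.
- by move=> x; rewrite cabsM ger0_norm// mulr_ge0 ?cabs_ge0.
Qed.

Lemma cintegrableN f : cintegrable f -> cintegrable (fun x => - f x).
Proof.
move=> [mf foo]; split; first exact: measurable_copp.
by rewrite /norm1; under eq_integral do rewrite cabsN.
Qed.

Lemma CintB f g : cintegrable f -> cintegrable g ->
  Cint (fun x => f x - g x) = Cint f - Cint g.
Proof.
move=> fi gi; rewrite CintD//; last exact: cintegrableN.
congr (_ + _); rewrite -mulN1r -CintZ//; apply: eq_cint => x.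
by rewrite mulN1r.
Qed.

(** With z the integral, |z|^2 is the integral of Re (conj z * f), and
    Re (conj z * f) <= |z| |f| pointwise. *)
Lemma cabs_Cint_le f : measurable_fun setT f ->
  ((cabs (Cint f))%:E <= norm1 f)%E.
Proof.
move=> mf; have [foo|] := boolP (norm1 f < +oo)%E; last first.
  by rewrite -leNgt leye_eq => /eqP ->; rewrite leey.
have fi : cintegrable f by [].
have [->|z0] := eqVneq (cabs (Cint f)) 0; first exact: norm1_ge0.
have zgt0 : 0 < cabs (Cint f) by rewrite lt_neqAle eq_sym z0 cabs_ge0.
have gi : cintegrable (fun x => conjc (Cint f) * f x) by exact: cintegrableZ.
have h : cabs (Cint f) ^+ 2 = \int[mu]_x (complex.Re (conjc (Cint f) * f x)).
  have := congr1 (@complex.Re R) (CintZ (conjc (Cint f)) fi).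
  by rewrite mul_conj /= => ->.
have fin : norm1 f \is a fin_num by rewrite ge0_fin_numE// norm1_ge0.
rewrite -(fineK fin) lee_fin -(ler_pM2l zgt0) -expr2 h.
rewrite -lee_fin EFinM (fineK fin).
rewrite (_ : (_ * norm1 f)%E = \int[mu]_x ((cabs (Cint f))%:E * (cabs (f x))%:E)%E)%E;
  last first.
  rewrite ge0_integralZl//.
  - exact: measurable_ecabs.
  - by move=> x _; rewrite lee_fin cabs_ge0.
  - by rewrite lee_fin ltW.
rewrite /Rintegral fineK; last exact: integrable_fin_num (cintegrable_Re gi).
apply: le_integral => //.
- exact: cintegrable_Re.
- by apply: integrableZl => //; exact: cintegrable_cabs.
- move=> x _; rewrite -EFinM lee_fin (le_trans (ler_norm _))//.
  by rewrite (le_trans (Re_le_cabs _))// cabsM cabs_conj.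
Qed.

End cint.

Section cint_fubini.
Context {R : realType} {d1 d2 : measure_display}.
Context {T1 : measurableType d1} {T2 : measurableType d2}.
Variables (m1 : {sigma_finite_measure set T1 -> \bar R}).
Variables (m2 : {sigma_finite_measure set T2 -> \bar R}).

Lemma measurable_Rfubini (u : T1 * T2 -> R) : measurable_fun setT u ->
  measurable_fun setT (fun x => \int[m2]_y u (x, y)).
Proof.
move=> mu_; apply: measurableT_comp => //.
have mE : measurable_fun setT (EFin \o u) by exact/measurable_EFinP.
under eq_fun do rewrite integralE.
apply: emeasurable_funB.
- rewrite (_ : (fun x => _) = fubini_F m2 ((EFin \o u)^\+%E)).
    by apply: measurable_fun_fubini_tonelli_F => //; exact: measurable_funepos.
  apply/funext => x; apply: eq_integral => y _.
  by rewrite -[_ (x, y)]/(((EFin \o u)^\+%E \o pair x) y) -funepos_comp.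
- rewrite (_ : (fun x => _) = fubini_F m2 ((EFin \o u)^\-%E)).
    by apply: measurable_fun_fubini_tonelli_F => //; exact: measurable_funeneg.
  apply/funext => x; apply: eq_integral => y _.
  by rewrite -[_ (x, y)]/(((EFin \o u)^\-%E \o pair x) y) -funeneg_comp.
Qed.

Lemma Rfubini (u : T1 * T2 -> R) :
  (m1 \x m2)%E.-integrable setT (EFin \o u) ->
  \int[m1]_x \int[m2]_y u (x, y) = \int[(m1 \x m2)%E]_z u z.
Proof.
move=> ui; rewrite /Rintegral -(integral12_prod_meas1 ui); congr fine.
have mu_ : measurable_fun setT u by apply/measurable_EFinP; exact: measurable_int ui.
apply: ae_eq_integral => //.
- by apply/measurable_EFinP; exact: measurable_Rfubini.
- exact: measurable_fubini_F ui.
(* For the other x the real-valued inner integral is meaningless. *)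
- apply: filterS (ae_integrable1 ui) => x xi _.
  by rewrite fineK//; exact: (integrable_fin_num measurableT xi).
Qed.

Lemma measurable_Cfubini (f : T1 * T2 -> R[i]) : measurable_fun setT f ->
  measurable_fun setT (fun x => Cint m2 (fun y => f (x, y))).
Proof.
move=> mf; apply: measurable_cplx.
- exact: (measurable_Rfubini (u := fun z => complex.Re (f z)) (measurable_ReT mf)).
- exact: (measurable_Rfubini (u := fun z => complex.Im (f z)) (measurable_ImT mf)).
Qed.

Lemma Cfubini (f : T1 * T2 -> R[i]) : cintegrable (m1 \x m2)%E f ->
  Cint m1 (fun x => Cint m2 (fun y => f (x, y))) = Cint (m1 \x m2)%E f.
Proof.
move=> fi; apply: complexP => /=.
- exact: (Rfubini (cintegrable_Re fi)).
- exact: (Rfubini (cintegrable_Im fi)).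
Qed.

Lemma norm1_tonelli (f : T1 * T2 -> R[i]) : measurable_fun setT f ->
  norm1 (m1 \x m2)%E f = (\int[m1]_x norm1 m2 (fun y => f (x, y)))%E.
Proof.
move=> mf; apply: fubini_tonelli1; first exact: measurable_ecabs.
by move=> x; rewrite lee_fin cabs_ge0.
Qed.

Lemma sqnorm_tonelli (f : T1 * T2 -> R[i]) : measurable_fun setT f ->
  sqnorm (m1 \x m2)%E f = (\int[m1]_x sqnorm m2 (fun y => f (x, y)))%E.
Proof.
move=> mf; apply: (fubini_tonelli1 (fun z => (cabs (f z) ^+ 2)%:E)).
  exact: measurable_esqcabs.
by move=> x; rewrite lee_fin sqr_ge0.
Qed.

Lemma measurable_sqnorm_slice1 (f : T1 * T2 -> R[i]) : measurable_fun setT f ->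
  measurable_fun setT (fun x => sqnorm m2 (fun y => f (x, y))).
Proof.
move=> mf; apply: (measurable_fun_fubini_tonelli_F (m2 := m2)
  (fun z => (cabs (f z) ^+ 2)%:E)); first exact: measurable_esqcabs.
by move=> z; rewrite lee_fin sqr_ge0.
Qed.

Lemma measurable_norm1_slice1 (f : T1 * T2 -> R[i]) : measurable_fun setT f ->
  measurable_fun setT (fun x => norm1 m2 (fun y => f (x, y))).
Proof.
move=> mf; apply: (measurable_fun_fubini_tonelli_F (m2 := m2)
  (fun z => (cabs (f z))%:E)); first exact: measurable_ecabs.
by move=> z; rewrite lee_fin cabs_ge0.
Qed.

Lemma measurable_sqnorm_slice2 (f : T1 * T2 -> R[i]) : measurable_fun setT f ->
  measurable_fun setT (fun y => sqnorm m1 (fun x => f (x, y))).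
Proof.
move=> mf; apply: (measurable_fun_fubini_tonelli_G (m1 := m1)
  (fun z => (cabs (f z) ^+ 2)%:E)); first exact: measurable_esqcabs.
by move=> z; rewrite lee_fin sqr_ge0.
Qed.

Lemma sqnorm_tonelli_swap (f : T1 * T2 -> R[i]) : measurable_fun setT f ->
  (\int[m2]_y sqnorm m1 (fun x => f (x, y)))%E = sqnorm (m1 \x m2)%E f.
Proof.
move=> mf; apply/esym; apply: (fubini_tonelli2 (fun z => (cabs (f z) ^+ 2)%:E)).
  exact: measurable_esqcabs.
by move=> x; rewrite lee_fin sqr_ge0.
Qed.

End cint_fubini.

Section cint_fubini_swap.
Context {R : realType} {d1 d2 : measure_display}.
Context {T1 : measurableType d1} {T2 : measurableType d2}.
Variables (m1 : {sigma_finite_measure set T1 -> \bar R}).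
Variables (m2 : {sigma_finite_measure set T2 -> \bar R}).

Lemma Rfubini_swap (u : T1 * T2 -> R) :
  (m1 \x m2)%E.-integrable setT (EFin \o u) ->
  \int[m2]_y \int[m1]_x u (x, y) = \int[(m1 \x m2)%E]_z u z.
Proof.
move=> ui; rewrite /Rintegral -(integral21_prod_meas1 ui); congr fine.
have mu_ : measurable_fun setT u by apply/measurable_EFinP; exact: measurable_int ui.
apply: ae_eq_integral => //.
- apply/measurable_EFinP.
  apply: (measurable_Rfubini m1 (u := fun z => u (z.2, z.1))).
  by apply: measurableT_comp mu_ _; exact: measurable_fun_pair.
- exact: measurable_fubini_G ui.
- apply: filterS (ae_integrable2 ui) => x xi _.
  by rewrite fineK//; exact: (integrable_fin_num measurableT xi).
Qed.

Lemma Cfubini_swap (f : T1 * T2 -> R[i]) : cintegrable (m1 \x m2)%E f ->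
  Cint m2 (fun y => Cint m1 (fun x => f (x, y))) =
  Cint m1 (fun x => Cint m2 (fun y => f (x, y))).
Proof.
move=> fi; rewrite Cfubini//; apply: complexP => /=.
- exact: (Rfubini_swap (cintegrable_Re fi)).
- exact: (Rfubini_swap (cintegrable_Im fi)).
Qed.

End cint_fubini_swap.

(** * Square integrable functions *)

Section Ltwo.
Context {R : realType} {d : measure_display} {T : measurableType d}.
Variable mu : {measure set T -> \bar R}.
Implicit Types f g : T -> R[i].

Lemma poweR2 (x : \bar R) : (0 <= x)%E -> (x `^ 2%R = x ^+ 2)%E.
Proof.
case: x => [r| |] //; first by rewrite lee_fin => r0; rewrite poweR_EFin powR_mulrn.
by rewrite poweRyr// expe2 mulyy.
Qed.

Lemma sqr_Lnorm2 (f : T -> \bar R) :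
  ('N[mu]_2%:E[f] ^+ 2 = \int[mu]_x (`|f x| ^+ 2))%E.
Proof.
rewrite -poweR2 ?Lnorm_ge0// poweR_Lnorm//.
by apply: eq_integral => x _; rewrite poweR2.
Qed.

Lemma sqr_Lnormc2 f : (Lnorm mu 2%:E (fun x => (cabs (f x))%:E) ^+ 2)%E = sqnorm mu f.
Proof.
rewrite sqr_Lnorm2; apply: eq_integral => x _.
by rewrite abse_EFin ger0_norm ?cabs_ge0// EFin_expe.
Qed.

(** Stated for extended values, so that no integrability has to be checked. *)
Lemma cauchy_schwarz (u v : T -> R) :
  measurable_fun setT u -> measurable_fun setT v ->
  ((\int[mu]_x (`|u x * v x|)%:E) ^+ 2 <=
   (\int[mu]_x (u x ^+ 2)%:E) * (\int[mu]_x (v x ^+ 2)%:E))%E.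
Proof.
move=> mu_ mv.
have := hoelder mu mu_ mv (p := 2) (q := 2).
rewrite Lnorm1 => /(_ ltac:(by []) ltac:(by []) ltac:(by field)) h.
have sq (w : T -> R) : ('N[mu]_2%:E[EFin \o w] ^+ 2 = \int[mu]_x (w x ^+ 2)%:E)%E.
  rewrite sqr_Lnorm2; apply: eq_integral => x _.
  by rewrite abse_EFin -EFin_expe real_normK ?num_real.
rewrite -!sq; set a := (X in (_ <= X ^+ 2 * _)%E); set b := (X in (_ <= _ * X ^+ 2)%E).
rewrite (_ : (a ^+ 2 * b ^+ 2 = (a * b) ^+ 2)%E); last first.
  by rewrite !expe2 muleACA.
by rewrite lee_sqr// ?mule_ge0 ?Lnorm_ge0// integral_ge0.
Qed.

Lemma eq_sqnorm f g : (forall x, cabs (f x) = cabs (g x)) -> sqnorm mu f = sqnorm mu g.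
Proof. by move=> fg; apply: eq_integral => x _; rewrite fg. Qed.

Lemma sqnorm_le f g : measurable_fun setT f -> measurable_fun setT g ->
  (forall x, cabs (f x) <= cabs (g x)) -> (sqnorm mu f <= sqnorm mu g)%E.
Proof.
move=> mf mg fg; apply: ge0_le_integral => //.
- by move=> x _; rewrite lee_fin sqr_ge0.
- exact: measurable_esqcabs.
- exact: measurable_esqcabs.
- by move=> x _; rewrite lee_fin ler_pXn2r ?nnegrE ?cabs_ge0.
Qed.

Lemma sqnormZ (c : R[i]) f : measurable_fun setT f ->
  (sqnorm mu (fun x => c * f x)%R = (cabs c ^+ 2)%:E * sqnorm mu f)%E.
Proof.
move=> mf; rewrite /sqnorm -ge0_integralZl//.
- by apply: eq_integral => x _; rewrite cabsM exprMn EFinM.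
- exact: measurable_esqcabs.
- by move=> x _; rewrite lee_fin sqr_ge0.
- by rewrite lee_fin sqr_ge0.
Qed.

Lemma sqnorm_weighted (t : R) f g : 0 < t ->
  measurable_fun setT f -> measurable_fun setT g ->
  (sqnorm mu f <= (1 + t)%:E * sqnorm mu g +
     (1 + t^-1)%:E * sqnorm mu (fun x => f x - g x)%R)%E.
Proof.
move=> t0 mf mg; have t1 : 0 <= 1 + t by rewrite addr_ge0// ltW.
have t2 : 0 <= 1 + t^-1 by rewrite addr_ge0// invr_ge0 ltW.
have mfg : measurable_fun setT (fun x => f x - g x) by exact: measurable_csub.
rewrite /sqnorm -!ge0_integralZl//; last 4 first.
- exact: measurable_esqcabs.
- by move=> x _; rewrite lee_fin sqr_ge0.
- exact: measurable_esqcabs.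
- by move=> x _; rewrite lee_fin sqr_ge0.
rewrite -ge0_integralD//; last 4 first.
- by move=> x _; rewrite lee_fin mulr_ge0 ?sqr_ge0.
- by apply: measurable_funeM; exact: measurable_esqcabs.
- by move=> x _; rewrite lee_fin mulr_ge0 ?sqr_ge0.
- by apply: measurable_funeM; exact: measurable_esqcabs.
apply: ge0_le_integral => //.
- by move=> x _; rewrite lee_fin sqr_ge0.
- exact: measurable_esqcabs.
- by apply: emeasurable_funD; apply: measurable_funeM; exact: measurable_esqcabs.
- by move=> x _; rewrite -!EFinM -EFinD lee_fin sqr_cabs_le_weighted.
Qed.

Lemma sqnormN f : sqnorm mu (fun x => - f x) = sqnorm mu f.
Proof. by apply: eq_sqnorm => x; rewrite cabsN. Qed.

Lemma sqnorm_sub_sym f g :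
  sqnorm mu (fun x => f x - g x) = sqnorm mu (fun x => g x - f x).
Proof. by apply: eq_sqnorm => x; rewrite -cabsN opprB. Qed.

Lemma sqnormD_le f g : measurable_fun setT f -> measurable_fun setT g ->
  (sqnorm mu (fun x => f x + g x)%R <= 2%:E * sqnorm mu f + 2%:E * sqnorm mu g)%E.
Proof.
move=> mf mg; have := @sqnorm_weighted 1 (fun x => f x + g x) f ltr01
  (measurable_cadd mf mg) mf.
rewrite invr1 (_ : (1 + 1 = 2 :> R))//.
by rewrite (_ : (fun x => f x + g x - f x) = g)//; apply/funext => x; ring.
Qed.

Lemma sqnorm_fin_add f g : measurable_fun setT f -> measurable_fun setT g ->
  (sqnorm mu f < +oo)%E -> (sqnorm mu g < +oo)%E ->
  (sqnorm mu (fun x => f x + g x)%R < +oo)%E.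
Proof.
move=> mf mg fo go; apply: le_lt_trans (sqnormD_le mf mg) _.
by rewrite lte_add_pinfty// lte_mul_pinfty// ge0_fin_numE// sqnorm_ge0.
Qed.

Lemma sqnorm_fin_sub f g : measurable_fun setT f -> measurable_fun setT g ->
  (sqnorm mu f < +oo)%E -> (sqnorm mu g < +oo)%E ->
  (sqnorm mu (fun x => f x - g x)%R < +oo)%E.
Proof.
move=> mf mg fo go; apply: sqnorm_fin_add => //; first exact: measurable_copp.
by rewrite sqnormN.
Qed.

Lemma sqnorm_integrable f : measurable_fun setT f -> (sqnorm mu f < +oo)%E ->
  mu.-integrable setT (fun x => (cabs (f x) ^+ 2)%:E).
Proof.
move=> mf fo; apply/integrableP; split; first exact: measurable_esqcabs.
by under eq_integral do rewrite abse_EFin ger0_norm ?sqr_ge0//.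
Qed.

(** 2|fg| <= |f|^2 + |g|^2. *)
Lemma cintegrable_mul2 f g : measurable_fun setT f -> measurable_fun setT g ->
  (sqnorm mu f < +oo)%E -> (sqnorm mu g < +oo)%E ->
  cintegrable mu (fun x => f x * g x).
Proof.
move=> mf mg fo go.
apply: (@cintegrable_le _ _ _ _ _ (fun x => cabs (f x) ^+ 2 + cabs (g x) ^+ 2)).
- exact: measurable_cmul.
- rewrite (_ : _ \o _ = fun x => ((cabs (f x) ^+ 2)%:E + (cabs (g x) ^+ 2)%:E)%E)//.
  by apply: integrableD => //; exact: sqnorm_integrable.
- move=> x; rewrite cabsM ger0_norm ?addr_ge0 ?sqr_ge0//.
  have := sqr_ge0 (cabs (f x) - cabs (g x)).
  by rewrite sqrrB; have := cabs_ge0 (f x); have := cabs_ge0 (g x); nra.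
Qed.

Lemma cabs_Cint_mul_le f g : measurable_fun setT f -> measurable_fun setT g ->
  (((cabs (Cint mu (fun x => f x * g x)%R)) ^+ 2)%:E <= sqnorm mu f * sqnorm mu g)%E.
Proof.
move=> mf mg.
apply: le_trans (cauchy_schwarz (measurable_cabsT mf) (measurable_cabsT mg)).
rewrite EFin_expe lee_sqr ?lee_fin ?cabs_ge0//; last first.
  by apply: integral_ge0 => x _; rewrite lee_fin.
apply: le_trans (cabs_Cint_le mu (measurable_cmul mf mg)) _.
rewrite le_eqVlt; apply/orP; left; apply/eqP; apply: eq_integral => x _.
by rewrite cabsM ger0_norm// mulr_ge0 ?cabs_ge0.
Qed.

Lemma ae_eq_sqnorm f g : measurable_fun setT f -> measurable_fun setT g ->
  f = g %[ae mu] -> sqnorm mu f = sqnorm mu g.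
Proof.
move=> mf mg fg; apply: ge0_ae_eq_integral => //.
- exact: measurable_esqcabs.
- exact: measurable_esqcabs.
- by move=> x _; rewrite lee_fin sqr_ge0.
- by move=> x _; rewrite lee_fin sqr_ge0.
- by apply: filterS fg => x /(_ I) -> _.
Qed.

Lemma ae_eq_norm1 f g : measurable_fun setT f -> measurable_fun setT g ->
  f = g %[ae mu] -> norm1 mu f = norm1 mu g.
Proof.
move=> mf mg fg; apply: ge0_ae_eq_integral => //.
- exact: measurable_ecabs.
- exact: measurable_ecabs.
- by move=> x _; rewrite lee_fin cabs_ge0.
- by move=> x _; rewrite lee_fin cabs_ge0.
- by apply: filterS fg => x /(_ I) -> _.
Qed.

Lemma ae_eq_Cint f g : measurable_fun setT f -> measurable_fun setT g ->
  f = g %[ae mu] -> Cint mu f = Cint mu g.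
Proof.
move=> mf mg fg; apply: complexP; rewrite !(Re_Cint,Im_Cint) /Rintegral;
  congr fine; apply: ae_eq_integral => //.
- by apply/measurable_EFinP; exact: measurable_ReT.
- by apply/measurable_EFinP; exact: measurable_ReT.
- by apply: filterS fg => x /(_ I) -> _.
- by apply/measurable_EFinP; exact: measurable_ImT.
- by apply/measurable_EFinP; exact: measurable_ImT.
- by apply: filterS fg => x /(_ I) -> _.
Qed.

End Ltwo.

Section truncation.
Context {R : realType} {d : measure_display} {T : measurableType d}.
Variable mu : {measure set T -> \bar R}.
Variable F : nat -> set T.
Hypothesis mF : forall k, measurable (F k).
Implicit Types f g : T -> R[i].

(** Both the argument and the value are cut off, so that the truncation of a
    square integrable function is bounded and integrable. *)
Definition trunc f k x : R[i] :=
  if (x \in F k) && (cabs (f x) <= k%:R) then f x else 0.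

Lemma measurable_trunc f k : measurable_fun setT f -> measurable_fun setT (trunc f k).
Proof.
move=> mf; apply: measurable_fun_ifT => //.
apply: measurable_and.
  apply: (measurable_fun_bool true).
  rewrite (_ : _ @^-1` _ = F k) ?setTI//.
  by apply/seteqP; split => x /=; [move=> /set_mem|move=> /mem_set].
by apply: measurable_fun_ler => //; exact: measurable_cabsT.
Qed.

Lemma trunc_le f k x : cabs (trunc f k x) <= cabs (f x).
Proof. by rewrite /trunc; case: ifP => // _; rewrite cabs0 cabs_ge0. Qed.

Lemma trunc_bound f k x : cabs (trunc f k x) <= k%:R * \1_(F k) x.
Proof.
rewrite /trunc indicE; case: ifPn => [/andP[-> h]|_]; first by rewrite mulr1.
by rewrite cabs0 mulr_ge0.
Qed.

Hypothesis F_cover : forall x, \forall k \near \oo, F k x.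

Lemma trunc_near f x : \forall k \near \oo, trunc f k x = f x.
Proof.
have := nbhs_infty_ger (cabs (f x)).
apply: filterS2 (F_cover x) => k Fx kx.
by rewrite /trunc mem_set//= ifT.
Qed.

(** Dominated convergence, with majorant |f|^2. *)
Lemma sqnorm_trunc_cvg f : measurable_fun setT f -> (sqnorm mu f < +oo)%E ->
  sqnorm mu (fun x => f x - trunc f k x) @[k --> \oo] --> (0 : \bar R).
Proof.
move=> mf foo.
rewrite (_ : 0%E = (\int[mu]_x (cst 0 x))%E :> \bar R); last by rewrite integral0.
have fi := sqnorm_integrable mf foo.
apply: (@dominated_cvg _ _ _ mu setT _ _ (cst 0) (fun x => (cabs (f x) ^+ 2)%:E)) => //.
- move=> n; apply: measurable_esqcabs; apply: measurable_csub => //.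
  exact: measurable_trunc.
- move=> x _; apply: cvg_near_cst; apply: filterS (trunc_near f x) => k ->.
  by rewrite subrr cabs0 expr0n.
- move=> n x _; rewrite abse_EFin ger0_norm ?sqr_ge0// lee_fin.
  rewrite ler_pXn2r ?nnegrE ?cabs_ge0// /trunc.
  by case: ifP => _; rewrite ?subrr ?subr0 ?cabs0 ?cabs_ge0.
Qed.

Lemma norm1_trunc f k : measurable_fun setT f -> (mu (F k) < +oo)%E ->
  (norm1 mu (trunc f k) < +oo)%E.
Proof.
move=> mf muF.
apply: (@le_lt_trans _ _ (\int[mu]_x (k%:R%:E * (\1_(F k) x)%:E))%E).
  apply: ge0_le_integral => //.
  - by move=> x _; rewrite lee_fin cabs_ge0.
  - by apply: measurable_ecabs; exact: measurable_trunc.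
  - by apply: measurable_funeM; apply/measurable_EFinP; exact: measurable_indic.
  - by move=> x _; rewrite -EFinM lee_fin trunc_bound.
rewrite ge0_integralZl//; last by apply/measurable_EFinP; exact: measurable_indic.
by rewrite integral_indic// setIT lte_mul_pinfty.
Qed.

End truncation.

(** * Changes of variables *)

Section scaling_map.
Context {R : realType} {d d' : measure_display}.
Context {S : measurableType d} {T : measurableType d'}.
Variables (nu : {measure set S -> \bar R}) (mu : {measure set T -> \bar R}).

(** All that integration by substitution needs. Neither an inverse nor a
    derivative of phi enters, so the same lemmas serve the affine maps of R^d and
    the identification of R x R^n with R^(n+1). *)
Definition scales_between (phi : S -> T) (c : R) :=
  [/\ measurable_fun setT phi, 0 <= c &
      forall A, measurable A -> nu (phi @^-1` A) = (c%:E * mu A)%E].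

Variables (phi : S -> T) (c : R).
Hypothesis phic : scales_between phi c.

Lemma ge0_integral_scales (f : T -> \bar R) :
  measurable_fun setT f -> (forall x, 0 <= f x)%E ->
  (\int[nu]_x f (phi x) = c%:E * \int[mu]_x f x)%E.
Proof.
move=> mf f0; have [mphi c0 hc] := phic.
have := @ge0_integral_pushforward _ _ _ _ R phi mphi nu setT f measurableT mf
  (fun y _ => f0 y).
rewrite preimage_setT => <-.
rewrite [LHS](eq_measure_integral (mscale (NngNum c0) mu)); last first.
  by move=> A mA _; exact: hc.
by rewrite ge0_integral_mscale.
Qed.

Lemma norm1_scales (f : T -> R[i]) : measurable_fun setT f ->
  norm1 nu (fun x => f (phi x)) = (c%:E * norm1 mu f)%E.
Proof.
move=> mf; apply: (ge0_integral_scales (f := fun x => (cabs (f x))%:E)).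
  exact: measurable_ecabs.
by move=> x; rewrite lee_fin cabs_ge0.
Qed.

Lemma sqnorm_scales (f : T -> R[i]) : measurable_fun setT f ->
  sqnorm nu (fun x => f (phi x)) = (c%:E * sqnorm mu f)%E.
Proof.
move=> mf; apply: (ge0_integral_scales (f := fun x => (cabs (f x) ^+ 2)%:E)).
  exact: measurable_esqcabs.
by move=> x; rewrite lee_fin sqr_ge0.
Qed.

Lemma cintegrable_scales (f : T -> R[i]) : cintegrable mu f ->
  cintegrable nu (fun x => f (phi x)).
Proof.
move=> [mf foo]; have [mphi c0 hc] := phic; split.
  exact: measurableT_comp mf mphi.
by rewrite norm1_scales// lte_mul_pinfty.
Qed.

Lemma Rintegral_scales (u : T -> R) : mu.-integrable setT (EFin \o u) ->
  \int[nu]_x u (phi x) = c * \int[mu]_x u x.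
Proof.
move=> iu; have mu_ : measurable_fun setT (EFin \o u) := measurable_int mu iu.
have pf : (\int[mu]_x (EFin \o u)^\+ x)%E \is a fin_num.
  by apply: integrable_fin_num => //; exact: integrable_funepos.
have nf : (\int[mu]_x (EFin \o u)^\- x)%E \is a fin_num.
  by apply: integrable_fin_num => //; exact: integrable_funeneg.
rewrite /Rintegral [in LHS]integralE [in RHS]integralE.
have -> : (\int[nu]_x (EFin \o u \o phi)^\+ x = c%:E * \int[mu]_x (EFin \o u)^\+ x)%E.
  by rewrite funepos_comp (ge0_integral_scales (f := (EFin \o u)^\+%E))//;
    exact: measurable_funepos.
have -> : (\int[nu]_x (EFin \o u \o phi)^\- x = c%:E * \int[mu]_x (EFin \o u)^\- x)%E.
  by rewrite funeneg_comp (ge0_integral_scales (f := (EFin \o u)^\-%E))//;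
    exact: measurable_funeneg.
by rewrite -muleBr// ?fin_num_adde_defr// fineM// fin_numB pf nf.
Qed.

Lemma Cint_scales (f : T -> R[i]) : cintegrable mu f ->
  Cint nu (fun x => f (phi x)) = c%:C * Cint mu f.
Proof.
move=> fi; apply: complexP.
- by rewrite cReM !Re_Cint /= mul0r subr0 (Rintegral_scales (cintegrable_Re fi)).
- by rewrite cImM !Im_Cint /= mul0r addr0 (Rintegral_scales (cintegrable_Im fi)).
Qed.

Lemma ae_scales (P : set T) : {ae mu, forall x, P x} ->
  {ae nu, forall x, P (phi x)}.
Proof.
have [mphi c0 hc] := phic.
move=> [N [mN N0 PN]]; exists (phi @^-1` N); split.
- by rewrite -[X in measurable X]setTI; exact: mphi.
- by rewrite hc// N0 mule0.
- by move=> x /= nP; apply: PN.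
Qed.

End scaling_map.

Notation scales_by mu := (scales_between mu mu).

Lemma scales_by_comp (R : realType) (d : measure_display) (T : measurableType d)
    (mu : {measure set T -> \bar R}) (f g : T -> T) (c k : R) :
  scales_by mu f c -> scales_by mu g k -> scales_by mu (f \o g) (k * c).
Proof.
move=> [mf c0 hf] [mg k0 hg]; split; first exact: measurableT_comp.
  exact: mulr_ge0.
move=> A mA; rewrite EFinM -muleA -hf// -hg//.
by rewrite -[X in measurable X]setTI; exact: mf.
Qed.

Lemma scales_by_prod (R : realType) (d1 d2 : measure_display)
    (T1 : measurableType d1) (T2 : measurableType d2)
    (m1 : {sigma_finite_measure set T1 -> \bar R})
    (m2 : {sigma_finite_measure set T2 -> \bar R})
    (f1 : T1 -> T1) (f2 : T2 -> T2) (c1 c2 : R) :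
  scales_by m1 f1 c1 -> scales_by m2 f2 c2 ->
  scales_by (m1 \x m2)%E (fun z => (f1 z.1, f2 z.2)) (c1 * c2).
Proof.
move=> [mf1 c10 h1] [mf2 c20 h2].
have mf : measurable_fun setT (fun z : T1 * T2 => (f1 z.1, f2 z.2)).
  by apply: measurable_fun_pair; apply: measurableT_comp.
split => //; first exact: mulr_ge0.
move=> A mA.
rewrite /product_measure1/=.
transitivity (\int[m1]_x (c2%:E * m2 (xsection A (f1 x))))%E.
  apply: eq_integral => x _; rewrite -h2; last exact: measurable_xsection.
  by congr (m2 _); apply/seteqP; split => y; rewrite /xsection /= !inE.
rewrite ge0_integralZl//; last first.
  exact: (measurableT_comp (measurable_fun_xsection m2 mA) mf1).
rewrite (ge0_integral_scales (f := fun x => m2 (xsection A x)) (And3 mf1 c10 h1))//.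
  by rewrite muleA EFinM (muleC c1%:E).
exact: measurable_fun_xsection.
Qed.

Section line.
Context {R : realType}.
Notation L := (@lebesgue_measure R).

(** Translations and dilations act on half-open intervals in the expected way,
    and a measure on the line is determined by its values there. *)
Lemma scales_by_translation (s : R) :
  scales_by L (fun x : measurableTypeR R => x + s) 1.
Proof.
have mphi : measurable_fun setT (fun x : measurableTypeR R => x + s : measurableTypeR R).
  by apply: measurable_funD.
split => // A mA; rewrite mul1e; apply/esym.
change (L A = pushforward L (fun x : measurableTypeR R => x + s : measurableTypeR R) A).
apply: lebesgue_measure_unique => //= _ [[a b]] _ <-; rewrite /pushforward.
rewrite (_ : _ @^-1` _ = `]a - s, b - s]%classic); last first.
  by apply/seteqP; split => x /=; rewrite !in_itv/= ltrBlDr lerBrDr.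
rewrite !lebesgue_measure_itv/= !lte_fin ltrD2r.
by rewrite !EFinB; case: ifP => // _; rewrite -!EFinB; congr EFin; ring.
Qed.

Lemma scales_by_dilation (c : R) : 0 < c ->
  scales_by L (fun x : measurableTypeR R => c * x) c^-1.
Proof.
move=> c0.
have mphi : measurable_fun setT (fun x : measurableTypeR R => c * x : measurableTypeR R).
  by apply: measurable_funM.
split => //; first by rewrite invr_ge0 ltW.
move=> A mA.
suff key : L A = (c%:E * pushforward L (fun x : measurableTypeR R => (c * x)%R : measurableTypeR R) A)%E.
  apply: etrans (congr1 (fun z => (c^-1)%:E * z)%E (esym key)).
  by rewrite muleA -EFinM mulVf ?gt_eqF// mul1e.
have c0' : 0 <= c by exact: ltW.
change (L A = pushforward (mscale (NngNum c0') L) (fun x : measurableTypeR R => (c * x)%R : measurableTypeR R) A).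
apply: lebesgue_measure_unique => //= _ [[a b]] _ <-; rewrite /pushforward /mscale/=.
rewrite (_ : _ @^-1` _ = `]a / c, b / c]%classic); last first.
  by apply/seteqP; split => x /=; rewrite !in_itv/= ltr_pdivrMr// ler_pdivlMr// mulrC.
rewrite !lebesgue_measure_itv/= !lte_fin ltr_pM2r ?invr_gt0//.
case: ifP => _; last by rewrite mule0.
by rewrite -!EFinB -EFinM; congr EFin; field; rewrite gt_eqF.
Qed.

Lemma scales_by_opp : scales_by L (fun x : measurableTypeR R => - x) 1.
Proof.
split => //; first exact: oppr_measurable.
by move=> A mA; rewrite mul1e; exact: lebesgue_measureN.
Qed.

End line.

(** * The exponential damping factor and its transform *)

Section poisson.
Context {R : realType}.
Notation L := (@lebesgue_measure R).

(** H is nonnegative thanks to the constant 1, which makes the fundamental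
    theorem of calculus on an unbounded interval applicable; its contribution is
    subtracted afterwards. F is the primitive of H that vanishes at infinity. *)
Let H (b c x : R) := expR (- (c * x)) * (1 + cos (b * x)).
Let F (b c x : R) := expR (- (c * x)) *
  ((b * sin (b * x) - c * cos (b * x)) / (c ^+ 2 + b ^+ 2) - c^-1).

Let is_derive_lin (k x : R) : is_derive x 1 (fun x : R => k * x) k.
Proof. by apply: is_derive_eq; rewrite /GRing.scale/= mulr1. Qed.

Let is_derive_F (b c x : R) : 0 < c -> is_derive x 1 (F b c) (H b c x).
Proof.
move=> c0; have D0 : c ^+ 2 + b ^+ 2 != 0.
  by rewrite gt_eqF// ltr_pwDl ?sqr_ge0// exprn_gt0.
have de : is_derive x 1 (fun x => expR (- (c * x))) (expR (- (c * x)) * (- c)).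
  have hn : is_derive x 1 (fun x : R => - (c * x)) (- c).
    exact: is_deriveN (is_derive_lin c x).
  exact: (is_derive1_comp (f := expR) (g := fun x => - (c * x)) (is_derive_expR _) hn).
have ds : is_derive x 1 (fun x => sin (b * x)) (cos (b * x) * b).
  exact: (is_derive1_comp (f := sin) (g := fun x => b * x) (is_derive_sin _) (is_derive_lin b x)).
have dc : is_derive x 1 (fun x => cos (b * x)) (- sin (b * x) * b).
  exact: (is_derive1_comp (f := cos) (g := fun x => b * x) (is_derive_cos _) (is_derive_lin b x)).
rewrite /F; apply: is_derive_eq.
rewrite /H /GRing.scale/=.
have c0' : c != 0 by rewrite gt_eqF.
field; by rewrite c0' D0.
Qed.

Let continuous_lin (k : R) : continuous (fun x : R => k * x).
Proof. exact: mulrl_continuous. Qed.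

Let continuous_H (b c : R) : continuous (H b c).
Proof.
move=> x; apply: (@continuousM R R^o (fun x => expR (- (c * x))) (fun x => 1 + cos (b * x))).
  apply: (@continuous_comp _ _ _ (fun x => - (c * x)) expR); last exact: continuous_expR.
  by apply: continuousN; exact: continuous_lin.
apply: (@continuousD R R^o R^o (cst 1) (fun x => cos (b * x))); first exact: cst_continuous.
apply: (@continuous_comp _ _ _ (fun x => b * x) cos); last exact: continuous_cos.
exact: continuous_lin.
Qed.

Let H_ge0 b c x : 0 <= H b c x.
Proof.
by rewrite mulr_ge0 ?expR_ge0// -lerBlDl sub0r cos_geN1.
Qed.

Let cvg_expRN (c : R) : 0 < c -> expR (- (c * x)) @[x --> +oo] --> (0 : R).
Proof.
move=> c0; apply: (@cvg_comp _ _ _ (fun x : R => c * x) (fun x => expR (- x))); last exact: cvgr_expR.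
exact: gt0_cvgMry.
Qed.

Let F_cvg b c : 0 < c -> F b c x @[x --> +oo] --> (0 : R).
Proof.
move=> c0; set K := (`|b| + c) / (c ^+ 2 + b ^+ 2) + c^-1.
have D0 : 0 < c ^+ 2 + b ^+ 2 by rewrite ltr_pwDl ?sqr_ge0// exprn_gt0.
have bnd x : `|F b c x| <= K * expR (- (c * x)).
  rewrite /F normrM (ger0_norm (expR_ge0 _)) mulrC ler_wpM2r ?expR_ge0//.
  apply: le_trans (ler_normB _ _) _; rewrite /K; apply: lerD; last first.
    by rewrite ger0_norm ?invr_ge0 ?(ltW c0).
  rewrite normrM (@ger0_norm _ (_^-1)) ?invr_ge0 ?(ltW D0)//.
  rewrite ler_wpM2r ?invr_ge0 ?(ltW D0)// (le_trans (ler_normB _ _))//.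
  rewrite !normrM lerD//.
    by rewrite ler_piMr// ler_norml sin_geN1 sin_le1.
  by rewrite (ger0_norm (ltW c0)) ler_piMr// ?(ltW c0)// ler_norml cos_geN1 cos_le1.
have hK : (fun x => K * expR (- (c * x))) @ +oo --> (0 : R).
  rewrite -(mulr0 K); apply: cvgM; [exact: cvg_cst|exact: cvg_expRN].
apply: (@squeeze_cvgr _ _ _ _ (fun x => - (K * expR (- (c * x))))
  (fun x => K * expR (- (c * x)))) => //.
- by near=> x; rewrite -ler_norml.
- by rewrite -oppr0; apply: cvgN.
Unshelve. all: by end_near. Qed.

Let integral_half b c : 0 < c ->
  (\int[L]_(x in `[0%R, +oo[) (H b c x)%:E = (c^-1 + c / (c ^+ 2 + b ^+ 2))%:E)%E.
Proof.
move=> c0.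
have cF : continuous (F b c).
  move=> x; apply: differentiable_continuous; apply/derivable1_diffP.
  by have /@ex_derive := is_derive_F b x c0.
rewrite (@ge0_continuous_FTC2y _ (H b c) (F b c) 0 0)//.
- rewrite sub0e -EFinN; congr EFin.
  by rewrite /F !mulr0 oppr0 expR0 sin0 cos0; ring.
- by apply: continuous_subspaceT; exact: continuous_H.
- exact: F_cvg.
- by apply: cvg_at_right_filter; exact: cF.
- by move=> x _; rewrite derive1E; have /@derive_val := is_derive_F b x c0.
Qed.

Definition decay (c x : R) := expR (- (c * `|x|)).

Lemma decay_ge0 c x : 0 <= decay c x. Proof. exact: expR_ge0. Qed.

Lemma continuous_decay c : continuous (decay c).
Proof.
move=> x; apply: (@continuous_comp _ _ _ (fun x => - (c * `|x|)) expR); last exact: continuous_expR.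
apply: continuousN; apply: continuousM; first exact: cst_continuous.
exact: norm_continuous.
Qed.

Lemma measurable_decay c : measurable_fun setT (decay c).
Proof. by apply: continuous_measurable_fun; exact: continuous_decay. Qed.

Let integral_decay_1cos b c : 0 < c ->
  (\int[L]_x (decay c x * (1 + cos (b * x)))%:E =
   (2 * (c^-1 + c / (c ^+ 2 + b ^+ 2)))%:E)%E.
Proof.
move=> c0; rewrite ge0_symfun_integralT.
- rewrite (_ : [set x | (0 <= x)%R] = `[0%R, +oo[%classic); last first.
    by apply/seteqP; split => x /=; rewrite in_itv/= andbT.
  rewrite EFinM -integral_half//; congr (_ * _)%E; apply: eq_integral => x.
  by rewrite inE/= in_itv/= andbT => x0; rewrite /decay /H ger0_norm.
- by move=> x; rewrite mulr_ge0 ?decay_ge0// -lerBlDl sub0r cos_geN1.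
- move=> x; apply: (@continuousM R R^o (decay c) (fun x => 1 + cos (b * x))).
    exact: continuous_decay.
  apply: (@continuousD R R^o R^o (cst 1) (fun x => cos (b * x))); first exact: cst_continuous.
  apply: (@continuous_comp _ _ _ (fun x => b * x) cos); last exact: continuous_cos.
  exact: continuous_lin.
- by move=> x /=; rewrite /decay normrN mulrN cosN.
Qed.

Lemma integral_decay c : 0 < c -> (\int[L]_x (decay c x)%:E = (2 / c)%:E)%E.
Proof.
move=> c0; have := integral_decay_1cos 0 c0.
under eq_integral do rewrite mul0r cos0 EFinM muleC.
rewrite ge0_integralZl//; last 2 first.
- by apply/measurable_EFinP; exact: measurable_decay.
- by move=> x _; rewrite lee_fin decay_ge0.
move=> h; have : (2^-1%:E * ((1 + 1 : R)%:E * \int[L]_x (decay c x)%:E) = (2 / c)%:E)%E.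
  by rewrite h -EFinM; congr EFin; field; rewrite gt_eqF.
by rewrite muleA -EFinM (_ : 2^-1 * (1 + 1) = 1)%R ?mul1e//; field.
Qed.

Lemma integrable_decay c : 0 < c -> L.-integrable setT (EFin \o decay c).
Proof.
move=> c0; apply/integrableP; split.
  by apply/measurable_EFinP; exact: measurable_decay.
under eq_integral do rewrite /= ger0_norm ?decay_ge0//.
by rewrite integral_decay// ltry.
Qed.

(** The real part is what remains of the integral of H after subtracting the
    constant; the imaginary part vanishes by oddness. *)
Lemma Cint_decay_cexpi b c : 0 < c ->
  Cint L (fun x => (decay c x)%:C * cexpi (b * x)) =
  (2 * c / (c ^+ 2 + b ^+ 2))%:C.
Proof.
move=> c0.
have mb : measurable_fun setT (fun x : measurableTypeR R => b * x).
  by apply: continuous_measurable_fun; exact: continuous_lin.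
have ci : cintegrable L (fun x => (decay c x)%:C * cexpi (b * x)).
  apply: (@cintegrable_le R _ (measurableTypeR R) L _ (decay c)) => //.
  - apply: measurable_cmul; first by apply: measurable_realC; exact: measurable_decay.
    exact: measurable_cexpi.
  - exact: integrable_decay.
  - by move=> x; rewrite cabsM cabs_cexpi mulr1 cabs_real.
have D0 : c ^+ 2 + b ^+ 2 != 0.
  by rewrite gt_eqF// ltr_pwDl ?sqr_ge0// exprn_gt0.
apply: complexP.
- rewrite Re_Cint /=; have ri := cintegrable_Re ci.
  have h : \int[L]_x (decay c x * (1 + cos (b * x))) =
      \int[L]_x decay c x + \int[L]_x complex.Re ((decay c x)%:C * cexpi (b * x)).
    rewrite -RintegralD//; last exact: integrable_decay.
    by apply: eq_Rintegral => x _; rewrite cReM /= mul0r subr0 mulrDr mulr1.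
  move: h; rewrite {1 2}/Rintegral integral_decay_1cos// integral_decay//=.
  move=> /esym/eqP; rewrite addrC eq_sym -subr_eq => /eqP <-.
  by field; rewrite (gt_eqF c0) D0.
- have ii := cintegrable_Im ci; rewrite Im_Cint /=.
  have h : \int[L]_x complex.Im ((decay c (- x))%:C * cexpi (b * (- x))) +
      \int[L]_x complex.Im ((decay c x)%:C * cexpi (b * x)) = 0.
    rewrite -RintegralD//; last first.
      exact: cintegrable_Im (cintegrable_scales (@scales_by_opp R) ci).
    rewrite /Rintegral; under eq_integral => x _.
      rewrite !cImM /= !mul0r !addr0 /decay normrN mulrN sinN mulrN addNr.
      over.
    by rewrite integral0.
  move: h; have /= := Rintegral_scales (@scales_by_opp R) ii.
  by rewrite mul1r => -> /eqP; rewrite -mulr2n mulrn_eq0 /= => /eqP.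
Qed.

End poisson.

(** * Fourier transform and Poisson kernel on the line *)

Section cvg0.
Context {R : realType}.
Implicit Types a : nat -> \bar R.

Lemma ge0_cvge0P a : (forall n, 0 <= a n)%E ->
  (a n @[n --> \oo] --> (0 : \bar R)) <->
  (forall e : R, 0 < e -> \forall n \near \oo, (a n <= e%:E)%E).
Proof.
move=> a0; split=> [|h].
  move=> /fine_cvgP[afin /cvgrPdist_le h] e e0.
  apply: filterS2 afin (h e e0) => n an; rewrite sub0r normrN => hn.
  by rewrite -(fineK an) lee_fin (le_trans (ler_norm _) hn).
apply/fine_cvgP; split.
  apply: filterS (h 1 ltr01) => n an.
  by rewrite ge0_fin_numE// (le_lt_trans an)// ltry.
apply/cvgrPdist_le => e e0; apply: filterS (h e e0) => n an.
rewrite sub0r normrN ger0_norm ?fine_ge0//= -lee_fin fineK//.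
by rewrite ge0_fin_numE// (le_lt_trans an)// ltry.
Qed.

End cvg0.

Lemma cintegrable_bounded {R : realType} {d : measure_display} {T : measurableType d}
    (m : {measure set T -> \bar R}) (M : R) (h k : T -> R[i]) :
  cintegrable m h -> measurable_fun setT k -> (forall x, cabs (k x) <= M) ->
  cintegrable m (fun x => h x * k x).
Proof.
move=> hi mk k1; have [mh _] := hi.
apply: (@cintegrable_le _ _ _ _ _ (fun z => M * cabs (h z))).
- exact: measurable_cmul.
- rewrite (_ : _ \o _ = fun z => (M%:E * (cabs (h z))%:E)%E)//.
  by apply: integrableZl => //; exact: cintegrable_cabs.
- move=> x; rewrite cabsM mulrC (le_trans _ (ler_norm _))//.
  by rewrite ler_wpM2r ?cabs_ge0.
Qed.

Section mult_formula.
Context {R : realType} {d1 d2 : measure_display}.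
Context {T1 : measurableType d1} {T2 : measurableType d2}.
Variables (m1 : {sigma_finite_measure set T1 -> \bar R}).
Variables (m2 : {sigma_finite_measure set T2 -> \bar R}).

Lemma norm1_tensor (f : T1 -> R[i]) (g : T2 -> R[i]) :
  measurable_fun setT f -> measurable_fun setT g ->
  norm1 (m1 \x m2)%E (fun z => f z.1 * g z.2) = (norm1 m1 f * norm1 m2 g)%E.
Proof.
move=> mf mg.
have mf1 : measurable_fun setT (fun z : T1 * T2 => f z.1) by exact: measurableT_comp mf _.
have mg2 : measurable_fun setT (fun z : T1 * T2 => g z.2) by exact: measurableT_comp mg _.
rewrite norm1_tonelli; last exact: measurable_cmul.
rewrite -[RHS]muleC /norm1 -ge0_integralZl//; last 3 first.
- exact: measurable_ecabs.
- by move=> x _; rewrite lee_fin cabs_ge0.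
- exact: norm1_ge0.
apply: eq_integral => x _; rewrite muleC -ge0_integralZl//.
- by apply: eq_integral => y _ /=; rewrite cabsM EFinM.
- exact: measurable_ecabs.
- by move=> y _; rewrite lee_fin cabs_ge0.
- by rewrite lee_fin cabs_ge0.
Qed.

Lemma cintegrable_tensor (f : T1 -> R[i]) (g : T2 -> R[i]) (e : T1 * T2 -> R[i]) :
  cintegrable m1 f -> cintegrable m2 g ->
  measurable_fun setT e -> (forall z, cabs (e z) <= 1) ->
  cintegrable (m1 \x m2)%E (fun z => f z.1 * g z.2 * e z).
Proof.
move=> [mf foo] [mg goo] me e1.
have mf1 : measurable_fun setT (fun z : T1 * T2 => f z.1) by exact: measurableT_comp mf _.
have mg2 : measurable_fun setT (fun z : T1 * T2 => g z.2) by exact: measurableT_comp mg _.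
have mt := measurable_cmul mf1 mg2.
have ti : cintegrable (m1 \x m2)%E (fun z => f z.1 * g z.2).
  split => //; rewrite norm1_tensor// lte_mul_pinfty//; first exact: norm1_ge0.
  by rewrite ge0_fin_numE ?norm1_ge0.
exact: cintegrable_bounded ti me e1.
Qed.

(** Fubini's theorem. With e the Fourier kernel, this moves the transform from
    one factor of a pairing to the other. *)
Lemma Cint_mult_formula (f : T1 -> R[i]) (g : T2 -> R[i]) (e : T1 * T2 -> R[i]) :
  cintegrable m1 f -> cintegrable m2 g ->
  measurable_fun setT e -> (forall z, cabs (e z) <= 1) ->
  Cint m2 (fun y => g y * Cint m1 (fun x => f x * e (x, y))) =
  Cint m1 (fun x => f x * Cint m2 (fun y => g y * e (x, y))).
Proof.
move=> fi gi me e1; have ti := cintegrable_tensor fi gi me e1.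
have := Cfubini_swap ti => /= h.
transitivity (Cint m2 (fun y => Cint m1 (fun x => f x * g y * e (x, y)))).
  apply: eq_cint => y; rewrite -CintZ; last first.
    by apply: (cintegrable_bounded (M := 1)) => //; exact: measurable_fun_pair1.
  by apply: eq_cint => x; rewrite mulrA (mulrC (g y)).
rewrite h; apply: eq_cint => x; rewrite -CintZ; last first.
  by apply: (cintegrable_bounded (M := 1)) => //; exact: measurable_fun_pair2.
by apply: eq_cint => y; rewrite mulrA.
Qed.

End mult_formula.

Section fourier_line.
Context {R : realType}.
Notation L := (@lebesgue_measure R).
Notation RR := (measurableTypeR R).
Implicit Types f h : RR -> R[i].

(** The one-dimensional transform on the real line itself; elements of R^1 are
    column vectors. *)
Definition fourier1 f (xi : RR) : R[i] :=
  Cint L (fun x => f x * cexpi (- (2 * pi * (x * xi)))).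

Let e (z : RR * RR) : R[i] := cexpi (- (2 * pi * (z.1 * z.2))).

Let me : measurable_fun setT e.
Proof.
apply: measurable_cexpi; apply: measurableT_comp; first exact: oppr_measurable.
by apply: measurable_funM => //; apply: measurable_funM.
Qed.

Let e1 z : cabs (e z) <= 1. Proof. by rewrite cabs_cexpi. Qed.

Lemma cabs_fourier1_le f xi : cintegrable L f ->
  cabs (fourier1 f xi) <= fine (norm1 L f).
Proof.
move=> [mf foo]; rewrite -lee_fin fineK ?ge0_fin_numE ?norm1_ge0//.
apply: le_trans (cabs_Cint_le _ _) _.
  apply: measurable_cmul => //.
  exact: (measurable_fun_pair1 (f := e)).
rewrite le_eqVlt; apply/orP; left; apply/eqP; apply: eq_integral => x _.
by rewrite cabsM cabs_cexpi mulr1.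
Qed.

Lemma measurable_fourier1 f : measurable_fun setT f -> measurable_fun setT (fourier1 f).
Proof.
move=> mf.
apply: (measurable_Cfubini L (f := fun z : RR * RR => f z.2 * e (z.2, z.1))).
apply: measurable_cmul; first exact: measurableT_comp mf _.
by apply: measurableT_comp me _; exact: measurable_fun_pair.
Qed.

Definition poisson (ep s : R) := ep / (pi * (ep ^+ 2 + s ^+ 2)).

Let pi0 : pi != 0 :> R. Proof. by rewrite gt_eqF// pi_gt0. Qed.

Let twopi_gt0 (ep : R) : 0 < ep -> 0 < 2 * pi * ep.
Proof. by move=> ?; rewrite !mulr_gt0// pi_gt0. Qed.

Lemma poisson_gt0 ep s : 0 < ep -> 0 < poisson ep s.
Proof.
move=> ep0; rewrite divr_gt0// mulr_gt0 ?pi_gt0//.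
by rewrite ltr_pwDl ?sqr_ge0// exprn_gt0.
Qed.

(** The Poisson kernel is the inverse Fourier transform of the exponential
    damping factor. *)
Lemma Cint_decay_poisson ep s : 0 < ep ->
  Cint L (fun xi : RR => (decay (2 * pi * ep) xi)%:C * cexpi (2 * pi * s * xi)) =
  (poisson ep s)%:C.
Proof.
move=> ep0; rewrite Cint_decay_cexpi ?twopi_gt0//; congr (_%:C); rewrite /poisson.
have D0 : ep ^+ 2 + s ^+ 2 != 0.
  by rewrite gt_eqF// ltr_pwDl ?sqr_ge0// exprn_gt0.
move: (pi : R) pi0 => p p0; field; rewrite D0 p0 /=.
rewrite (_ : _ + _ = (2 * p) ^+ 2 * (ep ^+ 2 + s ^+ 2)); last by ring.
by rewrite mulf_neq0// expf_neq0// mulf_neq0.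
Qed.

Lemma poisson_le ep s : 0 < ep -> poisson ep s <= (pi * ep)^-1.
Proof.
move=> ep0; have D0 : 0 < ep ^+ 2 + s ^+ 2 by rewrite ltr_pwDl ?sqr_ge0// exprn_gt0.
rewrite /poisson ler_pdivrMr ?mulr_gt0 ?pi_gt0//.
rewrite invfM mulrACA mulVf ?gt_eqF ?pi_gt0// mul1r ler_pdivlMl//.
by rewrite -expr2 lerDl sqr_ge0.
Qed.

Lemma continuous_poisson ep : 0 < ep -> continuous (poisson ep).
Proof.
move=> ep0 x; apply: (@continuousM R R^o (cst ep) (fun s => (pi * (ep ^+ 2 + s ^+ 2))^-1)).
  exact: cst_continuous.
apply: continuousV.
  rewrite mulf_neq0//; last by rewrite gt_eqF// ltr_pwDl ?sqr_ge0// exprn_gt0.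
apply: (@continuousM R R^o (cst pi) (fun s => ep ^+ 2 + s ^+ 2)); first exact: cst_continuous.
apply: (@continuousD R R^o R^o (cst (ep ^+ 2)) (fun s => s ^+ 2)); first exact: cst_continuous.
exact: exprn_continuous.
Qed.

Lemma measurable_poisson ep : 0 < ep -> measurable_fun setT (poisson ep : RR -> R).
Proof. by move=> ep0; apply: continuous_measurable_fun; exact: continuous_poisson. Qed.

Let integral_poisson1 : (\int[L]_s (poisson 1 s)%:E = 1)%E.
Proof.
rewrite ge0_symfun_integralT.
- rewrite (_ : [set x | (0 <= x)%R] = `[0%R, +oo[%classic); last first.
    by apply/seteqP; split => x /=; rewrite in_itv/= andbT.
  rewrite (_ : (\int[_]_(x in _) _)%E = (\int[L]_(x in `[0%R, +oo[) ((pi^-1)%:E * (oneDsqr x)^-1%:E))%E); last first.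
    apply: eq_integral => x _; rewrite -EFinM; congr EFin.
    by rewrite /poisson /oneDsqr expr1n div1r invfM.
  rewrite ge0_integralZl//.
  + rewrite integral0y_oneDsqr -!EFinM; congr EFin.
    by move: (pi : R) pi0 => p p0; field.
  + apply/measurable_EFinP; apply: measurable_funTS; apply: continuous_measurable_fun.
    exact: continuous_oneDsqrV.
  + by rewrite lee_fin invr_ge0 pi_ge0.
- by move=> x; apply/ltW/poisson_gt0.
- exact: continuous_poisson.
- by move=> x; rewrite /poisson /= sqrrN.
Qed.

(** Moves the width of the kernel into the argument of w: as the width tends to
    0, the weight stays fixed and only w varies. *)
Lemma integral_poisson_rescale ep (w : RR -> \bar R) : 0 < ep ->
  measurable_fun setT w -> (forall s, 0 <= w s)%E ->
  (\int[L]_s ((poisson ep s)%:E * w s) =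
   \int[L]_s ((poisson 1 s)%:E * w (ep * s)%R))%E.
Proof.
move=> ep0 mw w0.
have h := ge0_integral_scales (scales_by_dilation ep0) (f := fun s => ((poisson ep s)%:E * w s)%E).
have : (ep%:E * \int[L]_x ((poisson ep (ep * x)%R)%:E * w (ep * x)%R) =
   \int[L]_s ((poisson ep s)%:E * w s))%E.
  rewrite h; last 2 first.
  - by apply: emeasurable_funM => //; apply/measurable_EFinP; exact: measurable_poisson.
  - by move=> x; rewrite mule_ge0// lee_fin ltW// poisson_gt0.
  by rewrite muleA -EFinM mulfV ?gt_eqF// mul1e.
move=> <-; rewrite -ge0_integralZl//.
- apply: eq_integral => s _; rewrite muleA -EFinM; congr (_%:E * _)%E.
  have D0 : 1 + s ^+ 2 != 0 by rewrite gt_eqF// ltr_pwDl ?sqr_ge0.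
  have ep0' : ep != 0 by rewrite gt_eqF.
  rewrite /poisson; move: (pi : R) pi0 => p p0; field.
  rewrite p0 D0 /= (_ : _ + _ = ep ^+ 2 * (1 + s ^+ 2)); last by ring.
  by rewrite mulf_neq0// expf_neq0.
- apply: emeasurable_funM.
    apply/measurable_EFinP; apply: measurableT_comp (measurable_poisson ep0) _.
    exact: measurable_funM.
  apply: measurableT_comp mw _; exact: measurable_funM.
- by move=> x _; rewrite mule_ge0// lee_fin ltW// poisson_gt0.
- by rewrite lee_fin ltW.
Qed.

Lemma integral_poisson ep : 0 < ep -> (\int[L]_s (poisson ep s)%:E = 1)%E.
Proof.
move=> ep0; rewrite -integral_poisson1.
under eq_integral do rewrite -[_%:E]mule1.
rewrite (integral_poisson_rescale (w := cst 1%E))//.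
by apply: eq_integral => s _; rewrite mule1.
Qed.

End fourier_line.

(** * The regularised Plancherel identity *)

Section regularised.
Context {R : realType}.
Notation L := (@lebesgue_measure R).
Notation RR := (measurableTypeR R).
Implicit Types f h : RR -> R[i].

Lemma scales_by_reflection (x : R) : scales_by L (fun s : RR => x - s) 1.
Proof.
have := scales_by_comp (@scales_by_translation R x) (@scales_by_opp R).
by rewrite mul1r (_ : _ \o _ = fun s : RR => x - s)//; apply/funext => s /=; rewrite addrC.
Qed.

Definition trans_by (s : R) f : RR -> R[i] := fun x => f (x - s).

(** The squared modulus of continuity of f in L2. *)
Definition shift_defect f (s : R) : \bar R := sqnorm L (fun x => f x - trans_by s f x).

Lemma measurable_shift s f : measurable_fun setT f -> measurable_fun setT (trans_by s f).
Proof.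
by move=> mf; have [mt _ _] := @scales_by_translation R (- s); exact: measurableT_comp mf mt.
Qed.

Lemma sqnorm_shift s f : measurable_fun setT f -> sqnorm L (trans_by s f) = sqnorm L f.
Proof. by move=> mf; rewrite (sqnorm_scales (scales_by_translation (- s)))// mul1e. Qed.

Lemma shift_defect_le s f : measurable_fun setT f ->
  (shift_defect f s <= 4%:E * sqnorm L f)%E.
Proof.
move=> mf; have ms := measurable_shift s mf.
have := sqnormD_le L mf (measurable_copp ms).
rewrite sqnormN sqnorm_shift// => h; apply: le_trans h _.
by rewrite -ge0_muleDl ?lee_fin// -EFinD (_ : 2 + 2 = 4 :> R)//; ring.
Qed.

Section identity.
Variable f : RR -> R[i].
Hypothesis mf : measurable_fun setT f.
Hypothesis f1 : (norm1 L f < +oo)%E.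
Hypothesis f2 : (sqnorm L f < +oo)%E.
Variable ep : R.
Hypothesis ep0 : 0 < ep.

Let w (xi : R) := decay (2 * pi * ep) xi.
Let fi : cintegrable L f. Proof. by []. Qed.

Let twopiep : 0 < 2 * pi * ep. Proof. by rewrite !mulr_gt0// pi_gt0. Qed.

Let wi : cintegrable L (fun xi : RR => (w xi)%:C).
Proof.
apply: (@cintegrable_le R _ RR L _ (w : RR -> R)).
- by apply: measurable_realC; exact: measurable_decay.
- exact: integrable_decay.
- by move=> x; rewrite cabs_real.
Qed.

Let e (z : RR * RR) : R[i] := cexpi (- (2 * pi * (z.1 * z.2))).

Let me : measurable_fun setT e.
Proof.
apply: measurable_cexpi; apply: measurableT_comp; first exact: oppr_measurable.
by apply: measurable_funM => //; apply: measurable_funM.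
Qed.

Let e1 z : cabs (e z) <= 1. Proof. by rewrite cabs_cexpi. Qed.

Let mex x : measurable_fun setT (fun xi => e (x, xi)).
Proof. exact: (measurable_fun_pair2 (f := e)). Qed.

Let N := fine (norm1 L f).

Let gi : cintegrable L (fun xi => (w xi)%:C * conjc (fourier1 f xi)).
Proof.
apply: (@cintegrable_bounded _ _ _ _ N) => //.
- by apply: measurable_cconj; exact: measurable_fourier1.
- by move=> x; rewrite cabs_conj; exact: cabs_fourier1_le.
Qed.

Let gwi x : cintegrable L (fun xi => (w xi)%:C * conjc (e (x, xi))).
Proof.
apply: (@cintegrable_bounded _ _ _ _ 1) => //.
- by apply: measurable_cconj; exact: mex.
- by move=> y; rewrite cabs_conj.
Qed.

(** The Poisson average of f, that is, f convolved with the Poisson kernel. *)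
Let A (x : RR) := Cint L (fun y => f y * (poisson ep (x - y))%:C).

(** A first use of the multiplication formula: transforming the damped transform
    back yields the Poisson average. *)
Let inner x : Cint L (fun xi => (w xi)%:C * conjc (fourier1 f xi) * e (x, xi)) = conjc (A x).
Proof.
rewrite -[LHS]conjcK -Cint_conj; last exact: (cintegrable_bounded (M := 1) gi).
congr conjc.
transitivity (Cint L (fun xi => ((w xi)%:C * conjc (e (x, xi))) * Cint L (fun y => f y * e (y, xi)))).
  apply: eq_cint => xi; rewrite !cconjM conjcK cconj_real.
  by rewrite -[Cint _ _]/(fourier1 f xi) mulrAC.
rewrite (Cint_mult_formula fi (gwi x) me e1); apply: eq_cint => y; congr (_ * _).
rewrite -Cint_decay_poisson//; apply: eq_cint => xi.
rewrite -mulrA; congr (_ * _); rewrite /e -cexpiN -cexpiD opprK /=.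
by congr cexpi; ring.
Qed.

(** A second use of the multiplication formula. *)
Let energy_pairing :
  Cint L (fun xi => ((w xi)%:C * conjc (fourier1 f xi)) * fourier1 f xi) =
  Cint L (fun x => f x * conjc (A x)).
Proof.
rewrite (Cint_mult_formula fi gi me e1); apply: eq_cint => x.
by rewrite inner.
Qed.

(** Substituting y = x - s turns the Poisson average of f at x into an average
    over the shifts of f. *)
Let A_shift x : A x = Cint L (fun s => trans_by s f x * (poisson ep s)%:C).
Proof.
have mp := measurable_poisson ep0.
have hi : cintegrable L (fun y => f y * (poisson ep (x - y))%:C).
  apply: (@cintegrable_bounded _ _ _ _ (pi * ep)^-1) => //.
    apply: measurable_realC; apply: (measurableT_comp mp).
    by have [] := scales_by_reflection x.
  by move=> y; rewrite cabs_real ger0_norm ?(ltW (poisson_gt0 _ ep0))//; exact: poisson_le.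
have := Cint_scales (scales_by_reflection x) hi; rewrite mul1r => h.
apply: etrans (esym h) _.
by apply: eq_cint => s; rewrite /trans_by; congr (_ * (poisson ep _)%:C); ring.
Qed.

(** The autocorrelation of f. *)
Let corr (s : RR) := Cint L (fun x => f x * conjc (trans_by s f x)).

Let mshift2 : measurable_fun setT (fun z : RR * RR => trans_by z.2 f z.1).
Proof.
apply: (measurableT_comp mf); apply: measurable_funB; exact: measurable_fst || exact: measurable_snd.
Qed.

Let G (z : RR * RR) := f z.1 * conjc (trans_by z.2 f z.1) * (poisson ep z.2)%:C.

Let mG : measurable_fun setT G.
Proof.
apply: measurable_cmul; first apply: measurable_cmul.
- exact: measurableT_comp mf _.
- exact: measurable_cconj.
- by apply: measurable_realC; apply: measurableT_comp (measurable_poisson ep0) _.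
Qed.

Let corr_integrable s : cintegrable L (fun x => f x * conjc (trans_by s f x)).
Proof.
apply: cintegrable_mul2 => //; first by apply: measurable_cconj; exact: measurable_shift.
rewrite (@eq_sqnorm _ _ _ L _ (trans_by s f)); last by move=> x; rewrite cabs_conj.
by rewrite sqnorm_shift.
Qed.

Let corr_norm1 s : (norm1 L (fun x => f x * conjc (trans_by s f x))%R <= sqnorm L f)%E.
Proof.
have ms := measurable_shift s mf.
rewrite -lee_sqr ?norm1_ge0 ?sqnorm_ge0//.
apply: (@le_trans _ _ (sqnorm L f * sqnorm L (trans_by s f))%E).
  apply: le_trans (cauchy_schwarz L (measurable_cabsT mf) (measurable_cabsT ms)).
  rewrite lee_sqr ?norm1_ge0//; last by apply: integral_ge0 => x _; rewrite lee_fin.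
  rewrite le_eqVlt; apply/orP; left; apply/eqP; apply: eq_integral => x _.
  by rewrite cabsM cabs_conj ger0_norm// mulr_ge0 ?cabs_ge0.
by rewrite sqnorm_shift// expe2.
Qed.

Let Gi : cintegrable (L \x L)%E G.
Proof.
split => //.
have -> : norm1 (L \x L)%E G = (\int[L]_s \int[L]_x (cabs (G (x, s)))%:E)%E.
  apply: (fubini_tonelli2 (fun z => (cabs (G z))%:E)); first exact: measurable_ecabs.
  by move=> z; rewrite lee_fin cabs_ge0.
apply: (@le_lt_trans _ _ (\int[L]_s (sqnorm L f * (poisson ep s)%:E))%E).
  apply: ge0_le_integral => //.
  - by move=> s _; apply: integral_ge0 => x _; rewrite lee_fin cabs_ge0.
  - apply: (measurable_fun_fubini_tonelli_G (m1 := L) (fun z => (cabs (G z))%:E)).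
      exact: measurable_ecabs.
    by move=> z; rewrite lee_fin cabs_ge0.
  - by apply: measurable_funeM; apply/measurable_EFinP; exact: measurable_poisson.
  move=> s _; rewrite muleC.
  rewrite (_ : (\int[L]_x _ = (poisson ep s)%:E * norm1 L (fun x => f x * conjc (trans_by s f x))%R)%E).
    by rewrite lee_wpmul2l// lee_fin ltW// poisson_gt0.
  rewrite /norm1 -ge0_integralZl//.
  - apply: eq_integral => x _; rewrite /G /= cabsM cabs_real ger0_norm ?(ltW (poisson_gt0 _ ep0))//.
    by rewrite mulrC EFinM.
  - by apply: measurable_ecabs; have [] := corr_integrable s.
  - by move=> x _; rewrite lee_fin cabs_ge0.
  - by rewrite lee_fin ltW// poisson_gt0.
rewrite ge0_integralZl//.
- by rewrite integral_poisson// mule1.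
- by apply/measurable_EFinP; exact: measurable_poisson.
- by move=> s _; rewrite lee_fin ltW// poisson_gt0.
- exact: sqnorm_ge0.
Qed.

Let pairing_corr : Cint L (fun x => f x * conjc (A x)) =
  Cint L (fun s => corr s * (poisson ep s)%:C).
Proof.
have mp := measurable_poisson ep0.
transitivity (Cint L (fun x => Cint L (fun s => G (x, s)))).
  apply: eq_cint => x; rewrite A_shift.
  have hi : cintegrable L (fun s => trans_by s f x * (poisson ep s)%:C).
    have fx : cintegrable L (fun s => trans_by s f x).
      have h := (cintegrable_scales (scales_by_reflection x) fi). exact: h.
    apply: (@cintegrable_bounded _ _ _ _ (pi * ep)^-1) => //.
      exact: measurable_realC.
    by move=> y; rewrite cabs_real ger0_norm ?(ltW (poisson_gt0 _ ep0))//; exact: poisson_le.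
  rewrite -Cint_conj// -CintZ.
    by apply: eq_cint => s; rewrite cconjM cconj_real mulrA.
  have [mh hoo] := hi; split; first exact: measurable_cconj.
  by rewrite /norm1; under eq_integral do rewrite cabs_conj.
rewrite -(Cfubini_swap Gi); apply: eq_cint => s; rewrite /G /=.
by rewrite CintZr.
Qed.

(** Polarisation, because f and its translates have the same norm. *)
Let Re_corr s : complex.Re (corr s) = fine (sqnorm L f) - 2^-1 * fine (shift_defect f s).
Proof.
have ms := measurable_shift s mf.
have f2s : (sqnorm L (trans_by s f) < +oo)%E by rewrite sqnorm_shift.
rewrite /corr Re_Cint.
have i1 := sqnorm_integrable mf f2.
have i2 := sqnorm_integrable ms f2s.
have i3 := cintegrable_Re (corr_integrable s).
rewrite /shift_defect.
have -> : fine (sqnorm L (fun x => f x - trans_by s f x)) =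
   \int[L]_x ((cabs (f x) ^+ 2 + cabs (trans_by s f x) ^+ 2) -
     2 * complex.Re (f x * conjc (trans_by s f x))).
  congr fine; apply: eq_integral => x _; congr EFin.
  by rewrite !sqr_cabs cReM cRe_conj cIm_conj cReD cImD cReN cImN; ring.
have i12 : L.-integrable setT (EFin \o (fun x => cabs (f x) ^+ 2 + cabs (trans_by s f x) ^+ 2)).
  by rewrite (_ : _ \o _ = (fun x => (cabs (f x) ^+ 2)%:E + (cabs (trans_by s f x) ^+ 2)%:E)%E)//;
    exact: integrableD.
have i32 : L.-integrable setT (EFin \o (fun x => 2 * complex.Re (f x * conjc (trans_by s f x)))).
  rewrite (_ : _ \o _ = (fun x => 2%:E * (complex.Re (f x * conjc (trans_by s f x)))%:E)%E)//.
  exact: integrableZl.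
rewrite RintegralB// RintegralD// RintegralZl//.
have e2 : \int[L]_x (cabs (trans_by s f x) ^+ 2) = fine (sqnorm L f).
  by rewrite -(sqnorm_shift s mf).
rewrite e2 -[\int[L]_x (cabs (f x) ^+ 2)]/(fine (sqnorm L f)).
by field.
Qed.

Lemma measurable_shift_defect : measurable_fun setT (shift_defect f).
Proof.
apply: (measurable_fun_fubini_tonelli_G (m1 := L)
  (fun z : RR * RR => (cabs (f z.1 - trans_by z.2 f z.1) ^+ 2)%:E)).
  apply: measurable_esqcabs; apply: measurable_csub => //.
  exact: measurableT_comp mf _.
by move=> z; rewrite lee_fin sqr_ge0.
Qed.

Let defect_fin s : shift_defect f s \is a fin_num.
Proof.
rewrite ge0_fin_numE ?sqnorm_ge0//; apply: le_lt_trans (shift_defect_le s mf) _.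
by rewrite lte_mul_pinfty.
Qed.

(** The damped energy of the transform is the Poisson average of the
    autocorrelation, whose real part is the energy of f minus half of the squared
    modulus of continuity. What separates this identity from Plancherel's is
    only the continuity of translations. *)
Lemma regularised_plancherel :
  (\int[L]_xi (decay (2 * pi * ep) xi * cabs (fourier1 f xi) ^+ 2)%:E +
   2^-1%:E * \int[L]_s ((poisson ep s)%:E * shift_defect f s) = sqnorm L f)%E.
Proof.
have mF := measurable_fourier1 mf.
have mp := measurable_poisson ep0.
have msd := measurable_shift_defect.
have E1 := congr1 (@complex.Re R) energy_pairing.
rewrite pairing_corr !Re_Cint in E1.
have pd0 s : (0 <= (poisson ep s)%:E * shift_defect f s)%E.
  by rewrite mule_ge0 ?sqnorm_ge0// lee_fin ltW// poisson_gt0.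
have pi_int : L.-integrable setT (EFin \o (poisson ep : RR -> R)).
  apply/integrableP; split; first exact/measurable_EFinP.
  under eq_integral do rewrite /= ger0_norm ?(ltW (poisson_gt0 _ ep0))//.
  by rewrite integral_poisson// ltry.
have pdi : L.-integrable setT (fun s => (poisson ep s)%:E * shift_defect f s)%E.
  apply: (@le_integrable _ _ _ L setT measurableT _ (fun s => (4%:E * sqnorm L f) * (poisson ep s)%:E)%E).
  - by apply: emeasurable_funM => //; apply/measurable_EFinP.
  - move=> s _; rewrite gee0_abs// gee0_abs; last first.
      by rewrite !mule_ge0 ?sqnorm_ge0// lee_fin ltW// poisson_gt0.
    rewrite muleC lee_wpmul2r//; first by rewrite lee_fin ltW// poisson_gt0.
    exact: shift_defect_le.
  - have -> : (4%:E * sqnorm L f = (4 * fine (sqnorm L f))%:E)%E.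
      by rewrite EFinM fineK// ge0_fin_numE// sqnorm_ge0.
    exact: integrableZl.
have fS : sqnorm L f \is a fin_num by rewrite ge0_fin_numE// sqnorm_ge0.
have fpd := integrable_fin_num measurableT pdi.
set I := (\int[L]_s (_ * _))%E in fpd *.
have E2 : \int[L]_s complex.Re (corr s * (poisson ep s)%:C) =
    fine (sqnorm L f) - 2^-1 * fine I.
  transitivity (\int[L]_s (fine (sqnorm L f) * poisson ep s -
      2^-1 * fine ((poisson ep s)%:E * shift_defect f s)%E)).
    apply: eq_Rintegral => s _; rewrite cReM Re_corr fineM//= mulr0 subr0.
    by rewrite mulrBl; congr (_ - _); ring.
  have ipd : L.-integrable setT (EFin \o (fun s : RR => fine ((poisson ep s)%:E * shift_defect f s)%E)).
    apply: eq_integrable pdi => // s _ /=.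
    by rewrite fineK// fin_numM.
  rewrite RintegralB//; last 2 first.
  - rewrite (_ : _ \o _ = (fun s => (fine (sqnorm L f))%:E * (EFin \o (poisson ep : RR -> R)) s)%E)//.
    exact: integrableZl.
  - rewrite (_ : _ \o _ = (fun s => 2^-1%:E * (EFin \o (fun s : RR => fine ((poisson ep s)%:E * shift_defect f s)%E)) s)%E)//.
    exact: integrableZl.
  rewrite (RintegralZl _ measurableT pi_int) (RintegralZl _ measurableT ipd).
  rewrite {1}/Rintegral integral_poisson//= mulr1.
  congr (_ - _ * _); congr fine; apply: eq_integral => s _.
  by rewrite fineK// fin_numM.
rewrite E2 in E1.
have E3 : \int[L]_x complex.Re ((w x)%:C * conjc (fourier1 f x) * fourier1 f x) =
   \int[L]_x (w x * cabs (fourier1 f x) ^+ 2).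
  apply: eq_Rintegral => x _; rewrite -mulrA mul_conj.
  by rewrite cReM /= mul0r subr0.
rewrite E3 in E1.
have Wi : L.-integrable setT (EFin \o (fun x => w x * cabs (fourier1 f x) ^+ 2)).
  have : cintegrable L (fun xi => ((w xi)%:C * conjc (fourier1 f xi)) * fourier1 f xi).
    apply: (cintegrable_bounded (M := N) gi) => // x; exact: cabs_fourier1_le.
  move=> /cintegrable_Re; apply: eq_integrable => // x _.
  by apply: (congr1 EFin); rewrite -mulrA mul_conj cReM /= mul0r subr0.
have fW := integrable_fin_num measurableT Wi.
rewrite -(fineK fS) -(fineK fW) -(fineK fpd) -EFinM -EFinD; congr EFin.
apply: etrans (congr1 (fun z => z + 2^-1 * fine I) E1) _; exact: subrK.
Qed.

End identity.
End regularised.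

(** * Continuity of translations *)

Section translation_continuity.
Context {R : realType}.

Let lebesgue_itvcc_lty (a b : R) : (@lebesgue_measure R `[a, b]%classic < +oo)%E.
Proof.
by rewrite lebesgue_measure_itv/=; case: ifP => // _; rewrite -EFinB ltry.
Qed.

Notation L := (@lebesgue_measure R).
Notation RR := (measurableTypeR R).
Implicit Types f h : RR -> R[i].

Let shift_continuous f := forall s : nat -> R, s @ \oo --> (0 : R) ->
  shift_defect f (s n) @[n --> \oo] --> (0 : \bar R).

(** Both f - h and its translates have the same norm, whence the factor 8. *)
Let shift_defectD f h s : measurable_fun setT f -> measurable_fun setT h ->
  (shift_defect f s <= 2%:E * shift_defect h s +
     8%:E * sqnorm L (fun x => f x - h x)%R)%E.
Proof.
move=> mf mh; have mfh := measurable_csub mf mh.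
have m1 := measurable_csub mh (measurable_shift s mh).
have m2 := measurable_csub mfh (measurable_shift s mfh).
have -> : shift_defect f s = sqnorm L (fun x => (h x - trans_by s h x) +
    ((f x - h x) - trans_by s (fun x => f x - h x) x)).
  by apply: eq_sqnorm => x; rewrite /trans_by; congr cabs; ring.
apply: le_trans (sqnormD_le L m1 m2) _.
rewrite leeD2l// (_ : 8 = 2 * 4 :> R); last by ring.
rewrite EFinM -muleA lee_wpmul2l//.
exact: shift_defect_le.
Qed.

Let shift_continuous_lim f : measurable_fun setT f ->
  (forall e : R, 0 < e -> exists h, [/\ measurable_fun setT h, shift_continuous h &
     (sqnorm L (fun x => f x - h x)%R <= e%:E)%E]) -> shift_continuous f.
Proof.
move=> mf dens s s0; apply/ge0_cvge0P => [n|e e0]; first exact: sqnorm_ge0.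
have [h [mh ch fh]] := dens (e / 16) ltac:(by rewrite divr_gt0).
have /ge0_cvge0P := ch s s0 => /(_ (fun n => sqnorm_ge0 _ _) (e / 4) ltac:(by rewrite divr_gt0)).
apply: filterS => n hn; apply: le_trans (shift_defectD _ mf mh) _.
rewrite (_ : e%:E = 2%:E * (e / 4)%:E + 8%:E * (e / 16)%:E)%E; last first.
  by rewrite -!EFinM -EFinD; congr EFin; field.
by apply: leeD; rewrite lee_wpmul2l.
Qed.

Let bounded_seq (s : nat -> R) : s @ \oo --> (0 : R) -> exists2 B, 0 < B & forall n, `|s n| <= B.
Proof.
move=> s0; have : cvgn s by apply/cvg_ex; exists 0.
move=> /cvg_seq_bounded [M [_ hM]]; exists (`|M| + 1) => [|n]; first by rewrite ltr_pwDr.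
by apply: hM => //; rewrite (le_lt_trans (ler_norm _))// ltrDl.
Qed.

(** Dominated convergence: the translates by a bounded sequence all live on one
    bounded interval. *)
Let shift_continuous_base (h1 h2 : R -> R) (M K : R) :
  continuous h1 -> continuous h2 ->
  (forall x, `|h1 x| <= M) -> (forall x, `|h2 x| <= M) ->
  (forall x, K < `|x| -> h1 x = 0) -> (forall x, K < `|x| -> h2 x = 0) ->
  shift_continuous (fun x => h1 x +i* h2 x).
Proof.
move=> c1 c2 b1 b2 z1 z2 s s0; have [B B0 sB] := bounded_seq s0.
set h : RR -> R[i] := fun x => _.
have M0 : 0 <= M by exact: le_trans (b1 0).
have mh : measurable_fun setT h.
  by apply: measurable_cplx; exact: continuous_measurable_fun.
have bh x : cabs (h x) <= 2 * M.
  by rewrite (le_trans (cabs_le_ReIm _))//= mulr2n mulrDl mul1r lerD.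
set E := `[- (K + B), K + B]%classic : set RR.
have mE : measurable E by exact: measurable_itv.
rewrite (_ : 0%E = (\int[L]_x (cst 0 x))%E :> \bar R); last by rewrite integral0.
apply: (@dominated_cvg _ _ _ L setT measurableT _ (cst 0)
  (fun x => ((16 * M ^+ 2)%:E * (\1_E x)%:E)%E)) => //.
- move=> n; apply: measurable_esqcabs; apply: measurable_csub => //.
  exact: measurable_shift.
- move=> x _.
  have hs : x - s n @[n --> \oo] --> x.
    rewrite -[X in _ --> X]subr0; apply: cvgB => //; exact: cvg_cst.
  have l1 : h1 x - h1 (x - s n) @[n --> \oo] --> 0.
    rewrite -[X in _ --> X](subrr (h1 x)); apply: cvgB; first exact: cvg_cst.
    by apply: continuous_cvg hs; exact: c1.
  have l2 : h2 x - h2 (x - s n) @[n --> \oo] --> 0.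
    rewrite -[X in _ --> X](subrr (h2 x)); apply: cvgB; first exact: cvg_cst.
    by apply: continuous_cvg hs; exact: c2.
  have l : (h1 x - h1 (x - s n)) ^+ 2 + (h2 x - h2 (x - s n)) ^+ 2 @[n --> \oo] --> 0.
    rewrite -[X in _ --> X](addr0 0).
    apply: cvgD; rewrite -[X in _ --> X](mulr0 0); under eq_fun do rewrite expr2.
    - exact: cvgM.
    - exact: cvgM.
  apply: (@cvg_trans _ ((((h1 x - h1 (x - s n)) ^+ 2 + (h2 x - h2 (x - s n)) ^+ 2)%:E) @[n --> \oo])).
    by apply: near_eq_cvg; near=> n; rewrite sqr_cabs /trans_by /=.
  by apply/fine_cvgP; split; [exact: nearW|exact: l].
- apply: integrableZl => //; apply/integrableP; split.
    by apply/measurable_EFinP; exact: measurable_indic.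
  under eq_integral do rewrite /= ger0_norm//.
  by rewrite integral_indic// setIT; exact: lebesgue_itvcc_lty.
- move=> n x _; rewrite abse_EFin ger0_norm ?sqr_ge0// -EFinM lee_fin indicE.
  have [xE|xE] := boolP (x \in E).
    rewrite mulr1 (_ : 16 * M ^+ 2 = (4 * M) ^+ 2); last by ring.
    rewrite ler_pXn2r ?nnegrE ?cabs_ge0 ?mulr_ge0//.
    apply: le_trans (cabsB _ _) _; rewrite (_ : 4 * M = 2 * M + 2 * M); last by ring.
    by apply: lerD; exact: bh.
  have xKB : K + B < `|x|.
    rewrite ltNge; apply: contra xE => xE; apply/mem_set => /=.
    by rewrite /E/= in_itv/= -ler_norml.
  have xs : K < `|x - s n|.
    have := lerB_dist x (s n); have := sB n; move: xKB; lra.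
  have xK : K < `|x| by move: xKB B0; lra.
  rewrite /trans_by /h (z1 _ xK) (z2 _ xK) (z1 _ xs) (z2 _ xs).
  by rewrite subrr cabs0 expr0n mulr0.
Unshelve. all: by end_near. Qed.

Let tent (K x : R) : R := Num.max 0 (Num.min 1 (K + 1 - `|x|)).

Let tent_continuous K : continuous (tent K).
Proof.
move=> x; apply: (@continuous_max R R (cst 0) (fun x => Num.min 1 (K + 1 - `|x|))).
  exact: cst_continuous.
apply: (@continuous_min R R (cst 1) (fun x => K + 1 - `|x|)); first exact: cst_continuous.
apply: (@continuousB R R^o R^o (cst (K + 1)) (fun x => `|x|)); first exact: cst_continuous.
exact: norm_continuous.
Qed.

Let tent_ge0 K x : 0 <= tent K x. Proof. by rewrite le_max lexx. Qed.

Let tent_le1 K x : tent K x <= 1.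
Proof. by rewrite ge_max ler01 ge_min lexx. Qed.

Let tent1 K x : `|x| <= K -> tent K x = 1.
Proof. by move=> xK; rewrite /tent min_l ?max_r//; lra. Qed.

Let tent0 K x : K + 1 < `|x| -> tent K x = 0.
Proof. by move=> xK; rewrite /tent min_r ?max_l//; lra. Qed.

(** Clipping to [-M, M] moves no value away from a point of that interval. *)
Let clip_dist (M a b : R) : 0 <= M -> `|a| <= M ->
  `|a - Num.max (- M) (Num.min M b)| <= `|a - b|.
Proof.
move=> M0; rewrite ler_norml => /andP[h1 h2].
have n1 := ler_norm (a - b); have n2 := ler_norm (- (a - b)); rewrite normrN in n2.
move: (`|a - b|) n1 n2 => c n1 n2; rewrite ler_norml.
have [h3|h3] := leP M b.
  by have [h4|h4] := leP (- M) M; apply/andP; split; lra.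
by have [h4|h4] := leP (- M) b; apply/andP; split; lra.
Qed.

(** An L1 approximation of u by a continuous function becomes an L2 approximation
    by clipping its values and cutting off its argument, because then
    |u - h|^2 <= 2 M |u - h|. *)
Let approx (u : R -> R) (M K e : R) : 0 <= M -> 0 <= K -> 0 < e ->
  measurable_fun setT (u : RR -> R) ->
  (forall x, `|u x| <= M) -> (forall x, K < `|x| -> u x = 0) ->
  exists h : R -> R, [/\ continuous h, forall x, `|h x| <= M,
    forall x, K + 1 < `|x| -> h x = 0 &
    (\int[L]_x ((u x - h x) ^+ 2)%:E <= e%:E)%E].
Proof.
move=> M0 K0 e0 mu_ ub uz.
set E := `[- (K + 1), K + 1]%classic : set RR.
have mE : measurable E by exact: measurable_itv.
have Efin : (L E < +oo)%E.
  exact: lebesgue_itvcc_lty.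
have ui : L.-integrable E (EFin \o u).
  apply: measurable_bounded_integrable => //; first exact: measurable_funTS.
  exists M; split; rewrite ?num_real// => y My x _ /=.
  by rewrite (le_trans (ub x))// ltW.
have [g [cg gi gcv]] := approximation_continuous_integrable mE Efin ui.
have eM : 0 < e / (2 * M + 1).
  by rewrite divr_gt0// ltr_wpDl// mulr_ge0.
have /ge0_cvge0P := gcv => /(_ _ _ eM) h.
have {h} [n gn] : exists n, (\int[L]_(z in E) `|(u z - g n z)%:E| <= (e / (2 * M + 1))%:E)%E.
  have [|N _ hN] := h; first by move=> n; exact: integral_ge0.
  by exists N; apply: hN => /=.
pose c x := Num.max (- M) (Num.min M (g n x)).
have cc : continuous c.
  move=> x; apply: (@continuous_max R R (cst (- M)) (fun x => Num.min M (g n x))).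
    exact: cst_continuous.
  apply: (@continuous_min R R (cst M) (g n)); first exact: cst_continuous.
  exact: cg.
have cM x : `|c x| <= M.
  by rewrite ler_norml /c le_max lexx ge_max ge_min lexx /=; lra.
have uc x : `|u x - c x| <= `|u x - g n x| by exact: clip_dist.
exists (fun x => c x * tent K x); split.
- by move=> x; apply: continuousM; [exact: cc|exact: tent_continuous].
- by move=> x; rewrite normrM (ger0_norm (tent_ge0 _ _)) (le_trans _ (cM x))// ler_piMr.
- by move=> x xK; rewrite tent0// mulr0.
have pt x : (u x - c x * tent K x) ^+ 2 <= 2 * M * (`|u x - g n x| * \1_E x).
  rewrite indicE; have [xE|xE] := boolP (x \in E); last first.
    have xK : K + 1 < `|x|.
      rewrite ltNge; apply: contra xE => xE; apply/mem_set => /=.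
      by rewrite /E/= in_itv/= -ler_norml.
    by rewrite tent0// uz ?mulr0 ?subr0 ?expr0n ?mulr0//; lra.
  rewrite mulr1.
  have ut : u x - c x * tent K x = (u x - c x) * tent K x.
    have [xK|xK] := leP `|x| K; first by rewrite tent1// !mulr1.
    by rewrite uz//; ring.
  rewrite ut -real_normK ?num_real// normrM (ger0_norm (tent_ge0 _ _)) exprMn.
  apply: (@le_trans _ _ (`|u x - c x| ^+ 2)).
    by rewrite ler_piMr ?sqr_ge0// expr_le1.
  rewrite expr2 ler_pM// (le_trans (ler_normB _ _))//.
  by have := ub x; have := cM x; lra.
apply: (@le_trans _ _ (\int[L]_x ((2 * M)%:E * (`|u x - g n x| * \1_E x)%:E))%E).
  apply: ge0_le_integral => //.
  - by move=> x _; rewrite lee_fin sqr_ge0.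
  - apply/measurable_EFinP; apply: measurable_funX; apply: measurable_funB => //.
    apply: continuous_measurable_fun => x.
    by apply: continuousM; [exact: cc|exact: tent_continuous].
  - apply: measurable_funeM; apply/measurable_EFinP; apply: measurable_funM => //.
    apply: measurableT_comp => //; apply: measurable_funB => //.
    exact: continuous_measurable_fun.
  - by move=> x _; rewrite -EFinM lee_fin.
rewrite ge0_integralZl//; last 2 first.
- apply/measurable_EFinP; apply: measurable_funM => //.
  apply: measurableT_comp => //; apply: measurable_funB => //.
  exact: continuous_measurable_fun.
- by rewrite lee_fin mulr_ge0.
have -> : (\int[L]_x (`|u x - g n x| * \1_E x)%:E = \int[L]_(z in E) `|(u z - g n z)%:E|)%E.
  by rewrite [RHS]integral_mkcond; apply: eq_integral => x _; rewrite patchE indicE;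
    case: (x \in E); rewrite ?mulr1 ?mulr0.
apply: le_trans (lee_wpmul2l _ gn) _; first by rewrite lee_fin mulr_ge0.
rewrite -EFinM lee_fin; set q := e / _ in eM *.
have -> : e = q * (2 * M + 1) by rewrite divfK// gt_eqF// ltr_wpDl// mulr_ge0.
by rewrite mulrDr mulr1 mulrC lerDl ltW.
Qed.

Lemma shift_defect_cvg0 f (s : nat -> R) : measurable_fun setT f ->
  (sqnorm L f < +oo)%E -> s @ \oo --> (0 : R) ->
  shift_defect f (s n) @[n --> \oo] --> (0 : \bar R).
Proof.
move=> mf foo; move: s; change (shift_continuous f).
pose F (k : nat) : set RR := `[- k%:R, k%:R]%classic.
have mF k : measurable (F k) by exact: measurable_itv.
have Fcov x : \forall k \near \oo, F k x.
  by apply: filterS (nbhs_infty_ger `|x|) => k xk; rewrite /F/= in_itv/= -ler_norml.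
have tc := sqnorm_trunc_cvg mF Fcov mf foo.
apply: shift_continuous_lim => // e e0.
have /ge0_cvge0P := tc => /(_ (fun n => sqnorm_ge0 _ _) e e0) [k _ /(_ k (leqnn k)) hk].
exists (trunc F f k); split => //; first exact: measurable_trunc.
set t := trunc F f k; have mt : measurable_fun setT t by exact: measurable_trunc.
have tb x : cabs (t x) <= k%:R.
  rewrite (le_trans (trunc_bound _ _ _ _))// indicE; case: (_ \in _); rewrite ?mulr1 ?mulr0//.
have tz x : k%:R < `|x| -> t x = 0.
  move=> xk; rewrite /t /trunc; case: ifP => // /andP[/set_mem].
  by rewrite /F/= in_itv/= -ler_norml leNgt xk.
apply: shift_continuous_lim => // {hk e e0} e e0.
have e2 : 0 < e / 2 by rewrite divr_gt0.
have [h1 [c1 b1 z1 i1]] := approx (ler0n R k) (ler0n R k) e2 (measurable_ReT mt)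
  (fun x => le_trans (Re_le_cabs _) (tb x)) (fun x kx => congr1 (@complex.Re R) (tz x kx)).
have [h2 [c2 b2 z2 i2]] := approx (ler0n R k) (ler0n R k) e2 (measurable_ImT mt)
  (fun x => le_trans (Im_le_cabs _) (tb x)) (fun x kx => congr1 (@complex.Im R) (tz x kx)).
exists (fun x => h1 x +i* h2 x); split.
- by apply: measurable_cplx; exact: continuous_measurable_fun.
- exact: (shift_continuous_base c1 c2 b1 b2 z1 z2).
have m1 : measurable_fun setT (h1 : RR -> R) by exact: continuous_measurable_fun.
have m2 : measurable_fun setT (h2 : RR -> R) by exact: continuous_measurable_fun.
rewrite (_ : e = e / 2 + e / 2); last by field.
rewrite EFinD; apply: le_trans (leeD i1 i2); rewrite -ge0_integralD//.
- rewrite le_eqVlt; apply/orP; left; apply/eqP; apply: eq_integral => x _.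
  by rewrite sqr_cabs cReD cImD cReN cImN.
- by move=> x _; rewrite lee_fin sqr_ge0.
- by apply/measurable_EFinP; apply: measurable_funX; apply: measurable_funB => //; exact: measurable_ReT.
- by move=> x _; rewrite lee_fin sqr_ge0.
- by apply/measurable_EFinP; apply: measurable_funX; apply: measurable_funB => //; exact: measurable_ImT.
Qed.

End translation_continuity.

(** * Plancherel's identity on the line *)

Section plancherel_line.
Context {R : realType}.
Notation L := (@lebesgue_measure R).
Notation RR := (measurableTypeR R).

(** The width of the damping tends to 0 in the regularised identity: the damped
    energies increase to the full energy of the transform, while the averaged
    modulus of continuity vanishes by dominated convergence under the weight of
    the Poisson kernel of width 1. *)
Theorem plancherel1 (f : RR -> R[i]) : measurable_fun setT f ->
  (norm1 L f < +oo)%E -> (sqnorm L f < +oo)%E ->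
  sqnorm L (fourier1 f) = sqnorm L f.
Proof.
move=> mf f1 f2.
have mF := measurable_fourier1 mf.
pose ep (n : nat) : R := harmonic n.
have ep0 n : 0 < ep n by exact: harmonic_gt0.
pose a n := (\int[L]_xi (decay (2 * pi * ep n) xi * cabs (fourier1 f xi) ^+ 2)%:E)%E.
pose b n := (\int[L]_s ((poisson 1 s)%:E * shift_defect f (ep n * s)%R))%E.
have msd : measurable_fun setT (shift_defect f) by exact: measurable_shift_defect.
have ab n : (a n + 2^-1%:E * b n = sqnorm L f)%E.
  rewrite -(regularised_plancherel mf f1 f2 (ep0 n)) /b.
  by rewrite -integral_poisson_rescale// => s; exact: sqnorm_ge0.
have acv : a n @[n --> \oo] --> sqnorm L (fourier1 f).
  have dpos n x : 0 <= 2 * pi * ep n * `|x| by rewrite !mulr_ge0// ?pi_ge0// ltW.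
  rewrite (_ : sqnorm L (fourier1 f) = (\int[L]_xi (limn (fun n =>
      (decay (2 * pi * ep n) xi * cabs (fourier1 f xi) ^+ 2)%:E)))%E); last first.
    apply: eq_integral => x _; apply/esym/cvg_lim => //.
    apply/fine_cvgP; split; first exact: nearW.
    rewrite [X in X @ _ --> _](_ : _ = fun n => decay (2 * pi * ep n) x * cabs (fourier1 f x) ^+ 2)//.
    rewrite -[X in _ --> X]mul1r; apply: cvgM; last exact: cvg_cst.
    rewrite -[X in _ --> X](@expR0 R); apply: (@continuous_cvg _ _ _ \oo _ (fun n => - (2 * pi * ep n * `|x|)) expR).
      exact: continuous_expR.
    rewrite -oppr0; apply: cvgN.
    rewrite -(mul0r `|x|); apply: cvgM; last exact: cvg_cst.
    rewrite -(mulr0 (2 * pi)); apply: cvgM; first exact: cvg_cst.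
    exact: cvg_harmonic.
  apply: (@cvg_monotone_convergence _ _ _ L setT measurableT
    (fun n xi => (decay (2 * pi * ep n) xi * cabs (fourier1 f xi) ^+ 2)%:E)).
  - move=> n; apply/measurable_EFinP; apply: measurable_funM; first exact: measurable_decay.
    by apply: measurable_funX; exact: measurable_cabsT.
  - by move=> n x _; rewrite lee_fin mulr_ge0 ?decay_ge0 ?sqr_ge0.
  - move=> x _ m n mn; rewrite lee_fin ler_wpM2r ?sqr_ge0// ler_expR lerN2.
    rewrite ler_wpM2r// ler_wpM2l ?mulr_ge0 ?pi_ge0//.
    by rewrite /ep /harmonic lef_pV2 ?posrE// ler_nat.
have bcv : b n @[n --> \oo] --> (0 : \bar R).
  rewrite (_ : 0%E = (\int[L]_x (cst 0 x))%E :> \bar R); last by rewrite integral0.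
  have fS : sqnorm L f \is a fin_num by rewrite ge0_fin_numE// sqnorm_ge0.
  apply: (@dominated_cvg _ _ _ L setT measurableT _ (cst 0)
    (fun s => (4 * fine (sqnorm L f))%:E * (poisson 1 s)%:E)%E).
  - move=> n; apply: emeasurable_funM; first by apply/measurable_EFinP; exact: measurable_poisson.
    by apply: (measurableT_comp msd); exact: measurable_funM.
  - move=> s _.
    have hs : ep n * s @[n --> \oo] --> (0 : R).
      by rewrite -(mul0r s); apply: cvgM; [exact: cvg_harmonic|exact: cvg_cst].
    rewrite -[X in _ --> X](mule0 (poisson 1 s)%:E); apply: cvgeZl => //.
    exact: (shift_defect_cvg0 mf f2 hs).
  - by move=> s _; rewrite -EFinM.
  - apply: integrableZl => //; apply/integrableP; split.
      by apply/measurable_EFinP; exact: measurable_poisson.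
    under eq_integral do rewrite /= ger0_norm ?(ltW (poisson_gt0 _ ltr01))//.
    by rewrite integral_poisson// ltry.
  - move=> n s _; rewrite gee0_abs; last first.
      by rewrite mule_ge0 ?sqnorm_ge0// lee_fin ltW// poisson_gt0.
    rewrite muleC lee_wpmul2r//; first by rewrite lee_fin ltW// poisson_gt0.
    by rewrite EFinM fineK//; exact: shift_defect_le.
have abcv : (a n + 2^-1%:E * b n)%E @[n --> \oo] --> (sqnorm L (fourier1 f) + 2^-1%:E * 0)%E.
  apply: cvgeD => //; last exact: cvgeZl.
  by rewrite mule0 fin_num_adde_defl.
rewrite mule0 adde0 in abcv.
have := cvg_lim (@ereal_hausdorff R) abcv => <-.
rewrite (_ : (fun n => _) = cst (sqnorm L f)); last by apply/funext => n; exact: ab.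
exact: lim_cst.
Qed.

End plancherel_line.

(** * Plancherel's identity in several variables *)

Section Rn_basics.
Context {R : realType}.
Notation L := (@lebesgue_measure R).
Notation RR := (measurableTypeR R).
Notation lam n := (@lebesgue_Rn R n).

Lemma unconsRnK n : cancel (@unconsRn R n) (@consRn R n).
Proof.
move=> x; apply/matrixP => i j; rewrite /consRn /unconsRn /=.
case: (split_ordP (i : 'I_(1 + n))) => k ->.
  apply: etrans (col_mxEu _ _ _ _) _; rewrite mxE !ord1 eqxx mulr1n /coords.
  by congr (x _ _); exact: val_inj.
by apply: etrans (col_mxEd _ _ _ _) _; rewrite mxE.
Qed.

Lemma scales_consRn n : scales_between (L \x lam n)%E (lam n.+1) (@consRn R n) 1.
Proof. by split => //; [exact: measurable_consRn|move=> A mA; rewrite mul1e]. Qed.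

Lemma consRn0 n (p : RR * Rn R n) : consRn p ord0 ord0 = p.1.
Proof.
rewrite /consRn (_ : ord0 = lshift n (ord0 : 'I_1)); last exact/val_inj.
by apply: etrans (col_mxEu _ _ _ _) _; rewrite mxE eqxx mulr1n.
Qed.

Lemma consRnS n (p : RR * Rn R n) k : consRn p (lift ord0 k) ord0 = p.2 k ord0.
Proof.
rewrite /consRn (_ : lift ord0 k = rshift 1 k); last exact/val_inj.
by apply: etrans (col_mxEd _ _ _ _) _.
Qed.

Lemma dotv_consRn n (p q : RR * Rn R n) :
  dotv (consRn p) (consRn q) = p.1 * q.1 + dotv p.2 q.2.
Proof.
rewrite /dotv big_ord_recl !consRn0; congr (_ + _).
by apply: eq_bigr => k _; rewrite !consRnS.
Qed.

Lemma measurable_dotv n d (T : measurableType d) (f g : T -> Rn R n) :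
  measurable_fun setT f -> measurable_fun setT g ->
  measurable_fun setT (fun x => dotv (f x) (g x)).
Proof.
move=> mf mg; apply: measurable_sum => k; apply: measurable_funM.
- exact: (measurableT_comp (measurable_coords k) mf).
- exact: (measurableT_comp (measurable_coords k) mg).
Qed.

Definition character n (x xi : Rn R n) : R[i] := cexpi (- (2 * pi * dotv x xi)).

Lemma measurable_character n d (T : measurableType d) (f g : T -> Rn R n) :
  measurable_fun setT f -> measurable_fun setT g ->
  measurable_fun setT (fun x => character (f x) (g x)).
Proof.
move=> mf mg; apply: measurable_cexpi; apply: measurableT_comp; first exact: oppr_measurable.
by apply: measurable_funM => //; exact: measurable_dotv.
Qed.

Lemma cabs_character n (x xi : Rn R n) : cabs (character x xi) = 1.
Proof. exact: cabs_cexpi. Qed.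

Lemma measurable_fourier_param n d (T : measurableType d) (F : T -> Rn R n -> R[i])
    (g : T -> Rn R n) :
  measurable_fun setT (fun z : T * Rn R n => F z.1 z.2) -> measurable_fun setT g ->
  measurable_fun setT (fun t => fourier (F t) (g t)).
Proof.
move=> mF mg; apply: (measurable_Cfubini (lam n)
  (f := fun z : T * Rn R n => F z.1 z.2 * character z.2 (g z.1))).
apply: measurable_cmul => //; apply: measurable_character => //.
exact: measurableT_comp mg _.
Qed.

Lemma measurable_fourier n (f : Rn R n -> R[i]) : measurable_fun setT f ->
  measurable_fun setT (fourier f).
Proof.
move=> mf; apply: (measurable_fourier_param (F := fun _ => f) (g := id)) => //.
exact: measurableT_comp mf _.
Qed.

Lemma cabs_fourier_le n (f : Rn R n -> R[i]) xi : measurable_fun setT f ->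
  ((cabs (fourier f xi))%:E <= norm1 (lam n) f)%E.
Proof.
move=> mf; apply: le_trans (cabs_Cint_le (lam n) _) _.
  by apply: measurable_cmul => //; exact: (measurable_character (f := id) (g := cst xi)).
rewrite le_eqVlt; apply/orP; left; apply/eqP; apply: eq_integral => x _.
by rewrite cabsM cabs_cexpi mulr1.
Qed.

End Rn_basics.

Section plancherel.
Context {R : realType}.
Notation L := (@lebesgue_measure R).
Notation RR := (measurableTypeR R).
Notation lam n := (@lebesgue_Rn R n).

Let slice n (f : Rn R n.+1 -> R[i]) (t : RR) (x : Rn R n) := f (consRn (t, x)).

Let measurable_slice n (f : Rn R n.+1 -> R[i]) : measurable_fun setT f ->
  measurable_fun setT (fun z : RR * Rn R n => slice f z.1 z.2).
Proof.
move=> mf; rewrite (_ : (fun z => _) = f \o (@consRn R n)).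
  exact: measurableT_comp mf (@measurable_consRn R n).
by apply/funext => -[].
Qed.

Let norm1_slice n (f : Rn R n.+1 -> R[i]) : measurable_fun setT f ->
  norm1 (lam n.+1) f = (\int[L]_t norm1 (lam n) (slice f t))%E.
Proof.
move=> mf; have := norm1_scales (scales_consRn n) mf.
rewrite mul1e => <-; rewrite norm1_tonelli//.
exact: measurableT_comp mf (@measurable_consRn R n).
Qed.

Let sqnorm_slice n (f : Rn R n.+1 -> R[i]) : measurable_fun setT f ->
  sqnorm (lam n.+1) f = (\int[L]_t sqnorm (lam n) (slice f t))%E.
Proof.
move=> mf; have := sqnorm_scales (scales_consRn n) mf.
rewrite mul1e => <-; rewrite sqnorm_tonelli//.
exact: measurableT_comp mf (@measurable_consRn R n).
Qed.

Let measurable_slice_t n (f : Rn R n.+1 -> R[i]) t : measurable_fun setT f ->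
  measurable_fun setT (slice f t).
Proof. by move=> mf; exact: (measurable_fun_pair2 t (measurable_slice mf)). Qed.

Let ae_lty (u : RR -> \bar R) : measurable_fun setT u -> (forall t, 0 <= u t)%E ->
  (\int[L]_t u t < +oo)%E -> {ae L, forall t, (u t < +oo)%E}.
Proof.
move=> mu_ u0 uoo.
have ui : L.-integrable setT u.
  apply/integrableP; split => //.
  by under eq_integral do rewrite gee0_abs//.
have := integrable_ae measurableT ui.
by apply: filterS => t /(_ I); rewrite ge0_fin_numE.
Qed.

Let measurable_norm1_slice n (f : Rn R n.+1 -> R[i]) : measurable_fun setT f ->
  measurable_fun setT (fun t => norm1 (lam n) (slice f t)).
Proof.
by move=> mf; exact: (measurable_norm1_slice1 (lam n) (measurable_slice mf)).
Qed.

Let measurable_sqnorm_slice n (f : Rn R n.+1 -> R[i]) : measurable_fun setT f ->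
  measurable_fun setT (fun t => sqnorm (lam n) (slice f t)).
Proof.
by move=> mf; exact: (measurable_sqnorm_slice1 (lam n) (measurable_slice mf)).
Qed.

(** Fubini's theorem; a slice is integrable only for almost every t, which is enough
    under the outer integral. *)
Let fourier_consRn n (f : Rn R n.+1 -> R[i]) tau eta :
  cintegrable (lam n.+1) f ->
  fourier f (consRn (tau, eta)) = fourier1 (fun t => fourier (slice f t) eta) tau.
Proof.
move=> fi; have [mf f1] := fi.
have ci : cintegrable (lam n.+1) (fun x => f x * character x (consRn (tau, eta))).
  apply: (cintegrable_bounded (M := 1) fi).
    exact: (measurable_character (f := id) (g := cst _)).
  by move=> x; rewrite cabs_character.
have hs := Cint_scales (scales_consRn n) ci; rewrite mul1r in hs.
apply: etrans (esym hs) _.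
rewrite -(Cfubini (cintegrable_scales (scales_consRn n) ci)).
have key t : cintegrable (lam n) (slice f t) ->
    Cint (lam n) (fun x => f (consRn (t, x)) * character (consRn (t, x)) (consRn (tau, eta))) =
    fourier (slice f t) eta * cexpi (- (2 * pi * (t * tau))).
  move=> ti; rewrite -CintZr; last first.
    apply: (cintegrable_bounded (M := 1) ti).
      exact: (measurable_character (f := id) (g := cst _)).
    by move=> x; rewrite cabs_character.
  apply: eq_cint => x; rewrite -mulrA; congr (_ * _).
  by rewrite /character dotv_consRn -cexpiD/=; congr cexpi; ring.
apply: ae_eq_Cint.
- have mc := @measurable_consRn R n.
  apply: (measurable_Cfubini (lam n) (f := fun z : RR * Rn R n =>
    f (consRn z) * character (consRn z) (consRn (tau, eta)))).
  apply: measurable_cmul; first exact: measurableT_comp mf mc.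
  exact: measurable_character.
- apply: measurable_cmul.
    exact: (measurable_fourier_param (measurable_slice mf) (@measurable_cst _ _ _ _ _ eta)).
  apply: measurable_cexpi; apply: measurableT_comp; first exact: oppr_measurable.
  by apply: measurable_funM => //; apply: measurable_funM.
- rewrite norm1_slice// in f1.
  apply: filterS (ae_lty (measurable_norm1_slice mf) (fun t => norm1_ge0 _ _) f1) => t ft _.
  by apply: key; split => //; exact: measurable_slice_t.
Qed.

(** Induction on the dimension. The induction hypothesis applies to almost every
    slice at a fixed first coordinate, the identity on the line to almost every
    frequency in the remaining variables. *)
Theorem plancherel n (f : Rn R n -> R[i]) : measurable_fun setT f ->
  (norm1 (lam n) f < +oo)%E -> (sqnorm (lam n) f < +oo)%E ->
  sqnorm (lam n) (fourier f) = sqnorm (lam n) f.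
Proof.
elim: n f => [f mf f1 f2|n IH f mf f1 f2].
  have cV0 (x : Rn R 0) : x = 0 by apply/matrixP => -[].
  congr (sqnorm _ _); apply/funext => xi; rewrite (cV0 xi).
  have E (x : Rn R 0) : f x * cexpi (- (2 * pi * dotv x 0)) = f x.
    by rewrite /dotv big_ord0 mulr0 oppr0 cexpi0 mulr1.
  rewrite (_ : fourier f 0 = Cint (lam 0) f); last exact: (eq_cint (lam 0) E).
  apply: complexP; rewrite ?Re_Cint ?Im_Cint /Rintegral.
  - rewrite integral_dirac//; first by rewrite diracT mul1e.
    by apply/measurable_EFinP; exact: measurable_ReT.
  - rewrite integral_dirac//; first by rewrite diracT mul1e.
    by apply/measurable_EFinP; exact: measurable_ImT.
have fi : cintegrable (lam n.+1) f by [].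
have mg : measurable_fun setT (fun z : RR * Rn R n => fourier (slice f z.1) z.2).
  apply: (measurable_fourier_param (F := fun z : RR * Rn R n => slice f z.1) (g := snd)) => //.
  have -> : (fun z : RR * Rn R n * Rn R n => slice f z.1.1 z.2) =
      (fun z : RR * Rn R n => slice f z.1 z.2) \o (fun z => (z.1.1, z.2)) by [].
  apply: measurableT_comp (measurable_slice mf) _.
  by apply: measurable_fun_pair => //; apply: measurableT_comp.
have f1' := f1; rewrite norm1_slice// in f1'.
have f2' := f2; rewrite sqnorm_slice// in f2'.
have g1 eta : (norm1 L (fun t => fourier (slice f t) eta) < +oo)%E.
  apply: le_lt_trans f1'; apply: ge0_le_integral => //.
  - by move=> t _; rewrite lee_fin cabs_ge0.
  - by apply: measurable_ecabs; exact: (measurable_fun_pair1 eta mg).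
  - exact: measurable_norm1_slice.
  - by move=> t _; apply: cabs_fourier_le; exact: measurable_slice_t.
have swap : (\int[lam n]_eta sqnorm L (fun t => fourier (slice f t) eta) =
    sqnorm (lam n.+1) f)%E.
  rewrite (sqnorm_tonelli_swap L (lam n) mg) (sqnorm_tonelli L (lam n) mg) (sqnorm_slice mf).
  apply: (ge0_ae_eq_integral measurableT).
  - exact: (measurable_sqnorm_slice1 (lam n) mg).
  - exact: measurable_sqnorm_slice.
  - by move=> t _; exact: sqnorm_ge0.
  - by move=> t _; exact: sqnorm_ge0.
  - have a1 := ae_lty (measurable_norm1_slice mf) (fun t => norm1_ge0 _ _) f1'.
    have a2 := ae_lty (measurable_sqnorm_slice mf) (fun t => sqnorm_ge0 _ _) f2'.
    apply: filterS2 a1 a2 => t t1 t2 _.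
    exact: (IH _ (measurable_slice_t t mf) t1 t2).
have mF := measurable_fourier mf.
have := sqnorm_scales (scales_consRn n) mF; rewrite mul1e => <-.
have mFc : measurable_fun setT (fun z : RR * Rn R n => fourier f (consRn z)).
  exact: measurableT_comp mF (@measurable_consRn R n).
rewrite -swap.
rewrite -(sqnorm_tonelli_swap L (lam n) mFc).
have msq := measurable_sqnorm_slice2 L mg.
apply: (ge0_ae_eq_integral measurableT (measurable_sqnorm_slice2 L mFc) msq).
- by move=> t _; exact: sqnorm_ge0.
- by move=> t _; exact: sqnorm_ge0.
- have si : (lam n).-integrable setT (fun eta => sqnorm L (fun t => fourier (slice f t) eta)).
    apply/integrableP; split => //.
    by under eq_integral do rewrite gee0_abs ?sqnorm_ge0//; rewrite swap.
  apply: filterS (integrable_ae measurableT si) => eta /(_ I).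
  rewrite (ge0_fin_numE (sqnorm_ge0 _ _)) => g2 _.
  rewrite -(plancherel1 _ (g1 eta) g2); last exact: (measurable_fun_pair1 eta mg).
  by apply: eq_sqnorm => tau; rewrite fourier_consRn.
Qed.

End plancherel.

(** * Invariance properties of Lebesgue measure *)

Section invariance.
Context {R : realType}.
Notation L := (@lebesgue_measure R).
Notation RR := (measurableTypeR R).
Notation lam n := (@lebesgue_Rn R n).

Let cV0 (x : Rn R 0) : x = 0. Proof. by apply/matrixP => -[]. Qed.

Let scales_step n (f1 : RR -> RR) (f2 : Rn R n -> Rn R n) (phi : Rn R n.+1 -> Rn R n.+1)
    (c1 c2 : R) : scales_by L f1 c1 -> scales_by (lam n) f2 c2 ->
  (forall p, phi (consRn p) = consRn (f1 p.1, f2 p.2)) ->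
  scales_by (lam n.+1) phi (c1 * c2).
Proof.
move=> s1 s2 hphi.
have [mf cc hf] := scales_by_prod s1 s2.
have phiE : phi = (@consRn R n) \o (fun z => (f1 z.1, f2 z.2)) \o (@unconsRn R n).
  apply/funext => x; rewrite -[RHS]/(consRn (f1 (unconsRn x).1, f2 (unconsRn x).2)).
  by rewrite -hphi unconsRnK.
have mphi : measurable_fun setT phi.
  rewrite phiE; apply: measurableT_comp; last exact: measurable_unconsRn.
  by apply: measurableT_comp => //; exact: measurable_consRn.
have [mc _ hc] := @scales_consRn R n.
split => // A mA.
have mA' : measurable (@consRn R n @^-1` A).
  by rewrite -[X in measurable X]setTI; exact: mc.
have := hc A mA; rewrite mul1e => <-.
have := hc (phi @^-1` A); rewrite mul1e => <-; last first.
  by rewrite -[X in measurable X]setTI; exact: mphi.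
rewrite -(hf _ mA'); congr ((L \x lam n)%E _).
by apply/seteqP; split => p /=; rewrite hphi.
Qed.

Lemma consRn_eq n (x : Rn R n.+1) (p : RR * Rn R n) :
  x ord0 ord0 = p.1 -> (forall k, x (lift ord0 k) ord0 = p.2 k ord0) -> x = consRn p.
Proof.
move=> h0 hS; apply/matrixP => i j; rewrite ord1.
have [->|[k ->]] : i = ord0 \/ exists k, i = lift ord0 k.
  by case: (unliftP ord0 i) => [k ->|->]; [right; exists k|left].
- by rewrite consRn0.
- by rewrite consRnS.
Qed.

Let scales_Rn0 (phi : Rn R 0 -> Rn R 0) : scales_by (lam 0) phi 1.
Proof.
have -> : phi = id by apply/funext => x; rewrite (cV0 (phi x)) (cV0 (id x)).
by split => // A mA; rewrite mul1e.
Qed.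

Lemma scales_addRn n (s : Rn R n) : scales_by (lam n) (fun x => x + s) 1.
Proof.
elim: n s => [|n IH] s; first exact: scales_Rn0.
rewrite -[1](mulr1 1); apply: (scales_step (scales_by_translation (s ord0 ord0))
  (IH (unconsRn s).2)) => p.
apply: consRn_eq => [|k]; rewrite mxE ?consRn0 ?consRnS//=.
by rewrite !mxE; congr (_ + s _ _); exact: val_inj.
Qed.

Lemma scales_oppRn n : scales_by (lam n) (fun x => - x) 1.
Proof.
elim: n => [|n IH]; first exact: scales_Rn0.
rewrite -[1](mulr1 1); apply: (scales_step (@scales_by_opp R) IH) => p.
by apply: consRn_eq => [|k]; rewrite mxE ?consRn0 ?consRnS//= mxE.
Qed.

Lemma scales_subRn n (a : Rn R n) : scales_by (lam n) (fun x => a - x) 1.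
Proof.
have := scales_by_comp (scales_addRn a) (scales_oppRn n).
by rewrite mul1r (_ : _ \o _ = fun x => a - x)//; apply/funext => x /=; rewrite addrC.
Qed.

Lemma scales_dilateRn n (c : R) : 0 < c ->
  scales_by (lam n) (fun x => c *: x) (c^-1 ^+ n).
Proof.
move=> c0; elim: n => [|n IH]; first by rewrite expr0; exact: scales_Rn0.
rewrite exprS; apply: (scales_step (scales_by_dilation c0) IH) => p.
by apply: consRn_eq => [|k]; rewrite mxE ?consRn0 ?consRnS//= mxE.
Qed.

Definition box n (r : R) : set (Rn R n) := [set x | forall i, `|x i ord0| <= r].
Arguments box : clear implicits.

Lemma measurable_coord n (i : 'I_n) : measurable_fun setT (fun x : Rn R n => x i ord0).
Proof. exact: (measurable_coords i). Qed.

Lemma measurable_box n r : measurable (box n r).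
Proof.
rewrite (_ : box n r = \bigcap_(i in [set: 'I_n]) ((fun x : Rn R n => x i ord0) @^-1` `[-r, r]%classic)).
  apply: fin_bigcap_measurable => // i _.
  by rewrite -[X in measurable X]setTI; apply: measurable_coord => //; exact: measurable_itv.
apply/seteqP; split => x /= h i; first by move=> _; rewrite /= in_itv/= -ler_norml.
by have := h i I; rewrite /= in_itv/= -ler_norml.
Qed.

Lemma lebesgue_box n r : 0 < r -> lam n (box n r) = ((2 * r) ^+ n)%:E.
Proof.
move=> r0; elim: n => [|n IH].
  rewrite (_ : box 0 r = setT); last by apply/seteqP; split => // x _ [].
  by rewrite expr0 -[LHS]/(\d_(0 : Rn R 0) setT) diracT.
have [mc _ hc] := @scales_consRn R n.
have := hc _ (@measurable_box n.+1 r); rewrite mul1e => <-.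
rewrite (_ : _ @^-1` _ = `[-r, r]%classic `*` box n r); last first.
  apply/seteqP; split => [p /= h|p /= [h1 h2] i].
    split => /=; first by rewrite in_itv/= -ler_norml -consRn0; exact: h.
    by move=> i; rewrite -consRnS; exact: h.
  have [->|[k ->]] : i = ord0 \/ exists k, i = lift ord0 k.
    by case: (unliftP ord0 i) => [k ->|->]; [right; exists k|left].
  - by rewrite consRn0; move: h1; rewrite in_itv/= -ler_norml.
  - by rewrite consRnS.
apply: etrans (product_measure1E L (lam n) (measurable_itv `[-r, r]) (@measurable_box n r)) _.
rewrite IH exprS EFinM; congr (_ * _)%E.
transitivity (@lebesgue_measure R `[-r, r]%classic) => //.
rewrite lebesgue_measure_itv/= lte_fin gt0_cp// -EFinB; congr EFin; ring.
Qed.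

Lemma measurable_mulmx n (O : 'M[R]_n) : measurable_fun setT (fun x : Rn R n => O *m x : Rn R n).
Proof.
apply: measurable_fun_coordsP => i.
apply: (eq_measurable_fun (fun x : Rn R n => \sum_j O i j * x j ord0)).
  by move=> x _; rewrite /= /coords mxE.
by apply: measurable_sum => j; apply: measurable_funM => //; exact: measurable_coord.
Qed.

Lemma measurable_addRn n d (T : measurableType d) (f g : T -> Rn R n) :
  measurable_fun setT f -> measurable_fun setT g -> measurable_fun setT (fun x => f x + g x).
Proof.
move=> mf mg; apply: measurable_fun_coordsP => i.
apply: (eq_measurable_fun (fun x => f x i ord0 + g x i ord0)).
  by move=> x _; rewrite /= /coords mxE.
by apply: measurable_funD; apply: (measurableT_comp (measurable_coord i)).
Qed.

Lemma measurable_subRn n d (T : measurableType d) (f g : T -> Rn R n) :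
  measurable_fun setT f -> measurable_fun setT g -> measurable_fun setT (fun x => f x - g x).
Proof.
move=> mf mg; apply: measurable_addRn => //.
by have [mo _ _] := scales_oppRn n; exact: measurableT_comp mo mg.
Qed.

Section orthogonal.
Variables (n : nat) (O : 'M[R]_n).
Hypothesis OTO : O^T *m O = 1%:M.

Let OOT : O *m O^T = 1%:M. Proof. by apply: mulmx1C. Qed.

Let phi (x : Rn R n) : Rn R n := O *m x.

Let mphi : measurable_fun setT phi. Proof. exact: measurable_mulmx. Qed.

Let nu (A : set (Rn R n)) : \bar R := lam n (phi @^-1` A).

Let ind (A : set (Rn R n)) (x : Rn R n) : \bar R := (\1_A x)%:E.

Let mind A : measurable A -> measurable_fun setT (ind A).
Proof. by move=> mA; apply/measurable_EFinP; exact: measurable_indic. Qed.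

Let ind_ge0 A x : (0 <= ind A x)%E. Proof. by rewrite lee_fin. Qed.

Let int_ind A : measurable A -> (\int[lam n]_x ind A x = lam n A)%E.
Proof. by move=> mA; rewrite integral_indic// setIT. Qed.

Let int_ind_phi A : measurable A -> (\int[lam n]_x ind A (phi x) = nu A)%E.
Proof.
move=> mA; have mA' : measurable (phi @^-1` A).
  by rewrite -[X in measurable X]setTI; exact: mphi.
by rewrite /nu -int_ind.
Qed.

(** Both sides compute the integral of 1_A (O x + y) 1_B y, by translating one
    variable by the other; this is the uniqueness of Haar measure. *)
Let uniqueness A B : measurable A -> measurable B ->
  (lam n B * nu A = lam n A * nu B)%E.
Proof.
move=> mA mB.
have mO := mphi.
have m1 : measurable_fun setT (fun z : Rn R n * Rn R n => phi z.1).
  exact: measurableT_comp mO _.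
transitivity (\int[lam n]_y \int[lam n]_x (ind B y * ind A (phi x)))%E.
  rewrite -int_ind// muleC -ge0_integralZl//; last exact: mind.
  apply: eq_integral => y _; rewrite muleC -int_ind_phi// ge0_integralZl//.
  exact: measurableT_comp (mind mA) mO.
transitivity (\int[lam n]_y \int[lam n]_x (ind B y * ind A (phi x + y)%R))%E.
  apply: eq_integral => y _.
  have := ge0_integral_scales (scales_addRn (O^T *m y))
    (f := fun x => (ind B y * ind A (phi x))%E).
  rewrite mul1e => <-//.
  - apply: eq_integral => x _; congr (_ * ind A _)%E.
    by rewrite /phi mulmxDr mulmxA OOT mul1mx.
  - by apply: measurable_funeM; exact: measurableT_comp (mind mA) mO.
  - by move=> x; rewrite mule_ge0.
transitivity (\int[lam n]_x \int[lam n]_y (ind B y * ind A (phi x + y)%R))%E.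
  apply/esym; apply: (sfinite_Fubini (lam n) (lam n)
    (fun z => (ind B z.2 * ind A (phi z.1 + z.2)%R)%E)).
    by move=> z; rewrite mule_ge0.
  apply: emeasurable_funM; first exact: measurableT_comp (mind mB) _.
  by apply: measurableT_comp (mind mA) _; exact: measurable_addRn.
transitivity (\int[lam n]_x \int[lam n]_y (ind B (y - phi x)%R * ind A y))%E.
  apply: eq_integral => x _.
  have := ge0_integral_scales (scales_addRn (- phi x))
    (f := fun y => (ind B y * ind A (phi x + y)%R)%E).
  rewrite mul1e => <-//.
  - by apply: eq_integral => y _; congr (_ * ind A _)%E; rewrite addrC subrK.
  - apply: emeasurable_funM; first exact: mind.
    by apply: measurableT_comp (mind mA) _; apply: measurable_addRn.
  - by move=> y; rewrite mule_ge0.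
transitivity (\int[lam n]_y \int[lam n]_x (ind B (y - phi x)%R * ind A y))%E.
  apply: (sfinite_Fubini (lam n) (lam n)
    (fun z => (ind B (z.2 - phi z.1)%R * ind A z.2)%E)).
    by move=> z; rewrite mule_ge0.
  apply: emeasurable_funM; last exact: measurableT_comp (mind mA) _.
  by apply: measurableT_comp (mind mB) _; exact: measurable_subRn.
rewrite -int_ind// muleC -ge0_integralZl//; last exact: mind.
apply: eq_integral => y _; rewrite -int_ind_phi// muleC -ge0_integralZl//; last first.
  exact: measurableT_comp (mind mB) mO.
have := ge0_integral_scales (scales_subRn (O^T *m y))
  (f := fun x => (ind B (y - phi x)%R * ind A y)%E).
rewrite mul1e => <-//.
- apply: eq_integral => x _; rewrite muleC; congr (_ * ind B _)%E.
  by rewrite /phi mulmxBr mulmxA OOT mul1mx opprB addrC subrK.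
- apply: emeasurable_funM; last by [].
  by apply: measurableT_comp (mind mB) _; exact: measurable_subRn.
- by move=> x; rewrite mule_ge0.
Qed.

Let ball : set (Rn R n) := [set x | dotv x x <= 1].

Let measurable_ball : measurable ball.
Proof.
rewrite (_ : ball = (fun x => dotv x x) @^-1` `]-oo, 1]%classic).
  have md : measurable_fun setT (fun x : Rn R n => dotv x x) by exact: measurable_dotv.
  by rewrite -[X in measurable X]setTI; apply: md => //; exact: measurable_itv.
by apply/seteqP; split => x /=; rewrite in_itv.
Qed.

Let dotv_mulmx x : dotv (phi x) (phi x) = dotv x x.
Proof.
have E (u : Rn R n) : dotv u u = (u^T *m u) ord0 ord0.
  by rewrite mxE; apply: eq_bigr => k _; rewrite mxE.
by rewrite !E /phi trmx_mul -mulmxA (mulmxA O^T) OTO mul1mx.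
Qed.

Let ball_gt0 : (0 < lam n ball)%E.
Proof.
have r0 : 0 < (n.+1%:R : R)^-1 by rewrite invr_gt0.
apply: (@lt_le_trans _ _ (lam n (box n n.+1%:R^-1))).
  by rewrite lebesgue_box// lte_fin exprn_gt0// mulr_gt0.
apply: le_measure; rewrite ?inE; [exact: measurable_box|exact: measurable_ball|].
move=> x xb; rewrite /ball /= /dotv.
apply: (@le_trans _ _ (\sum_(k < n) (n.+1%:R : R)^-1)).
  apply: ler_sum => k _; rewrite -expr2 -real_normK ?num_real//.
  apply: (@le_trans _ _ `|x k ord0|); last exact: xb.
  rewrite expr2 ler_piMr//; apply: (le_trans (xb k)).
  by rewrite invf_le1// ler1n.
rewrite sumr_const card_ord -[leLHS]mulr_natl ler_pdivrMr// mul1r ler_nat//.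
Qed.

Let ball_fin : (lam n ball < +oo)%E.
Proof.
apply: (@le_lt_trans _ _ (lam n (box n 1))); last by rewrite lebesgue_box// ltry.
apply: le_measure; rewrite ?inE; [exact: measurable_ball|exact: measurable_box|].
move=> x; rewrite /ball /= => xb i.
rewrite -(ler_pXn2r (n:=2))// ?nnegrE// expr1n real_normK ?num_real//.
apply: le_trans xb; rewrite /dotv (bigD1 i)//= -expr2 lerDl.
by apply: sumr_ge0 => k _; rewrite -expr2 sqr_ge0.
Qed.

(** By uniqueness the image measure is a multiple of Lebesgue measure, and the
    unit ball, which is mapped onto itself, shows that the factor is 1. *)
Lemma scales_orthogonal : scales_by (lam n) (fun x => O *m x) 1.
Proof.
split => // A mA; rewrite mul1e.
have nuball : nu ball = lam n ball.
  by rewrite /nu; congr (lam n _); apply/seteqP; split => x; rewrite /ball /= dotv_mulmx.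
have := uniqueness mA measurable_ball; rewrite nuball => /eqP.
have bf : lam n ball \is a fin_num by rewrite ge0_fin_numE.
rewrite (muleC (lam n A)) => /eqP h.
have [b bE] : exists b, lam n ball = b%:E by exists (fine (lam n ball)); rewrite fineK.
have b0 : b != 0 by move: ball_gt0; rewrite bE lte_fin => /gt_eqF ->.
have := congr1 (fun z => (b^-1)%:E * z)%E h; rewrite bE !muleA -!EFinM mulVf//.
by rewrite !mul1e.
Qed.

End orthogonal.

End invariance.

(** * Convolution *)

Section convolution.
Context {R : realType} {d : nat}.
Local Notation V := (Rn R d).
Local Notation mu := (@lebesgue_Rn R d).
Implicit Types (f g : V -> R[i]) (x : V).

Lemma measurable_reflect g x : measurable_fun setT g ->
  measurable_fun setT (fun y : V => g (x - y)).
Proof. by move=> mg; have [ms _ _] := scales_subRn x; exact: measurableT_comp mg ms. Qed.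

Lemma measurable_diff g : measurable_fun setT g ->
  measurable_fun setT (fun z : V * V => g (z.1 - z.2)).
Proof. by move=> mg; apply: measurableT_comp mg _; exact: measurable_subRn. Qed.

Lemma measurable_conv f g : measurable_fun setT f -> measurable_fun setT g ->
  measurable_fun setT (conv f g).
Proof.
move=> mf mg; apply: (measurable_Cfubini mu (f := fun z : V * V => f z.2 * g (z.1 - z.2))).
by apply: measurable_cmul; [exact: measurableT_comp mf _|exact: measurable_diff].
Qed.

Lemma conv_integrable f g x : measurable_fun setT f -> measurable_fun setT g ->
  (sqnorm mu f < +oo)%E -> (sqnorm mu g < +oo)%E ->
  cintegrable mu (fun y => f y * g (x - y)).
Proof.
move=> mf mg f2 g2; apply: cintegrable_mul2 => //; first exact: measurable_reflect.
by rewrite (sqnorm_scales (scales_subRn x) mg) mul1e.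
Qed.

Lemma conv_sub f h g x : measurable_fun setT f -> measurable_fun setT h ->
  measurable_fun setT g ->
  (sqnorm mu f < +oo)%E -> (sqnorm mu h < +oo)%E -> (sqnorm mu g < +oo)%E ->
  conv (fun y => f y - h y) g x = conv f g x - conv h g x.
Proof.
move=> mf mh mg f2 h2 g2.
rewrite [RHS](_ : _ = Cint mu (fun y => f y * g (x - y) - h y * g (x - y))).
  by apply: eq_cint => y; rewrite mulrBl.
by rewrite CintB//; exact: conv_integrable.
Qed.

Lemma conv_add f h g x : measurable_fun setT f -> measurable_fun setT h ->
  measurable_fun setT g ->
  (sqnorm mu f < +oo)%E -> (sqnorm mu h < +oo)%E -> (sqnorm mu g < +oo)%E ->
  conv (fun y => f y + h y) g x = conv f g x + conv h g x.
Proof.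
move=> mf mh mg f2 h2 g2.
rewrite [RHS](_ : _ = Cint mu (fun y => f y * g (x - y) + h y * g (x - y))).
  by apply: eq_cint => y; rewrite mulrDl.
by rewrite CintD//; exact: conv_integrable.
Qed.

Lemma conv_comm f g : measurable_fun setT f -> measurable_fun setT g ->
  (sqnorm mu f < +oo)%E -> (sqnorm mu g < +oo)%E ->
  conv f g = conv g f.
Proof.
move=> mf mg f2 g2; apply/funext => x.
have := Cint_scales (scales_subRn x) (conv_integrable x mf mg f2 g2).
rewrite mul1r => h; apply: etrans (esym h) _; apply: eq_cint => y.
by rewrite mulrC; congr (g _ * _); rewrite opprB addrC subrK.
Qed.

(** Convolutions of almost everywhere equal functions agree at every point. *)
Lemma ae_eq_conv f f' g g' : measurable_fun setT f -> measurable_fun setT f' ->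
  measurable_fun setT g -> measurable_fun setT g' ->
  f = f' %[ae mu] -> g = g' %[ae mu] -> conv f g = conv f' g'.
Proof.
move=> mf mf' mg mg' ff' gg'; apply/funext => x; apply: (ae_eq_Cint (mu := mu)).
- by apply: measurable_cmul => //; exact: measurable_reflect.
- by apply: measurable_cmul => //; exact: measurable_reflect.
- have gx : {ae mu, forall y, g (x - y) = g' (x - y)}.
    apply: (ae_scales (scales_subRn x) (P := fun y => g y = g' y)).
    by apply: filterS gg' => y /(_ I).
  by apply: filterS2 ff' gx => y /(_ I) -> ->.
Qed.

Let tonelli_conv (u v : V -> R) : measurable_fun setT u -> measurable_fun setT v ->
  (forall x, 0 <= u x) -> (forall x, 0 <= v x) ->
  (\int[mu]_x \int[mu]_y (u y * v (x - y)%R)%:E =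
   (\int[mu]_x (u x)%:E) * (\int[mu]_x (v x)%:E))%E.
Proof.
move=> mu_ mv u0 v0.
have mvd : measurable_fun setT (fun z : V * V => v (z.1 - z.2)).
  by apply: measurableT_comp mv _; exact: measurable_subRn.
rewrite (sfinite_Fubini mu mu (fun z : V * V => (u z.2 * v (z.1 - z.2)%R)%:E)); last 2 first.
- by move=> z; rewrite lee_fin mulr_ge0.
- apply/measurable_EFinP; apply: measurable_funM => //.
  exact: measurableT_comp mu_ _.
have mue : measurable_fun setT (fun x => (u x)%:E) by apply/measurable_EFinP.
have mve : measurable_fun setT (fun x => (v x)%:E) by apply/measurable_EFinP.
rewrite muleC -ge0_integralZl//; last 2 first.
- by move=> x _; rewrite lee_fin.
- by apply: integral_ge0 => x _; rewrite lee_fin.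
apply: eq_integral => y _; rewrite muleC.
have := ge0_integral_scales (scales_addRn (- y)) (f := fun x => (v x)%:E) mve.
rewrite mul1e => <-; last by move=> x; rewrite lee_fin.
rewrite -ge0_integralZl//.
- have [ms _ _] := scales_addRn (- y).
  exact: measurableT_comp mve ms.
- by move=> x _; rewrite lee_fin.
- by rewrite lee_fin.
Qed.

Let measurable_conv_pos (u v : V -> R) : measurable_fun setT u -> measurable_fun setT v ->
  (forall x, 0 <= u x) -> (forall x, 0 <= v x) ->
  measurable_fun setT (fun x => \int[mu]_y (u y * v (x - y)%R)%:E)%E.
Proof.
move=> mu_ mv u0 v0.
apply: (measurable_fun_fubini_tonelli_F (m2 := mu)
  (fun z : V * V => (u z.2 * v (z.1 - z.2))%:E)).
  apply/measurable_EFinP; apply: measurable_funM; first exact: measurableT_comp mu_ _.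
  by apply: measurableT_comp mv _; exact: measurable_subRn.
by move=> z; rewrite lee_fin mulr_ge0.
Qed.

Let cabs_conv_le f g x : measurable_fun setT f -> measurable_fun setT g ->
  ((cabs (conv f g x))%:E <= \int[mu]_y (cabs (f y) * cabs (g (x - y)%R))%:E)%E.
Proof.
move=> mf mg; apply: le_trans (cabs_Cint_le mu _) _.
  by apply: measurable_cmul => //; exact: measurable_reflect.
rewrite le_eqVlt; apply/orP; left; apply/eqP; apply: eq_integral => y _.
by rewrite cabsM.
Qed.

Lemma norm1_conv_le f g : measurable_fun setT f -> measurable_fun setT g ->
  (norm1 mu (conv f g) <= norm1 mu f * norm1 mu g)%E.
Proof.
move=> mf mg.
have maf := measurable_cabsT mf; have mag := measurable_cabsT mg.
rewrite -(tonelli_conv maf mag (fun=> cabs_ge0 _) (fun=> cabs_ge0 _)).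
apply: (ge0_le_integral mu measurableT).
- by move=> x _; rewrite lee_fin cabs_ge0.
- by apply: measurable_ecabs; exact: measurable_conv.
- exact: (measurable_conv_pos maf mag (fun=> cabs_ge0 _) (fun=> cabs_ge0 _)).
- by move=> x _; exact: cabs_conv_le.
Qed.

(** Young's inequality, by Cauchy-Schwarz for the measure |g (x - y)| dy. *)
Lemma sqnorm_conv_le f g : measurable_fun setT f -> measurable_fun setT g ->
  (sqnorm mu (conv f g) <= norm1 mu g ^+ 2 * sqnorm mu f)%E.
Proof.
move=> mf mg.
have maf := measurable_cabsT mf; have mag := measurable_cabsT mg.
have msf : measurable_fun setT (fun x => cabs (f x) ^+ 2) by exact: measurable_funX.
have msq : measurable_fun setT (fun x => Num.sqrt (cabs (g x))).
  by apply: measurableT_comp mag; exact: (continuous_measurable_fun (@sqrt_continuous R)).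
have bound x : ((cabs (conv f g x) ^+ 2)%:E <=
    norm1 mu g * \int[mu]_y (cabs (f y) ^+ 2 * cabs (g (x - y)%R))%:E)%E.
  have [msx _ _] := scales_subRn x.
  have msqx : measurable_fun setT (fun y : V => Num.sqrt (cabs (g (x - y)))).
    exact: measurableT_comp msq msx.
  have mu_ : measurable_fun setT (fun y : V => cabs (f y) * Num.sqrt (cabs (g (x - y)))).
    exact: measurable_funM.
  have := cauchy_schwarz mu msqx mu_.
  have -> : (\int[mu]_y (Num.sqrt (cabs (g (x - y)%R)) ^+ 2)%:E = norm1 mu g)%E.
    rewrite -[RHS]mul1e -(norm1_scales (scales_subRn x) mg).
    by apply: eq_integral => y _; rewrite sqr_sqrtr ?cabs_ge0.
  have -> : (\int[mu]_y ((cabs (f y) * Num.sqrt (cabs (g (x - y)%R))) ^+ 2)%:E =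
      \int[mu]_y (cabs (f y) ^+ 2 * cabs (g (x - y)%R))%:E)%E.
    by apply: eq_integral => y _; rewrite exprMn sqr_sqrtr ?cabs_ge0.
  apply: le_trans; rewrite EFin_expe lee_sqr ?lee_fin ?cabs_ge0//; last first.
    by apply: integral_ge0 => y _; rewrite lee_fin.
  apply: le_trans (cabs_conv_le x mf mg) _.
  rewrite le_eqVlt; apply/orP; left; apply/eqP; apply: eq_integral => y _.
  congr EFin; rewrite mulrCA -expr2 sqr_sqrtr ?cabs_ge0// ger0_norm//.
  by rewrite mulr_ge0 ?cabs_ge0.
rewrite expe2 -muleA muleC -muleA.
rewrite -(tonelli_conv msf mag (fun=> sqr_ge0 _) (fun=> cabs_ge0 _)).
have mI : measurable_fun setT (fun x => \int[mu]_y (cabs (f y) ^+ 2 * cabs (g (x - y)%R))%:E)%E.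
  exact: (measurable_conv_pos msf mag (fun=> sqr_ge0 _) (fun=> cabs_ge0 _)).
have I0 x : (0 <= \int[mu]_y (cabs (f y) ^+ 2 * cabs (g (x - y)%R))%:E)%E.
  by apply: integral_ge0 => y _; rewrite lee_fin mulr_ge0 ?sqr_ge0 ?cabs_ge0.
rewrite -ge0_integralZl//; last exact: norm1_ge0.
apply: (ge0_le_integral mu measurableT).
- by move=> x _; rewrite lee_fin sqr_ge0.
- by apply: measurable_esqcabs; exact: measurable_conv.
- exact: measurable_funeM.
- by move=> x _; exact: bound.
Qed.

(** Young's inequality with the roles of the two factors exchanged: for signals of
    small L1 norm. *)
Lemma sqnorm_conv_le' f g : measurable_fun setT f -> measurable_fun setT g ->
  (sqnorm mu f < +oo)%E -> (sqnorm mu g < +oo)%E ->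
  (sqnorm mu (conv f g) <= norm1 mu f ^+ 2 * sqnorm mu g)%E.
Proof. by move=> mf mg f2 g2; rewrite conv_comm//; exact: sqnorm_conv_le. Qed.

Lemma sqnorm_conv_fin f g : measurable_fun setT f -> measurable_fun setT g ->
  (sqnorm mu f < +oo)%E -> (norm1 mu g < +oo)%E ->
  (sqnorm mu (conv f g) < +oo)%E.
Proof.
move=> mf mg f2 g1; apply: le_lt_trans (sqnorm_conv_le mf mg) _.
have g1' : norm1 mu g \is a fin_num by rewrite ge0_fin_numE// norm1_ge0.
by rewrite lte_mul_pinfty ?fin_numX// expe_ge0// norm1_ge0.
Qed.

Lemma dotv_subl (x y xi : V) : dotv (x - y) xi = dotv x xi - dotv y xi.
Proof. by rewrite /dotv -sumrB; apply: eq_bigr => k _; rewrite !mxE mulrBl. Qed.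

Lemma character_sub (x y xi : V) : character x xi = character (x - y) xi * character y xi.
Proof. by rewrite /character -cexpiD dotv_subl; congr cexpi; ring. Qed.

(** Fubini's theorem, after splitting the kernel at x = (x - y) + y. *)
Theorem fourier_conv f g xi : measurable_fun setT f -> measurable_fun setT g ->
  (norm1 mu f < +oo)%E -> (norm1 mu g < +oo)%E ->
  (sqnorm mu f < +oo)%E -> (sqnorm mu g < +oo)%E ->
  fourier (conv f g) xi = fourier f xi * fourier g xi.
Proof.
move=> mf mg f1 g1 f2 g2.
pose F (z : V * V) := f z.2 * g (z.1 - z.2) * character z.1 xi.
have mF : measurable_fun setT F.
  apply: measurable_cmul; first apply: measurable_cmul.
  - exact: measurableT_comp mf _.
  - exact: measurable_diff.
  - exact: (measurable_character (f := fst) (g := cst xi)).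
have Fi : cintegrable (mu \x mu)%E F.
  split => //; rewrite norm1_tonelli//.
  rewrite (_ : (\int[mu]_x _)%E = (norm1 mu f * norm1 mu g)%E).
    by rewrite lte_mul_pinfty ?norm1_ge0// ge0_fin_numE ?norm1_ge0.
  rewrite -(tonelli_conv (measurable_cabsT mf) (measurable_cabsT mg) (fun=> cabs_ge0 _) (fun=> cabs_ge0 _)).
  apply: eq_integral => x _; apply: eq_integral => y _.
  by rewrite /F /= !cabsM cabs_character mulr1.
transitivity (Cint mu (fun x => Cint mu (fun y => F (x, y)))).
  apply: eq_cint => x; rewrite -[conv f g x]/(Cint mu _) -CintZr//.
  exact: conv_integrable.
rewrite -(Cfubini_swap Fi).
have gi : cintegrable mu (fun x => g x * character x xi).
  apply: (cintegrable_bounded (M := 1) (conj mg g1)).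
    exact: (measurable_character (f := id) (g := cst xi)).
  by move=> x; rewrite cabs_character.
have fi : cintegrable mu (fun x => f x * character x xi).
  apply: (cintegrable_bounded (M := 1) (conj mf f1)).
    exact: (measurable_character (f := id) (g := cst xi)).
  by move=> x; rewrite cabs_character.
transitivity (Cint mu (fun y => (f y * character y xi) * fourier g xi)); last exact: CintZr.
apply: eq_cint => y.
have := Cint_scales (scales_addRn (- y)) gi; rewrite mul1r => h.
have gyi := cintegrable_scales (scales_addRn (- y)) gi.
rewrite -[fourier g xi]h -CintZ; last exact: gyi.
by apply: eq_cint => x; rewrite /F /= (character_sub x y); ring.
Qed.

End convolution.

(** * Countable sums and the frame identity *)

Section esum_seq.
Context {R : realType} {T : choiceType}.
Implicit Types (S : set T) (a : T -> \bar R) (s : seq T).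

Lemma le_esum_seq S a s : uniq s -> (forall x, x \in s -> S x) ->
  (\sum_(x <- s) a x <= \esum_(x in S) a x)%E.
Proof.
move=> us sS; apply: esum_ge; exists [set` s].
  by split; [exact: finite_seq|move=> x /=; exact: sS].
by rewrite -fsbig_seq.
Qed.

Lemma esum_le_seq S a (C : \bar R) :
  (forall s, uniq s -> (forall x, x \in s -> S x) -> (\sum_(x <- s) a x <= C)%E) ->
  (\esum_(x in S) a x <= C)%E.
Proof.
move=> h; apply: ge_ereal_sup => _ [A [fA AS] <-].
rewrite fsbig_finite//; apply: h => [|x]; first exact: finmap.fset_uniq.
by move=> hx; have := in_fset_set fA x; rewrite [LHS]hx => /esym/set_mem/AS.
Qed.

Lemma esum_gt_seq S a (y : \bar R) : (y < \esum_(x in S) a x)%E ->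
  exists s, [/\ uniq s, forall x, x \in s -> S x & (y < \sum_(x <- s) a x)%E].
Proof.
move=> /ereal_sup_gt[_ [A [fA AS] <-]]; rewrite fsbig_finite// => yA.
exists (finmap.enum_fset (fset_set A)); split => //.
by move=> x hx; have := in_fset_set fA x; rewrite [LHS]hx => /esym/set_mem/AS.
Qed.

Lemma esum_lin S a b (c k : R) : 0 <= c -> 0 <= k ->
  (forall x, S x -> 0 <= a x)%E -> (forall x, S x -> 0 <= b x)%E ->
  (\esum_(x in S) (c%:E * a x + k%:E * b x) <=
   c%:E * (\esum_(x in S) a x) + k%:E * (\esum_(x in S) b x))%E.
Proof.
move=> c0 k0 a0 b0; apply: esum_le_seq => s us sS.
have sumZ (m : R) (f : T -> \bar R) : (forall x, S x -> 0 <= f x)%E ->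
    (\sum_(x <- s) m%:E * f x = m%:E * \sum_(x <- s) f x)%E.
  move=> f0; rewrite big_seq [in RHS]big_seq ge0_sume_distrr//.
  by move=> x /sS/f0.
rewrite big_split/= !sumZ//.
by apply: leeD; apply: lee_wpmul2l => //; exact: le_esum_seq.
Qed.

End esum_seq.

Section countable_esum.
Context (R : realType) (d : measure_display) (T : measurableType d) (I : choiceType).
Variables (mu : {measure set T -> \bar R}) (S D : set I) (e : nat -> I).
Variable g : I -> T -> \bar R.
Hypothesis eb : set_bij setT S e.
Hypothesis DS : D `<=` S.
Hypothesis mg : forall i, D i -> measurable_fun setT (g i).
Hypothesis g0 : forall i x, (0 <= g i x)%E.

(** The enumeration e of the superset S turns sums over D into series; this
    avoids distinguishing finite from infinite D. *)
Let esumE (a : I -> \bar R) : (forall i, 0 <= a i)%E ->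
  (\esum_(i in D) a i = \sum_(0 <= n <oo) (if e n \in D then a (e n) else 0))%E.
Proof.
move=> a0; rewrite -{1}((setIidPl _ _).2 DS) esum_mkcondl (reindex_esum setT S e _ eb).
by rewrite nneseries_esumT// => n; case: ifP.
Qed.

Let mterm n : measurable_fun setT (fun x => if e n \in D then g (e n) x else 0%E).
Proof.
by case: (boolP (e n \in D)) => [/set_mem/mg|_] //; exact: measurable_cst.
Qed.

Lemma measurable_esum : measurable_fun setT (fun x => \esum_(i in D) g i x)%E.
Proof.
under eq_fun do rewrite esumE//.
apply: ge0_emeasurable_sum => //.
by move=> n x _ _; case: ifP.
Qed.

Lemma integral_esum :
  (\int[mu]_x (\esum_(i in D) g i x) = \esum_(i in D) \int[mu]_x g i x)%E.
Proof.
rewrite esumE; last by move=> i; exact: integral_ge0.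
under eq_integral do rewrite esumE//.
rewrite integral_nneseries//.
- by apply: eq_eseriesr => n _; case: ifP => // _; rewrite integral0.
- by move=> n x _; case: ifP.
Qed.

End countable_esum.

(** Lets the weight t and the error tend to 0 in an estimate of weighted
    parallelogram type. *)
Lemma le_weighted_limit (R : realType) (A S : \bar R) : (0 <= S)%E ->
  (forall t e : R, 0 < t -> 0 < e ->
    (A <= (1 + t)%:E * S + (1 + t^-1)%:E * e%:E)%E) -> (A <= S)%E.
Proof.
case: S => [S| |] //; last by move=> _ _; rewrite leey.
rewrite lee_fin => S0 h; apply/lee_addgt0Pr => e e0.
have S1 : 0 < S + 1 by rewrite ltr_wpDl.
pose t := e / 2 / (S + 1).
have t0 : 0 < t by rewrite !divr_gt0.
have t1 : 0 < 1 + t^-1 by rewrite addr_gt0// invr_gt0.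
apply: le_trans (h t (e / 2 / (1 + t^-1)) t0 _) _; first by rewrite !divr_gt0.
rewrite -!EFinM -!EFinD lee_fin.
have -> : (1 + t^-1) * (e / 2 / (1 + t^-1)) = e / 2.
  by rewrite mulrCA mulfV ?mulr1// gt_eqF.
have : t * S <= e / 2.
  rewrite /t mulrAC ler_pdivrMr// ler_wpM2l ?divr_ge0 ?(ltW e0)//.
  by rewrite lerDl.
by rewrite mulrDl mul1r; lra.
Qed.

Section frame.
Context {R : realType} {d : nat}.
Local Notation V := (Rn R d).
Local Notation mu := (@lebesgue_Rn R d).
Variables (chi : L0 R d) (Psi : set (L0 R d)).
Hypothesis filters : scattering_filters chi Psi.
Hypothesis chi1 : (norm1 mu chi < +oo)%E.
Hypothesis chi2 : (sqnorm mu chi < +oo)%E.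
Hypothesis Psi1 : forall F : L0 R d, Psi F -> (norm1 mu F < +oo)%E.
Hypothesis Psi2 : forall F : L0 R d, Psi F -> (sqnorm mu F < +oo)%E.

Lemma measurable_L0 (F : L0 R d) : measurable_fun setT (F : V -> R[i]).
Proof. exact: measurable_funP. Qed.

Let enumeration : exists e : nat -> L0 R d, set_bij setT (chi |` Psi) e.
Proof.
have [c _] := filters.
have /card_set_bijP[f [ff fi fs]] := c.
have /choice[e he] : forall n, exists x, (chi |` Psi) x /\ f x = n.
  by move=> n; have [x Sx <-] := fs n I; exists x.
exists e; split.
- by move=> n _; have [] := he n.
- by move=> m n _ _ emn; have [_ <-] := he m; have [_ <-] := he n; rewrite emn.
- move=> x Sx; exists (f x) => //; have [Sy fy] := he (f x).
  by apply: fi; rewrite ?inE.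
Qed.

Lemma measurable_fourierL0 (F : L0 R d) : measurable_fun setT (fourier F).
Proof. by apply: measurable_fourier; exact: measurable_L0. Qed.

Let sqnorm_conv_fourier (f : V -> R[i]) (F : L0 R d) :
  measurable_fun setT f -> (norm1 mu f < +oo)%E -> (sqnorm mu f < +oo)%E ->
  (norm1 mu F < +oo)%E -> (sqnorm mu F < +oo)%E ->
  sqnorm mu (conv f F) =
  (\int[mu]_xi ((cabs (fourier f xi) ^+ 2)%:E * (cabs (fourier F xi) ^+ 2)%:E))%E.
Proof.
move=> mf f1 f2 F1 F2; have mF := measurable_L0 F.
rewrite -plancherel.
- by apply: eq_integral => xi _; rewrite fourier_conv// cabsM exprMn EFinM.
- exact: measurable_conv.
- apply: le_lt_trans (norm1_conv_le mf mF) _.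
  by rewrite lte_mul_pinfty ?norm1_ge0// ge0_fin_numE ?norm1_ge0.
- exact: sqnorm_conv_fin.
Qed.

(** By Plancherel's identity the left-hand side is the integral of |f^|^2 times
    the sum of the squared transforms of all filters, which is 1 almost
    everywhere. *)
Lemma frame_identity (f : V -> R[i]) : measurable_fun setT f ->
  (norm1 mu f < +oo)%E -> (sqnorm mu f < +oo)%E ->
  (sqnorm mu (conv f chi) + \esum_(F in Psi) sqnorm mu (conv f (F : L0 R d)) = sqnorm mu f)%E.
Proof.
move=> mf f1 f2; have [e eb] := enumeration.
have mff := measurable_esqcabs (measurable_fourier mf).
have mFF (F : L0 R d) := measurable_esqcabs (measurable_fourierL0 F).
rewrite sqnorm_conv_fourier//.
have -> : (\esum_(F in Psi) sqnorm mu (conv f (F : L0 R d)) =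
    \int[mu]_xi \esum_(F in Psi) ((cabs (fourier f xi) ^+ 2)%:E *
      (cabs (fourier (F : L0 R d) xi) ^+ 2)%:E))%E.
  rewrite (integral_esum _ eb); last 3 first.
  - by move=> F PF; right.
  - by move=> F PF; exact: emeasurable_funM.
  - by move=> F x; rewrite mule_ge0// lee_fin sqr_ge0.
  apply: eq_esum => F PF; apply: sqnorm_conv_fourier => //; [exact: Psi1|exact: Psi2].
have mes : measurable_fun setT (fun xi => \esum_(F in Psi) ((cabs (fourier f xi) ^+ 2)%:E *
      (cabs (fourier (F : L0 R d) xi) ^+ 2)%:E)%E).
  apply: (measurable_esum eb); first by move=> F PF; right.
  - by move=> F PF; exact: emeasurable_funM.
  - by move=> F x; rewrite mule_ge0// lee_fin sqr_ge0.
rewrite -ge0_integralD//; last 3 first.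
- by move=> x _; rewrite mule_ge0// lee_fin sqr_ge0.
- exact: emeasurable_funM.
- by move=> x _; apply: esum_ge0 => F _; rewrite mule_ge0// lee_fin sqr_ge0.
rewrite -(plancherel mf f1 f2); apply: (ge0_ae_eq_integral measurableT).
- by apply: emeasurable_funD => //; exact: emeasurable_funM.
- exact: mff.
- move=> x _; rewrite adde_ge0// ?mule_ge0 ?lee_fin ?sqr_ge0//.
  by apply: esum_ge0 => F _; rewrite mule_ge0// lee_fin sqr_ge0.
- by move=> x _; rewrite lee_fin sqr_ge0.
have [_ h] := filters; apply: filterS h => xi h _.
have sq0 (z : R[i]) : (0 <= (cabs z ^+ 2)%:E)%E by rewrite lee_fin sqr_ge0.
have esZ : (\esum_(F in Psi) ((cabs (fourier f xi) ^+ 2)%:E *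
      (cabs (fourier (F : L0 R d) xi) ^+ 2)%:E) =
   (cabs (fourier f xi) ^+ 2)%:E * \esum_(F in Psi) (cabs (fourier (F : L0 R d) xi) ^+ 2)%:E)%E.
  apply/eqP; rewrite eq_le; apply/andP; split.
    apply: esum_le_seq => s us sS; rewrite -ge0_sume_distrr//.
    by apply: lee_wpmul2l => //; exact: le_esum_seq.
  have [->|c0] := eqVneq (cabs (fourier f xi)) 0.
    by rewrite expr0n mul0e; apply: esum_ge0 => F _; rewrite mule_ge0.
  have cpos : 0 < cabs (fourier f xi) ^+ 2 by rewrite exprn_gt0// lt_neqAle eq_sym c0 cabs_ge0.
  rewrite -lee_pdivlMl//; apply: esum_le_seq => s us sS.
  rewrite lee_pdivlMl// ge0_sume_distrr//.
  exact: (le_esum_seq (fun F : L0 R d => ((cabs (fourier f xi) ^+ 2)%:E *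
      (cabs (fourier F xi) ^+ 2)%:E)%E) us sS).
rewrite esZ -ge0_muleDr//; first by rewrite h mule1.
by apply: esum_ge0.
Qed.

(** Integrable functions are dense in L2, by truncation. *)
Lemma integrable_approx (f : V -> R[i]) (e : R) :
  measurable_fun setT f -> (sqnorm mu f < +oo)%E -> 0 < e ->
  exists g, [/\ measurable_fun setT g, (norm1 mu g < +oo)%E,
    (sqnorm mu g <= sqnorm mu f)%E & (sqnorm mu (fun x => f x - g x)%R <= e%:E)%E].
Proof.
move=> mf f2 e0.
pose B (k : nat) := @box R d k%:R.
have mB k : measurable (B k) by exact: measurable_box.
have Bcov x : \forall k \near \oo, B k x.
  pose m := \sum_(i < d) `|x i ord0|.
  apply: filterS (nbhs_infty_ger m) => k mk i; apply: le_trans mk.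
  by rewrite /m (bigD1 i)//= lerDl sumr_ge0.
have muB k : (mu (B k) < +oo)%E.
  apply: (@le_lt_trans _ _ (mu (@box R d k.+1%:R))); last by rewrite lebesgue_box// ltry.
  apply: le_measure; rewrite ?inE; [exact: measurable_box|exact: measurable_box|].
  by move=> x xk i; apply: le_trans (xk i) _; rewrite ler_nat.
have /ge0_cvge0P := sqnorm_trunc_cvg mB Bcov mf f2.
move=> /(_ (fun n => sqnorm_ge0 _ _) e e0) [k _ /(_ k (leqnn k)) hk].
exists (trunc B f k); split => //.
- exact: measurable_trunc.
- exact: (norm1_trunc mB mf (muB k)).
- apply: sqnorm_le => //; first exact: measurable_trunc.
  by move=> x; exact: trunc_le.
Qed.

(** The frame identity yields the inequality for integrable functions. For finitely
    many filters, Young's inequality bounds the effect of truncating f by a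
    multiple of the truncation error, the multiple being at most K. *)
Theorem bessel (f : V -> R[i]) : measurable_fun setT f -> (sqnorm mu f < +oo)%E ->
  (\esum_(F in Psi) sqnorm mu (conv f (F : L0 R d)) <= sqnorm mu f)%E.
Proof.
move=> mf f2; apply: esum_le_seq => s us sPsi.
pose K := (1 + \sum_(F <- s) fine (norm1 mu (F : L0 R d)) ^+ 2)%R.
have K0 : 0 < K by rewrite ltr_pwDl// sumr_ge0// => F _; exact: sqr_ge0.
apply: le_weighted_limit => [|t e t0 e0]; first exact: sqnorm_ge0.
have [fk [mk k1 kle hk]] := integrable_approx mf f2 (divr_gt0 e0 K0).
have k2 : (sqnorm mu fk < +oo)%E by exact: le_lt_trans kle f2.
have mfk := measurable_csub mf mk.
have t1 : 0 <= 1 + t by rewrite addr_ge0// ltW.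
have t2 : 0 <= 1 + t^-1 by rewrite addr_ge0// invr_ge0 ltW.
have step (F : L0 R d) : F \in s -> (sqnorm mu (conv f F) <=
    (1 + t)%:E * sqnorm mu (conv fk F) +
    (1 + t^-1)%:E * ((fine (norm1 mu F) ^+ 2)%:E * (e / K)%:E))%E.
  move=> /sPsi PF; have mF := measurable_L0 F.
  have := sqnorm_weighted mu t0 (measurable_conv mf mF) (measurable_conv mk mF).
  move=> h; apply: le_trans h _; rewrite leeD2l// lee_wpmul2l//.
  rewrite (_ : (fun x => _) = conv (fun y => f y - fk y) F); last first.
    by apply/funext => x; rewrite conv_sub//; exact: Psi2.
  apply: le_trans (sqnorm_conv_le mfk mF) _.
  have F1 : norm1 mu F \is a fin_num by rewrite ge0_fin_numE ?norm1_ge0//; exact: Psi1.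
  by rewrite EFin_expe fineK// lee_wpmul2l// expe_ge0// norm1_ge0.
apply: (@le_trans _ _ (\sum_(F <- s) ((1 + t)%:E * sqnorm mu (conv fk (F : L0 R d)) +
    (1 + t^-1)%:E * ((fine (norm1 mu (F : L0 R d)) ^+ 2)%:E * (e / K)%:E)))%E).
  by rewrite big_seq [leRHS]big_seq; apply: lee_sum => F; exact: step.
rewrite big_split/=; apply: leeD.
  rewrite -ge0_sume_distrr; last by move=> F _; exact: sqnorm_ge0.
  apply: lee_wpmul2l => //; apply: le_trans kle; rewrite -(frame_identity mk k1 k2).
  apply: le_trans (le_esum_seq (fun F : L0 R d => sqnorm mu (conv fk F)) us sPsi) _.
  by rewrite leeDr// sqnorm_ge0.
under eq_bigr do rewrite -!EFinM.
rewrite sumEFin -EFinM lee_fin -big_distrr/=; apply: ler_wpM2l => //.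
rewrite -big_distrl/= mulrCA ler_piMr ?(ltW e0)//.
by rewrite ler_pdivrMr// mul1r /K lerDr.
Qed.

End frame.

(** * Dilations of signals and filters *)

Section L0_classes.
Context {R : realType} {d : nat}.
Local Notation V := (Rn R d).
Local Notation mu := (@lebesgue_Rn R d).
Local Open Scope quotient_scope.

Definition mkL0 (f : V -> R[i]) (mf : measurable_fun setT f) : L0 R d :=
  \pi_(L0 R d) (HB.pack f (isMeasurableFun.Build _ _ _ _ f mf) : {mfun V >-> R[i]}).

Lemma mkL0E (f : V -> R[i]) (mf : measurable_fun setT f) :
  (mkL0 mf : V -> R[i]) = f %[ae mu].
Proof.
rewrite /mkL0; set g := (X in \pi_(L0 R d) X).
have /eqmodP/asboolP : repr (\pi_(L0 R d) g) = g %[mod L0 R d] by rewrite reprK.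
by [].
Qed.

Lemma L0_eqP (f g : L0 R d) : (f : V -> R[i]) = g %[ae mu] -> f = g.
Proof. by move=> /ae_eqP/eqP; rewrite !reprK. Qed.

Lemma in_Lp1P (F : L0 R d) : in_Lp 1%E F <-> (norm1 mu F < +oo)%E.
Proof.
rewrite /in_Lp /Lnormc Lnorm1; under eq_integral do rewrite abse_EFin ger0_norm ?cabs_ge0//.
by [].
Qed.

Lemma in_Lp2P (F : V -> R[i]) : (Lnormc 2%:E F < +oo)%E <-> (sqnorm mu F < +oo)%E.
Proof.
rewrite -sqr_Lnormc2 -/(Lnormc 2%:E F).
have : (0 <= Lnormc 2%:E F)%E by exact: Lnorm_ge0.
by case: (Lnormc _ _) => [r| |] //= _; rewrite ?expe2 ?mulyy// -EFinM !ltry.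
Qed.

End L0_classes.

Section dilations.
Context {R : realType} {d : nat}.
Local Notation V := (Rn R d).
Local Notation mu := (@lebesgue_Rn R d).
Implicit Types (f g F : V -> R[i]) (c : R).

(** The L2-normalised dilation, for signals. *)
Definition dil c f : V -> R[i] := fun x => (Num.sqrt (c ^+ d))%:C * f (c *: x).

(** The L1-normalised dilation, for filters. *)
Definition dil1 c F : V -> R[i] := fun x => (c ^+ d)%:C * F (c *: x).

Lemma measurable_comp_scale c f : 0 < c -> measurable_fun setT f ->
  measurable_fun setT (fun x : V => f (c *: x)).
Proof. by move=> c0 mf; have [ms _ _] := @scales_dilateRn R d c c0; exact: measurableT_comp mf ms. Qed.

Lemma measurable_dil c f : 0 < c -> measurable_fun setT f -> measurable_fun setT (dil c f).
Proof.
move=> c0 mf; apply: measurable_cmul; first exact: measurable_cst.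
exact: measurable_comp_scale.
Qed.

Lemma measurable_dil1 c F : 0 < c -> measurable_fun setT F -> measurable_fun setT (dil1 c F).
Proof.
move=> c0 mf; apply: measurable_cmul; first exact: measurable_cst.
exact: measurable_comp_scale.
Qed.

Lemma norm1Z (k : R[i]) f : measurable_fun setT f ->
  (norm1 mu (fun x => k * f x)%R = (cabs k)%:E * norm1 mu f)%E.
Proof.
move=> mf; rewrite /norm1 -ge0_integralZl//.
- by apply: eq_integral => x _; rewrite cabsM EFinM.
- exact: measurable_ecabs.
- by move=> x _; rewrite lee_fin cabs_ge0.
- by rewrite lee_fin cabs_ge0.
Qed.

Lemma sqnorm_dil c f : 0 < c -> measurable_fun setT f -> sqnorm mu (dil c f) = sqnorm mu f.
Proof.
move=> c0 mf; rewrite sqnormZ; last exact: measurable_comp_scale.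
rewrite (sqnorm_scales (scales_dilateRn d c0) mf) muleA -EFinM cabs_real.
rewrite ger0_norm ?sqrtr_ge0// sqr_sqrtr ?exprn_ge0 ?(ltW c0)//.
by rewrite exprVn mulfV ?mul1e// expf_neq0// gt_eqF.
Qed.

Lemma norm1_dil c f : 0 < c -> measurable_fun setT f ->
  norm1 mu (dil c f) = ((Num.sqrt (c ^+ d))^-1%:E * norm1 mu f)%E.
Proof.
move=> c0 mf; rewrite norm1Z; last exact: measurable_comp_scale.
rewrite (norm1_scales (scales_dilateRn d c0) mf) muleA -EFinM cabs_real.
rewrite ger0_norm ?sqrtr_ge0//; congr (_%:E * _)%E.
have cd0 : 0 < c ^+ d by rewrite exprn_gt0.
rewrite exprVn -{2}(sqr_sqrtr (ltW cd0)) expr2 invfM mulrA mulfV ?mul1r//.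
by rewrite gt_eqF// sqrtr_gt0.
Qed.

Lemma sqnorm_dil1 c F : 0 < c -> measurable_fun setT F ->
  sqnorm mu (dil1 c F) = ((c ^+ d)%:E * sqnorm mu F)%E.
Proof.
move=> c0 mf; rewrite sqnormZ; last exact: measurable_comp_scale.
rewrite (sqnorm_scales (scales_dilateRn d c0) mf) muleA -EFinM cabs_real.
rewrite ger0_norm ?exprn_ge0 ?(ltW c0)//; congr (_%:E * _)%E.
by rewrite exprVn expr2 -mulrA mulfV ?mulr1// expf_neq0// gt_eqF.
Qed.

(** The two normalisations make convolution commute with dilations. *)
Lemma conv_dil c f F : 0 < c -> measurable_fun setT f -> measurable_fun setT F ->
  (sqnorm mu f < +oo)%E -> (sqnorm mu F < +oo)%E ->
  conv (dil c f) (dil1 c F) = dil c (conv f F).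
Proof.
move=> c0 mf mF f2 F2; apply/funext => x.
have hi := conv_integrable (c *: x) mf mF f2 F2.
have hi' := cintegrableZ ((c ^+ d)%:C * (Num.sqrt (c ^+ d))%:C) hi.
have := Cint_scales (scales_dilateRn d c0) hi'; rewrite (CintZ _ hi) => h.
transitivity (Cint mu (fun y => (c ^+ d)%:C * (Num.sqrt (c ^+ d))%:C *
    (f (c *: y) * F (c *: x - c *: y)))).
  by apply: eq_cint => y; rewrite /dil /dil1 -scalerBr; ring.
rewrite h !mulrA /dil; congr (_ * _); rewrite -[LHS]mul1r -[RHS]mul1r.
have -> : (c^-1 ^+ d)%:C * (c ^+ d)%:C = 1 :> R[i].
  by rewrite -[_ * _]rmorphM/= exprVn mulVf// expf_neq0// gt_eqF.
by rewrite !mul1r.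
Qed.

Lemma dil_dil c k f : 0 < c -> 0 < k -> dil c (dil k f) = dil (c * k) f.
Proof.
move=> c0 k0; apply/funext => x; rewrite /dil mulrA scalerA (mulrC k); congr (_ * _).
by rewrite exprMn sqrtrM ?exprn_ge0 ?(ltW c0)// rmorphM.
Qed.

Lemma dil_abs c f : 0 < c ->
  dil c (fun x => (cabs (f x))%:C) = fun x => (cabs (dil c f x))%:C.
Proof.
move=> c0; apply/funext => x; rewrite /dil cabsM cabs_real ger0_norm ?sqrtr_ge0//.
by rewrite rmorphM.
Qed.

Lemma dil_sub c f g : dil c (fun x => f x - g x) = fun x => dil c f x - dil c g x.
Proof. by apply/funext => x; rewrite /dil mulrBr. Qed.

Definition dilL0 c (F : L0 R d) (c0 : 0 < c) : L0 R d :=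
  mkL0 (measurable_dil1 c0 (measurable_L0 F)).

Lemma dilL0_inj c (c0 : 0 < c) : injective (fun F : L0 R d => dilL0 F c0).
Proof.
move=> F F' /= FF'; apply: L0_eqP.
have h1 := mkL0E (measurable_dil1 c0 (measurable_L0 F)).
have h2 := mkL0E (measurable_dil1 c0 (measurable_L0 F')).
have cd : (c ^+ d)%:C != 0 :> R[i].
  have cd' : c ^+ d != 0 by rewrite expf_neq0// gt_eqF.
  by apply: contra_neq cd' => /(congr1 (@complex.Re R)).
have h : {ae mu, forall x, F (c *: x) = F' (c *: x)}.
  apply: filterS2 h1 h2 => x /(_ I) e1 /(_ I) e2; apply: (mulfI cd).
  by move: e1 e2; rewrite -/(dilL0 F c0) -/(dilL0 F' c0) FF' => -> .
have ci : 0 < c^-1 by rewrite invr_gt0.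
have := ae_scales (scales_dilateRn d ci) h.
by apply: filterS => x; rewrite scalerA mulfV ?scale1r ?gt_eqF.
Qed.

End dilations.

Section wavelet_filters.
Context {R : realType} {d : nat}.
Local Notation V := (Rn R d).
Local Notation mu := (@lebesgue_Rn R d).
Variables (a : R) (psi : L0 R d).
Hypothesis a1 : 1 < a.

Let a0 : 0 < a. Proof. exact: lt_trans a1. Qed.

Section comp.
Variables (phi : V -> V) (c : R) (k : R[i]).
Hypothesis phic : scales_by mu phi c.

Let mphi : measurable_fun setT (fun x => psi (phi x)).
Proof. by have [ms _ _] := phic; exact: measurableT_comp (measurable_L0 psi) ms. Qed.

Lemma measurable_wav : measurable_fun setT (fun x => k * psi (phi x)).
Proof. by apply: measurable_cmul => //; exact: measurable_cst. Qed.

Lemma norm1_wav : (norm1 mu psi < +oo)%E -> (norm1 mu (fun x => (k * psi (phi x))%R) < +oo)%E.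
Proof.
move=> p1; rewrite norm1Z// (norm1_scales phic (measurable_L0 psi)).
have [_ c0 _] := phic.
by rewrite !lte_mul_pinfty// ?lee_fin ?cabs_ge0 ?mule_ge0 ?norm1_ge0.
Qed.

Lemma sqnorm_wav : (sqnorm mu psi < +oo)%E -> (sqnorm mu (fun x => (k * psi (phi x))%R) < +oo)%E.
Proof.
move=> p1; rewrite sqnormZ// (sqnorm_scales phic (measurable_L0 psi)).
have [_ c0 _] := phic.
by rewrite !lte_mul_pinfty// ?lee_fin ?sqr_ge0 ?mule_ge0 ?sqnorm_ge0.
Qed.

End comp.

Lemma scales_wavelet j (M : 'M[R]_d) : M *m M^T = 1%:M ->
  scales_by mu (fun x => a ^ j *: (invmx M *m x)) (1 * (a ^ j)^-1 ^+ d).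
Proof.
move=> MMT.
have uM : M \in unitmx by case: (mulmx1_unit MMT).
have iM : invmx M = M^T by rewrite -[RHS]mul1mx -(mulVmx uM) -mulmxA MMT mulmx1.
have h1 := scales_dilateRn d (exprz_gt0 j a0).
have h2 : scales_by mu (fun x => invmx M *m x) 1.
  by apply: scales_orthogonal; rewrite iM trmxK.
exact: (scales_by_comp h1 h2).
Qed.

(** Dilating psi_lambda by a^k gives psi_(a^k lambda), and a^k lambda lies beyond
    the low-pass threshold again because k is nonnegative. *)
Lemma Wav_dil (G : set 'M[R]_d) J (F : L0 R d) (k : nat) (c0 : 0 < a ^+ k) :
  Wav psi a G J F -> Wav psi a G J (dilL0 F c0).
Proof.
move=> [j [M [jJ GM FE]]]; exists (j + k%:Z), M; split => //.
  by apply: (lt_le_trans jJ); rewrite lerDl.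
have h1 := mkL0E (measurable_dil1 c0 (measurable_L0 F)).
have FE' : {ae mu, forall x, F x = dilate psi a j M x} by apply: filterS FE => x /(_ I).
have h2 := ae_scales (scales_dilateRn d c0) FE'.
apply: filterS2 h1 h2 => x /(_ I) -> Fx _; rewrite /dil1 Fx /dilate.
have an : a != 0 by rewrite gt_eqF.
rewrite mulrA; congr (_ * psi _).
  rewrite -[LHS]rmorphM/=; congr (_%:C).
  rewrite mulrDr expfzDr// mulrC; congr (_ * _).
  by rewrite mulrC -PoszM -exprM -exprnP.
by rewrite -scalemxAr scalerA expfzDr// -exprnP.
Qed.

End wavelet_filters.

(** * The energy remainder *)

Lemma cabs_realB (R : realType) (x y : R) : cabs (x%:C - y%:C : R[i]) = `|x - y|.
Proof. by rewrite -cabs_real; congr cabs; rewrite rmorphB. Qed.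

Lemma near_all_seq (T : eqType) (s : seq T) (P : T -> nat -> Prop) :
  (forall x, x \in s -> \forall k \near \oo, P x k) ->
  \forall k \near \oo, forall x, x \in s -> P x k.
Proof.
elim: s => [|y s IH] h; first exact: nearW.
have h1 := h y (mem_head _ _).
have h2 := IH (fun x xs => h x (mem_behead (s := y :: s) xs)).
by apply: filterS2 h1 h2 => k Py Ps x; rewrite inE => /predU1P[->//|]; exact: Ps.
Qed.

Lemma sum_const_le (R : realType) (T : Type) (s : seq T) (b : R) : 0 <= b ->
  \sum_(x <- s) (b / ((size s)%:R + 1)) <= b.
Proof.
move=> b0; have s1 : 0 < (size s)%:R + 1 :> R by rewrite ltr_wpDl.
have -> : \sum_(x <- s) (b / ((size s)%:R + 1)) = b * ((size s)%:R / ((size s)%:R + 1)).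
  by rewrite big_const_seq count_predT iter_addr_0 -(mulr_natr (_ / _)) mulrAC mulrA.
by rewrite ler_piMr// ler_pdivrMr// mul1r lerDl.
Qed.

Section energy.
Context {R : realType} {d : nat}.
Local Notation V := (Rn R d).
Local Notation mu := (@lebesgue_Rn R d).
Variables (chi : L0 R d) (Psi : set (L0 R d)).
Hypothesis filters : scattering_filters chi Psi.
Hypothesis chi1 : (norm1 mu chi < +oo)%E.
Hypothesis chi2 : (sqnorm mu chi < +oo)%E.
Hypothesis Psi1 : forall F : L0 R d, Psi F -> (norm1 mu F < +oo)%E.
Hypothesis Psi2 : forall F : L0 R d, Psi F -> (sqnorm mu F < +oo)%E.

Local Notation W := (energy_remainder Psi).

Definition square_integrable (f : V -> R[i]) :=
  measurable_fun setT f /\ (sqnorm mu f < +oo)%E.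

Definition absconv (f : V -> R[i]) (F : L0 R d) : V -> R[i] :=
  fun x => (cabs (conv f F x))%:C.

Lemma square_integrable_sub f g : square_integrable f -> square_integrable g ->
  square_integrable (fun x => f x - g x).
Proof.
by move=> [mf f2] [mg g2]; split; [exact: measurable_csub|exact: sqnorm_fin_sub].
Qed.

Lemma square_integrable_add f g : square_integrable f -> square_integrable g ->
  square_integrable (fun x => f x + g x).
Proof.
by move=> [mf f2] [mg g2]; split; [exact: measurable_cadd|exact: sqnorm_fin_add].
Qed.

Lemma sqnorm_abs (f : V -> R[i]) : sqnorm mu (fun x => (cabs (f x))%:C) = sqnorm mu f.
Proof. by apply: eq_sqnorm => x; rewrite cabs_real ger0_norm ?cabs_ge0. Qed.

Lemma square_integrable_conv f F : square_integrable f -> Psi F ->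
  square_integrable (conv f F).
Proof.
move=> [mf f2] PF; have mF := measurable_L0 F; split; first exact: measurable_conv.
by apply: sqnorm_conv_fin => //; exact: Psi1.
Qed.

Lemma square_integrable_abs f : square_integrable f ->
  square_integrable (fun x => (cabs (f x))%:C).
Proof.
move=> [mf f2]; split; first by apply: measurable_realC; exact: measurable_cabsT.
by rewrite sqnorm_abs.
Qed.

Lemma square_integrable_absconv f F : square_integrable f -> Psi F ->
  square_integrable (absconv f F).
Proof. by move=> f2 PF; apply: square_integrable_abs; exact: square_integrable_conv. Qed.

Lemma square_integrable_dil c f : 0 < c -> square_integrable f ->
  square_integrable (dil c f).
Proof.
by move=> c0 [mf f2]; split; [exact: measurable_dil|rewrite sqnorm_dil].
Qed.

Lemma energy_ge0 N f : (0 <= W N f)%E.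
Proof. by apply: esum_ge0 => p _; rewrite sqre_ge0. Qed.

Lemma energy0 f : W 0 f = sqnorm mu f.
Proof.
rewrite /energy_remainder (_ : [set p : 0.-tuple (L0 R d) | _] = [set [tuple]]).
  rewrite esum_set1; last exact: sqre_ge0.
  by rewrite /Lnormc sqr_Lnormc2.
by apply/seteqP; split => p /=; [rewrite tuple0|move=> _ []].
Qed.

(** Paths are sorted by their first filter. *)
Lemma energyS N f : W N.+1 f = \esum_(F in Psi) W N (absconv f F).
Proof.
pose e (q : L0 R d * N.-tuple (L0 R d)) : N.+1.-tuple (L0 R d) := [tuple of q.1 :: q.2].
rewrite /energy_remainder.
rewrite (esum_esum (I := Psi)
  (J := fun _ => [set p : N.-tuple (L0 R d) | forall k, Psi (tnth p k)])
  (a := fun F p => (Lnormc 2%:E (propagate p (absconv f F)) ^+ 2)%E)); last first.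
  by move=> F p _ _; exact: sqre_ge0.
rewrite (reindex_esum (Psi `*`` (fun _ => [set p : N.-tuple (L0 R d) | forall k, Psi (tnth p k)])) _ e).
  by apply: eq_esum => -[F p] _ /=.
split.
- move=> [F p] /= [PF Pp] k.
  have [->|[i ->]] : k = ord0 \/ exists i, k = lift ord0 i.
    by case: (unliftP ord0 k) => [i ->|->]; [right; exists i|left].
  + by rewrite tnth0.
  + by rewrite tnthS.
- move=> [F p] [F' p'] _ _ /= /(congr1 val) /= [-> pp'].
  by congr pair; exact: val_inj.
- move=> p; case/tupleP: p => F p Pp; exists (F, p) => //; split => /=.
    by have := Pp ord0; rewrite tnth0.
  by move=> k; have := Pp (lift ord0 k); rewrite tnthS.
Qed.

(** One layer does not increase distances: taking the modulus is a contraction, and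
    Bessel's inequality bounds the total distance over all filters. The weighted
    form of the estimate is the one that can be summed over the filters. *)
Lemma energy_weighted N f g (t : R) : 0 < t ->
  square_integrable f -> square_integrable g ->
  (W N f <= (1 + t)%:E * W N g + (1 + t^-1)%:E * sqnorm mu (fun x => f x - g x)%R)%E.
Proof.
move=> t0; elim: N f g => [|N IH] f g [mf f2] [mg g2].
  by rewrite !energy0; exact: sqnorm_weighted.
have t1 : 0 <= 1 + t by rewrite addr_ge0// ltW.
have t2 : 0 <= 1 + t^-1 by rewrite addr_ge0// invr_ge0 ltW.
have [mfg fg2] := square_integrable_sub (conj mf f2) (conj mg g2).
rewrite !energyS.
apply: (@le_trans _ _ (\esum_(F in Psi) ((1 + t)%:E * W N (absconv g (F : L0 R d)) +
  (1 + t^-1)%:E * sqnorm mu (conv (fun x => f x - g x)%R (F : L0 R d))))%E).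
  apply: le_esum => F PF.
  have mF := measurable_L0 F.
  have af := square_integrable_absconv (conj mf f2) PF.
  have ag := square_integrable_absconv (conj mg g2) PF.
  apply: le_trans (IH _ _ af ag) _; rewrite leeD2l// lee_wpmul2l//.
  apply: sqnorm_le.
  - by have [] := square_integrable_sub af ag.
  - exact: measurable_conv.
  - move=> x; rewrite conv_sub//; last exact: Psi2.
    by rewrite /absconv cabs_realB; exact: cabs_dist.
apply: le_trans (esum_lin t1 t2 _ _) _.
- by move=> F _; exact: energy_ge0.
- by move=> F _; exact: sqnorm_ge0.
apply: leeD; first exact: lexx.
by apply: lee_wpmul2l => //; exact: (bessel filters chi1 chi2 Psi1 Psi2).
Qed.

Section asymptotics.
Variable a : R.
Hypothesis a1 : 1 < a.
Hypothesis d_gt0 : (0 < d)%N.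
Hypothesis Psi_dil : forall (k : nat) (c0 : 0 < a ^+ k) (F : L0 R d),
  Psi F -> Psi (dilL0 F c0).

Let ak0 (k : nat) : 0 < a ^+ k. Proof. by rewrite exprn_gt0// (lt_trans _ a1). Qed.

(** The two weights of a parallelogram estimate can be absorbed in an error e: t is
    chosen small against the bound S0, then eta small against t. *)
Lemma weights (S0 e : R) : 0 <= S0 -> 0 < e -> exists t eta : R, [/\ 0 < t, 0 < eta &
  forall S X : \bar R, (0 <= S -> S <= S0%:E -> 0 <= X ->
    S <= (1 + t)%:E * X + (1 + t^-1)%:E * eta%:E + eta%:E -> S <= X + e%:E)%E].
Proof.
move=> S00 e0; pose t := e / 2 / (S0 + 1).
have S1 : 0 < S0 + 1 by rewrite ltr_wpDl.
have t0 : 0 < t by rewrite !divr_gt0.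
have t2 : 0 < 2 + t^-1 by rewrite addr_gt0// invr_gt0.
exists t, (e / 2 / (2 + t^-1)); split => //; first by rewrite !divr_gt0.
move=> [S| |] [X| |] //; rewrite ?leey// -!EFinM -!EFinD !lee_fin => S_ge0 SS0 X0.
set eta := e / 2 / _; have etaE : (2 + t^-1) * eta = e / 2.
  by rewrite /eta mulrCA mulfV ?mulr1// gt_eqF.
have [SX _|XS] := leP S X; first by rewrite (le_trans SX)// lerDl ltW.
have tX : t * X <= e / 2.
  apply: (@le_trans _ _ (t * (S0 + 1))); last by rewrite /t divfK// gt_eqF.
  by rewrite ler_pM2l//; lra.
have -> : (1 + t) * X + (1 + t^-1) * eta + eta = X + t * X + (2 + t^-1) * eta by ring.
by rewrite etaE; lra.
Qed.

Let cvg_expN : (a ^+ d)^-1 ^+ k @[k --> \oo] --> (0 : R).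
Proof.
apply: cvg_expr; rewrite ger0_norm ?invr_ge0 ?exprn_ge0 ?(ltW (lt_trans ltr01 a1))//.
by rewrite invf_lt1 ?exprn_gt0 ?(lt_trans ltr01 a1)// exprn_egt1 ?lt0n_neq0.
Qed.

(** Dilating an integrable signal to high frequencies shrinks its L1 norm, so
    that the low-pass filter captures less and less of it. *)
Let low_pass_vanishes f (e : R) : square_integrable f -> (norm1 mu f < +oo)%E -> 0 < e ->
  \forall k \near \oo, (sqnorm mu (conv (dil (a ^+ k) f) chi) <= e%:E)%E.
Proof.
move=> [mf f2] f1 e0; have mchi := measurable_L0 chi.
pose C := fine (norm1 mu f) ^+ 2 * fine (sqnorm mu chi).
have C0 : 0 <= C by rewrite mulr_ge0 ?sqr_ge0 ?fine_ge0 ?sqnorm_ge0.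
have : C * (a ^+ d)^-1 ^+ k @[k --> \oo] --> (0 : R).
  by rewrite -(mulr0 C); apply: cvgM; [exact: cvg_cst|exact: cvg_expN].
move=> /cvgrPdist_le /(_ e e0); apply: filterS => k hk.
have mdk := measurable_dil (ak0 k) mf.
have h := sqnorm_conv_le' mdk mchi.
rewrite (sqnorm_dil (ak0 k) mf) in h; apply: le_trans (h f2 chi2) _.
rewrite (norm1_dil (ak0 k) mf).
have f1' : norm1 mu f \is a fin_num by rewrite ge0_fin_numE ?norm1_ge0.
have chi2' : sqnorm mu chi \is a fin_num by rewrite ge0_fin_numE ?sqnorm_ge0.
rewrite -{1}(fineK f1') -EFinM -EFin_expe -{1}(fineK chi2') -EFinM lee_fin.
apply: le_trans hk; rewrite sub0r normrN (le_trans _ (ler_norm _))//.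
rewrite exprMn -mulrA -/C mulrC ler_wpM2l//.
rewrite !exprVn sqr_sqrtr ?exprn_ge0 ?(ltW (lt_trans ltr01 a1))//.
by rewrite -!exprM mulnC.
Qed.

(** The frame identity turns the smallness of the low-pass part into this, first
    for an integrable approximation g of f. *)
Let first_layer_full f (e : R) : square_integrable f -> 0 < e -> exists k : nat,
  (sqnorm mu f <= \esum_(F in Psi) sqnorm mu (conv (dil (a ^+ k) f) (F : L0 R d)) + e%:E)%E.
Proof.
move=> [mf f2] e0.
pose S0 := fine (sqnorm mu f).
have S0E : sqnorm mu f = S0%:E by rewrite fineK// ge0_fin_numE ?sqnorm_ge0.
have S00 : 0 <= S0 by rewrite fine_ge0// sqnorm_ge0.
have e2 : 0 < e / 2 by rewrite divr_gt0.
have [t [eta [t0 eta0 hw]]] := weights S00 e2.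
have t1 : 0 <= 1 + t by rewrite addr_ge0// ltW.
have t2 : 0 <= 1 + t^-1 by rewrite addr_ge0// invr_ge0 ltW.
have [g [mg g1 gle fg]] : exists g, [/\ measurable_fun setT g, (norm1 mu g < +oo)%E,
    (sqnorm mu g <= sqnorm mu f)%E & (sqnorm mu (fun x => f x - g x)%R <= eta%:E)%E].
  exact: integrable_approx.
have g2 : (sqnorm mu g < +oo)%E by exact: le_lt_trans f2.
have mfg := measurable_csub mf mg.
have [k _ /(_ k (leqnn k)) hk] := low_pass_vanishes (conj mg g2) g1 eta0.
exists k.
have mdg := measurable_dil (ak0 k) mg.
have mdf := measurable_dil (ak0 k) mf.
have dg2 : (sqnorm mu (dil (a ^+ k) g) < +oo)%E by rewrite (sqnorm_dil (ak0 k) mg).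
have df2 : (sqnorm mu (dil (a ^+ k) f) < +oo)%E by rewrite (sqnorm_dil (ak0 k) mf).
set Q := (\esum_(F in Psi) _)%E.
have Q0 : (0 <= Q)%E by apply: esum_ge0 => F _; exact: sqnorm_ge0.
have gQ : (sqnorm mu g <= Q + (e / 2)%:E)%E.
  apply: hw => //; rewrite -?S0E//; first exact: sqnorm_ge0.
  rewrite -(sqnorm_dil (ak0 k) mg).
  have dg1 : (norm1 mu (dil (a ^+ k) g) < +oo)%E.
    by rewrite (norm1_dil (ak0 k) mg) lte_mul_pinfty// lee_fin invr_ge0 sqrtr_ge0.
  rewrite -(frame_identity filters chi1 chi2 Psi1 Psi2 mdg dg1 dg2) addeC.
  apply: leeD => //.
  apply: (@le_trans _ _ (\esum_(F in Psi) ((1 + t)%:E * sqnorm mu (conv (dil (a ^+ k) f) (F : L0 R d)) +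
    (1 + t^-1)%:E * sqnorm mu (conv (dil (a ^+ k) (fun x => g x - f x)%R) (F : L0 R d))))%E).
    apply: le_esum => F PF; have mF := measurable_L0 F.
    apply: le_trans (sqnorm_weighted mu t0 (measurable_conv mdg mF) (measurable_conv mdf mF)) _.
    rewrite leeD2l// lee_wpmul2l// dil_sub.
    by rewrite le_eqVlt; apply/orP; left; apply/eqP; apply: eq_sqnorm => x;
      rewrite conv_sub//; exact: Psi2.
  apply: le_trans (esum_lin t1 t2 _ _) _; [by move=> F _; exact: sqnorm_ge0..|].
  apply: leeD; first exact: lexx.
  apply: lee_wpmul2l => //.
  have mgf := measurable_csub mg mf.
  have gf2 : (sqnorm mu (fun x => g x - f x)%R < +oo)%E by exact: sqnorm_fin_sub.
  apply: le_trans (bessel filters chi1 chi2 Psi1 Psi2 (measurable_dil (ak0 k) mgf) _) _.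
    by rewrite (sqnorm_dil (ak0 k) mgf).
  by rewrite (sqnorm_dil (ak0 k) mgf) sqnorm_sub_sym.
have fgS : (sqnorm mu f <= sqnorm mu g + (e / 2)%:E)%E.
  apply: hw; rewrite -?S0E ?sqnorm_ge0//.
  apply: le_trans (sqnorm_weighted mu t0 mf mg) _.
  apply: (@le_trans _ _ ((1 + t)%:E * sqnorm mu g + (1 + t^-1)%:E * eta%:E)%E).
    by rewrite leeD2l// lee_wpmul2l.
  by rewrite leeDl// lee_fin ltW.
apply: le_trans fgS _; apply: le_trans (leeD2r _ gQ) _.
by rewrite -addeA -EFinD -splitr.
Qed.

(** The dilates of a non-null filter are distinct filters, so the energies that
    they extract from a fixed signal are summable. *)
Let dilated_filter_vanishes x F (e : R) : square_integrable x -> Psi F -> 0 < e ->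
  \forall k \near \oo, (sqnorm mu (conv x (dil1 (a ^+ k) F)) <= e%:E)%E.
Proof.
move=> [mx x2] PF e0; have mF := measurable_L0 F.
pose Fk k := dilL0 F (ak0 k).
have convE k : conv x (Fk k) = conv x (dil1 (a ^+ k) F).
  have xx : x = x %[ae mu] by exact: aeW.
  exact: (ae_eq_conv mx mx (measurable_L0 _) (measurable_dil1 (ak0 k) mF) xx (mkL0E _)).
have E m : sqnorm mu (Fk m) = ((a ^+ m ^+ d)%:E * sqnorm mu F)%E.
  rewrite -(sqnorm_dil1 (ak0 m) mF).
  exact: (ae_eq_sqnorm (measurable_L0 _) (measurable_dil1 (ak0 m) mF) (mkL0E _)).
have [F0|F0] := eqVneq (sqnorm mu F) 0%E.
  apply: nearW => k; rewrite -convE.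
  have FkP : Psi (Fk k) by exact: Psi_dil.
  have Fk0 : sqnorm mu (Fk k) = 0%E by rewrite E F0 mule0.
  suff -> : sqnorm mu (conv x (Fk k)) = 0%E by rewrite lee_fin ltW.
  apply/eqP; rewrite eq_le sqnorm_ge0 andbT.
  have z0 : conv x (Fk k) = cst 0.
    apply/funext => y; apply: ComplexField.Normc.eq0_normc; apply/eqP.
    have := cabs_Cint_mul_le mu mx (measurable_reflect y (measurable_L0 (Fk k))).
    rewrite (sqnorm_scales (scales_subRn y) (measurable_L0 (Fk k))) Fk0 mul1e mule0 lee_fin.
    by move=> h; rewrite -sqrf_eq0 eq_le h sqr_ge0.
  rewrite z0 /sqnorm; under eq_integral do rewrite cabs0 expr0n.
  by rewrite integral0.
have Fk_inj : injective Fk.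
  move=> k l /(congr1 (fun G : L0 R d => sqnorm mu G)).
  have [s sE] : exists s, sqnorm mu F = s%:E.
    by exists (fine (sqnorm mu F)); rewrite fineK// ge0_fin_numE ?sqnorm_ge0//; exact: Psi2.
  have s0 : s != 0 by move: F0; rewrite sE.
  rewrite !E sE -!EFinM => -[] /(mulIf s0).
  rewrite -!exprM => /ieexprIn.
  rewrite (lt_trans ltr01 a1) gt_eqF// => /(_ isT isT)/eqP.
  by rewrite eqn_pmul2r// => /eqP.
pose r k := fine (sqnorm mu (conv x (dil1 (a ^+ k) F))).
have rE k : sqnorm mu (conv x (dil1 (a ^+ k) F)) = (r k)%:E.
  rewrite /r fineK// ge0_fin_numE ?sqnorm_ge0// -convE.
  apply: (sqnorm_conv_fin mx (measurable_L0 _) x2); apply: Psi1; exact: Psi_dil.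
have r0 k : 0 <= r k by rewrite fine_ge0// sqnorm_ge0.
have partial n : (\sum_(0 <= k < n) r k <= fine (sqnorm mu x)).
  rewrite -lee_fin fineK ?ge0_fin_numE ?sqnorm_ge0//.
  apply: le_trans (bessel filters chi1 chi2 Psi1 Psi2 mx x2).
  have us : uniq (map Fk (index_iota 0 n)) by rewrite map_inj_uniq// iota_uniq.
  have := @le_esum_seq _ _ Psi (fun G : L0 R d => sqnorm mu (conv x G)) _ us.
  rewrite big_map -sumEFin => h.
  under eq_bigr do rewrite -rE -convE.
  by apply: h => G /mapP[k _ ->]; exact: Psi_dil.
have rs : cvgn (series r).
  apply: nondecreasing_is_cvgn.
    by apply: nondecreasing_series => n _ _; exact: r0.
  by exists (fine (sqnorm mu x)) => _ [n _ <-]; exact: partial.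
have /cvgrPdist_le/(_ e e0) := cvg_series_cvg_0 rs.
apply: filterS => k; rewrite sub0r normrN ger0_norm// => rk.
by rewrite rE lee_fin.
Qed.

(** With D_k the dilation by a^k, the first layer splits u into finitely many pieces
    h = D_k1 u * F; the filters dilated by a^k see D_k h almost undisturbed by x,
    and the deeper layers are handled by the induction hypothesis for the
    pieces. *)
Let energy_dil_step N :
  (forall u (e : R), square_integrable u -> 0 < e -> \forall k \near \oo,
    (sqnorm mu u <= W N (dil (a ^+ k) u) + e%:E)%E) ->
  forall x u (e : R), square_integrable x -> square_integrable u -> 0 < e ->
    \forall k \near \oo,
    (sqnorm mu u <= W N.+1 (fun y => x y + dil (a ^+ k) u y)%R + e%:E)%E.
Proof.
move=> IH x u e x2 u2 e0.
pose S0 := fine (sqnorm mu u).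
have S0E : sqnorm mu u = S0%:E by rewrite fineK// ge0_fin_numE ?sqnorm_ge0//; case: u2.
have S00 : 0 <= S0 by rewrite fine_ge0// sqnorm_ge0.
have [t [eta [t0 eta0 hw]]] := weights S00 e0.
have t1 : 0 <= 1 + t by rewrite addr_ge0// ltW.
have t2 : 0 <= 1 + t^-1 by rewrite addr_ge0// invr_ge0 ltW.
have eta3 : 0 < eta / 3 by rewrite divr_gt0.
have [k1 hk1] := first_layer_full u2 eta3.
set v := dil (a ^+ k1) u in hk1.
have v2 : square_integrable v by exact: square_integrable_dil.
have [s [us sPsi hs]] : exists s : seq (L0 R d), [/\ uniq s, forall F, F \in s -> Psi F &
    (sqnorm mu u <= \sum_(F <- s) sqnorm mu (conv v (F : L0 R d)) + (eta / 3 + eta / 3)%:E)%E].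
  set Q := (\esum_(F in Psi) _)%E in hk1.
  have Qfin : Q \is a fin_num.
    rewrite ge0_fin_numE; last by apply: esum_ge0 => F _; exact: sqnorm_ge0.
    have [mv vf] := v2.
    exact: le_lt_trans (bessel filters chi1 chi2 Psi1 Psi2 mv vf) vf.
  have : (Q - (eta / 3)%:E < Q)%E by rewrite lteBlDr// lteDl// lte_fin.
  move=> /esum_gt_seq[s [us sPsi hs]]; exists s; split => //.
  apply: le_trans hk1 _; rewrite EFinD addeA leeD2r//.
  by rewrite -leeBlDr// ltW.
pose n := (size s)%:R : R.
have n0 : 0 < n + 1 by rewrite ltr_wpDl// ler0n.
have d1 : 0 < eta / 3 / (n + 1) by rewrite divr_gt0.
have d2 : 0 < eta / (n + 1) by rewrite divr_gt0.
have pieces : \forall k \near \oo, forall F : L0 R d, F \in s ->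
    (sqnorm mu (conv v F) <= W N (dil (a ^+ k) (absconv v F)) + (eta / 3 / (n + 1))%:E)%E /\
    (sqnorm mu (conv x (dil1 (a ^+ k) F)) <= (eta / (n + 1))%:E)%E.
  apply: near_all_seq => F /sPsi PF.
  have := IH _ _ (square_integrable_absconv v2 PF) d1; rewrite sqnorm_abs.
  by apply: filterS2 (dilated_filter_vanishes x2 PF d2) => k h1 h2.
move: pieces => [K _ hK]; exists (K + k1)%N => // k' /= kk'.
have [k kE] : exists k, k' = (k + k1)%N.
  by exists (k' - k1)%N; rewrite subnK// (leq_trans _ kk')// leq_addl.
have {}hK := hK k _; have {hK kk'}pieces := hK ltac:(by move: kk'; rewrite kE leq_add2r).
set w := fun y => _; set c := a ^+ k in pieces; have c0 : 0 < c by exact: ak0.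
have wE : w = fun y => x y + dil c v y.
  by rewrite /w /v dil_dil// -exprD -kE.
have w2 : square_integrable w.
  by rewrite wE; apply: square_integrable_add => //; exact: square_integrable_dil.
have [mx xx] := x2; have [mv vv] := v2; have [mw ww] := w2.
have piece (F : L0 R d) : F \in s ->
    (W N (dil c (absconv v F)) <= (1 + t)%:E * W N (absconv w (dilL0 F c0)) +
      (1 + t^-1)%:E * (eta / (n + 1))%:E)%E.
  move=> Fs; have PF := sPsi _ Fs; have mF := measurable_L0 F.
  have [_ hx] := pieces F Fs.
  have PFc : Psi (dilL0 F c0) by exact: Psi_dil.
  have s1 := square_integrable_dil c0 (square_integrable_absconv v2 PF).
  have s2 := square_integrable_absconv w2 PFc.
  apply: le_trans (energy_weighted N t0 s1 s2) _.
  rewrite leeD2l// lee_wpmul2l//; apply: le_trans hx.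
  have mdF := measurable_dil1 c0 mF.
  have dF2 : (sqnorm mu (dil1 c F) < +oo)%E.
    have F2 := Psi2 PF.
    by rewrite (sqnorm_dil1 c0 mF) lte_mul_pinfty// lee_fin exprn_ge0// (ltW c0).
  have convwE : conv w (dilL0 F c0) = fun y => conv x (dil1 c F) y + dil c (conv v F) y.
    have ww' : w = w %[ae mu] by exact: aeW.
    rewrite (ae_eq_conv mw mw (measurable_L0 _) mdF ww' (mkL0E _)).
    apply/funext => y; rewrite {1}wE conv_add//.
    - by rewrite conv_dil//; exact: Psi2.
    - exact: measurable_dil.
    - by rewrite sqnorm_dil.
  apply: sqnorm_le.
  - by have [] := square_integrable_sub s1 s2.
  - exact: measurable_conv.
  - move=> y; rewrite /absconv (dil_abs (conv v F) c0) cabs_realB.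
    apply: le_trans (cabs_dist _ _) _; rewrite convwE.
    by rewrite -(cabsN (conv x _ _)) opprD addrCA subrr addr0.
apply: hw => //; first exact: sqnorm_ge0; rewrite -?S0E//; first exact: energy_ge0.
apply: le_trans hs _.
apply: (@le_trans _ _ (\sum_(F <- s) W N (dil c (absconv v (F : L0 R d))) + eta%:E)%E).
  have -> : eta%:E = ((eta / 3)%:E + (eta / 3 + eta / 3)%:E)%E.
    by rewrite -EFinD; congr EFin; field.
  rewrite addeA leeD2r//.
  apply: (@le_trans _ _ (\sum_(F <- s) (W N (dil c (absconv v (F : L0 R d))) + (eta / 3 / (n + 1))%:E))%E).
    rewrite big_seq [leRHS]big_seq; apply: lee_sum => F Fs.
    by have [] := pieces F Fs.
  rewrite big_split/= leeD2l// sumEFin lee_fin.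
  by apply: sum_const_le; exact: ltW.
rewrite leeD2r//.
apply: (@le_trans _ _ (\sum_(F <- s) ((1 + t)%:E * W N (absconv w (dilL0 (F : L0 R d) c0)) +
      (1 + t^-1)%:E * (eta / (n + 1))%:E))%E).
  by rewrite big_seq [leRHS]big_seq; apply: lee_sum => F; exact: piece.
rewrite big_split/=; apply: leeD.
  rewrite -ge0_sume_distrr; last by move=> F _; exact: energy_ge0.
  apply: lee_wpmul2l => //; rewrite energyS.
  have us' : uniq (map (fun F : L0 R d => dilL0 F c0) s).
    by rewrite map_inj_uniq//; exact: dilL0_inj.
  have := le_esum_seq (S := Psi) (fun F : L0 R d => W N (absconv w F)) us'.
  rewrite big_map; apply => G /mapP[F Fs ->].
  by apply: Psi_dil; exact: sPsi.
under eq_bigr do rewrite -EFinM.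
rewrite sumEFin -EFinM lee_fin -big_distrr/= ler_wpM2l//.
by apply: sum_const_le; exact: ltW.
Qed.

Let energy_dil N u (e : R) : square_integrable u -> 0 < e -> \forall k \near \oo,
  (sqnorm mu u <= W N (dil (a ^+ k) u) + e%:E)%E.
Proof.
elim: N u e => [|N IH] u e u2 e0.
  apply: nearW => k; rewrite energy0 (sqnorm_dil (ak0 k)); last by case: u2.
  by rewrite leeDl// lee_fin ltW.
have z2 : square_integrable (cst 0 : V -> R[i]).
  split; first exact: measurable_cst.
  by rewrite /sqnorm; under eq_integral do rewrite cabs0 expr0n; rewrite integral0 ltry.
have := energy_dil_step IH z2 u2 e0; apply: filterS => k.
by rewrite (_ : (fun y => cst 0 y + dil (a ^+ k) u y) = dil (a ^+ k) u)//;
  apply/funext => y; rewrite add0r.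
Qed.

(** However large x is, a highly dilated u leaves almost all of its energy in a
    given layer: x and the bump hardly interact because they live at different
    frequencies. *)
Theorem energy_perturbation N x u (e : R) :
  square_integrable x -> square_integrable u -> 0 < e -> \forall k \near \oo,
  (sqnorm mu u <= W N.+1 (fun y => x y + dil (a ^+ k) u y)%R + e%:E)%E.
Proof. by apply: energy_dil_step; exact: energy_dil. Qed.

End asymptotics.
End energy.

(** * Rapidly converging sequences of square integrable functions *)

Section fast_cauchy.
Context {R : realType}.

Lemma cvg_summable_increments (v w : nat -> R) (M : R) :
  (forall j, `|v j.+1 - v j| <= w j) -> (forall n, \sum_(j < n) w j <= M) -> cvgn v.
Proof.
move=> vw wM.
have -> : v = fun n => v 0%N + series (telescope v) n.
  by apply/funext => n; rewrite -eq_sum_telescope.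
apply: is_cvgD; first exact: is_cvg_cst.
apply: normed_cvg; apply: nondecreasing_is_cvgn.
  by apply: nondecreasing_series => n _ _; exact: normr_ge0.
exists M => _ [n _ <-]; apply: le_trans (wM n).
by rewrite -(big_mkord xpredT); apply: ler_sum => j _; exact: vw.
Qed.

Lemma sum_geometric_half n : \sum_(j < n) (2 ^- j : R) <= 2.
Proof.
suff h : \sum_(j < n) (2 ^- j : R) = 2 - 2 * 2 ^- n.
  by rewrite h gerBl mulr_ge0// invr_ge0 exprn_ge0.
elim: n => [|n IH]; first by rewrite big_ord0 expr0; lra.
rewrite big_ord_recr/= IH exprS invfM mulrA mulfV// mul1r.
by lra.
Qed.

Context {dd : measure_display} {T : measurableType dd} (mu : {measure set T -> \bar R}).

(** Completeness of L2 for rapidly converging sequences. The weights 2^m make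
    the squares of the increments summable almost everywhere, which dominates
    the increments themselves because |u| <= 2^-m + 2^m |u|^2. *)
Lemma ae_cvg_fast_cauchy (x : nat -> T -> R[i]) (K : R) :
  (forall m, measurable_fun setT (x m)) ->
  (forall m, (sqnorm mu (fun t => x m.+1 t - x m t)%R <= (K / 4 ^+ m)%:E)%E) ->
  {ae mu, forall t, cvgn (fun n => complex.Re (x n t)) /\ cvgn (fun n => complex.Im (x n t))}.
Proof.
move=> mx xK.
pose h m t := (2 ^+ m * cabs (x m.+1 t - x m t) ^+ 2)%:E : \bar R.
have h0 m t : (0 <= h m t)%E 
  by rewrite lee_fin; apply: mulr_ge0; [exact: exprn_ge0|exact: sqr_ge0].
have mh m : measurable_fun setT (h m).
  rewrite /h; under eq_fun do rewrite EFinM.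
  by apply: measurable_funeM; apply: measurable_esqcabs; exact: measurable_csub.
have hK m : (\int[mu]_t h m t <= (K * 2 ^- m)%:E)%E.
  rewrite /h; under eq_integral do rewrite EFinM.
  rewrite ge0_integralZl//.
  - apply: (@le_trans _ _ ((2 ^+ m)%:E * (K / 4 ^+ m)%:E)%E).
      by apply: lee_wpmul2l; rewrite ?lee_fin ?exprn_ge0//; exact: xK.
    rewrite -EFinM lee_fin (_ : 4 = 2 * 2 :> R); last by rewrite -natrM.
    by rewrite exprMn invfM mulrCA (mulrA (2 ^+ m)) mulfV ?expf_neq0// mul1r.
  - by apply: measurable_esqcabs; exact: measurable_csub.
  - by move=> t _; rewrite lee_fin sqr_ge0.
have K0 : 0 <= K.
  by have := le_trans (sqnorm_ge0 mu _) (xK 0%N); rewrite expr0 divr1 lee_fin.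
pose S t := (\sum_(m <oo) h m t)%E.
have S_int : (\int[mu]_t S t <= (K * 2)%:E)%E.
  rewrite /S integral_nneseries//.
  apply: lime_le; first by apply: is_cvg_nneseries => n _ _; exact: integral_ge0.
  apply: nearW => n; rewrite big_mkord.
  apply: (@le_trans _ _ (\sum_(j < n) (K * 2 ^- j)%:E)%E); first exact: lee_sum.
  rewrite sumEFin lee_fin -big_distrr/= ler_wpM2l//.
  exact: sum_geometric_half.
have mS : measurable_fun setT S by exact: ge0_emeasurable_sum.
have S0 t : (0 <= S t)%E by exact: nneseries_ge0.
have iS : mu.-integrable setT S.
  apply/integrableP; split => //.
  under eq_integral do rewrite gee0_abs//.
  by apply: le_lt_trans S_int _; rewrite ltry.
apply: filterS (integrable_ae measurableT iS) => t /(_ I) St.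
have wM n : \sum_(j < n) (2 ^- j + 2 ^+ j * cabs (x j.+1 t - x j t) ^+ 2) <= 2 + fine (S t).
  rewrite big_split/=; apply: lerD; first exact: sum_geometric_half.
  rewrite -lee_fin fineK// -sumEFin; apply: le_trans (nneseries_lim_ge n _) => //.
  by rewrite big_mkord.
have bound j (z : R) : `|z| <= cabs (x j.+1 t - x j t) ->
    `|z| <= 2 ^- j + 2 ^+ j * cabs (x j.+1 t - x j t) ^+ 2.
  move=> /le_trans; apply.
  set c := cabs _; have p0 : 0 < 2 ^+ j :> R by rewrite exprn_gt0.
  rewrite -(ler_pM2l p0) mulrDr mulfV ?gt_eqF// mulrA -expr2 -exprMn.
  set y := (_ * c); rewrite -subr_ge0.
  have -> : 1 + y ^+ 2 - y = (y - 2^-1) ^+ 2 + 3 / 4 by field.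
  by rewrite addr_ge0 ?sqr_ge0.
split; apply: cvg_summable_increments wM => j; apply: bound; rewrite -?cReB -?cImB.
- by rewrite -cReN -cReD; exact: Re_le_cabs.
- by rewrite -cImN -cImD; exact: Im_le_cabs.
Qed.

(** The upper limits define a measurable function everywhere, and Fatou's lemma
    transfers to it every distance bound that holds along the sequence. *)
Lemma L2_limit (x : nat -> T -> R[i]) (K : R) :
  (forall m, measurable_fun setT (x m)) ->
  (forall m, (sqnorm mu (fun t => x m.+1 t - x m t)%R <= (K / 4 ^+ m)%:E)%E) ->
  exists f : T -> R[i], measurable_fun setT f /\
    forall (y : T -> R[i]) (B : \bar R), measurable_fun setT y ->
      (\forall n \near \oo, (sqnorm mu (fun t => x n t - y t)%R <= B)%E) ->
      (sqnorm mu (fun t => f t - y t)%R <= B)%E.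
Proof.
move=> mx xK.
pose lim (p : R[i] -> R) t := fine (limn_esup (fun n => (p (x n t))%:E)).
have mlim p : (forall n, measurable_fun setT (fun t => p (x n t))) -> measurable_fun setT (lim p).
  move=> mp; apply: measurableT_comp => //; apply: measurable_fun_limn_esup => n.
  by apply/measurable_EFinP; exact: mp.
have limE p t : cvgn (fun n => p (x n t)) -> p (x n t) @[n --> \oo] --> lim p t.
  move=> pc; have : (p (x n t))%:E @[n --> \oo] --> (limn (fun n => p (x n t)))%:E.
    by apply/fine_cvgP; split; [exact: nearW|exact: pc].
  by move=> /cvg_limn_einf_sup[_]; rewrite /lim => ->.
pose f t := (lim (@complex.Re R) t +i* lim (@complex.Im R) t)%C.
have mf : measurable_fun setT f.
  by apply: measurable_cplx; apply: mlim => n; [exact: measurable_ReT|exact: measurable_ImT].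
exists f; split => // y B my yB.
have mxy n : measurable_fun setT (fun t => x n t - y t) by exact: measurable_csub.
pose q n t := (cabs (x n t - y t) ^+ 2)%:E : \bar R.
have mq n : measurable_fun setT (q n) by exact: measurable_esqcabs.
have q0 n t : (0 <= q n t)%E by rewrite lee_fin sqr_ge0.
have -> : sqnorm mu (fun t => f t - y t) = (\int[mu]_t limn_einf (q^~ t))%E.
  apply: ge0_ae_eq_integral => //.
  - by apply: measurable_esqcabs; exact: measurable_csub.
  - rewrite /limn_einf; apply: measurableT_comp => //.
    apply: (measurable_fun_limn_esup (f := fun n t => (- q n t)%E)) => n.
    exact: measurableT_comp.
  - by move=> t _; rewrite lee_fin sqr_ge0.
  - move=> t _; rewrite limn_einf_lim; apply: lime_ge; first exact: is_cvg_einfs.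
    apply: nearW => n; apply: le_ereal_inf_tmp => _ [m _ <-]; exact: q0.
  - apply: filterS (ae_cvg_fast_cauchy mx xK) => t [rc ic] _.
    apply/esym; suff : q n t @[n --> \oo] --> (cabs (f t - y t) ^+ 2)%:E.
      by move=> /cvg_limn_einf_sup[->].
    apply/fine_cvgP; split; first exact: nearW.
    rewrite /comp/q/=.
    rewrite sqr_cabs; under eq_fun do rewrite sqr_cabs !cReD !cImD.
    rewrite !cReD !cImD.
    have hr := limE _ _ rc; have hi := limE _ _ ic.
    by apply: cvgD; apply: cvgM; apply: cvgD => //; exact: cvg_cst.
apply: le_trans (fatou mu measurableT mq (fun n t _ => q0 n t)) _.
rewrite limn_einf_lim; apply: lime_le; first exact: is_cvg_einfs.
apply: nearW => n; case: yB => N _ yB.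
apply: le_trans (yB (maxn n N) (leq_maxr _ _)).
by apply: ereal_inf_lbound; exists (maxn n N) => //=; exact: leq_maxl.
Qed.

End fast_cauchy.

(** * The gliding hump *)

Section null_sequences.
Context {R : realType} (E : nat -> R) (E0 : decreasing_null_seq E).

Lemma decreasing_null_gt0 n : (0 < n)%N -> 0 < E n.
Proof. by have [h _ _] := E0; exact: h. Qed.

Lemma decreasing_null_le m n : (0 < m)%N -> (m <= n)%N -> E n <= E m.
Proof.
have [_ dE _] := E0 => m0; elim: n => [|n IH]; first by rewrite leqn0 => /eqP ->.
rewrite leq_eqVlt => /predU1P[->//|]; rewrite ltnS => mn.
by apply: le_trans (IH mn); apply: dE; exact: leq_trans mn.
Qed.

Lemma decreasing_null_small (e : R) : 0 < e -> \forall n \near \oo, E n <= e.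
Proof.
have [_ _ cE] := E0 => e0; move/cvgrPdist_le : cE => /(_ e e0); apply: filterS => n.
by rewrite sub0r normrN; exact/le_trans/ler_norm.
Qed.

End null_sequences.

Section gliding_hump.
Context {R : realType} {d : nat}.
Local Notation V := (Rn R d).
Local Notation mu := (@lebesgue_Rn R d).
Variables (Psi : set (L0 R d)) (a : R).
Local Notation W := (energy_remainder Psi).
Hypothesis a0 : 0 < a.
Hypothesis W_weighted : forall N (f g : V -> R[i]) (t : R), 0 < t ->
  square_integrable f -> square_integrable g ->
  (W N f <= (1 + t)%:E * W N g + (1 + t^-1)%:E * sqnorm mu (fun x => f x - g x)%R)%E.
Hypothesis W_bump : forall N (x u : V -> R[i]) (e : R),
  square_integrable x -> square_integrable u -> 0 < e -> \forall k \near \oo,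
  (sqnorm mu u <= W N.+1 (fun y => x y + dil (a ^+ k) u y)%R + e%:E)%E.

(** One step of the construction: a bump of energy c * s that a finite number of
    layers cannot overlook. The factor 3/4 leaves room for the error. *)
Lemma bump (x u : V -> R[i]) (s c : R) (M : nat) : 0 < s -> 0 < c ->
  square_integrable x -> square_integrable u -> sqnorm mu u = s%:E ->
  exists v, [/\ square_integrable v, sqnorm mu v = (c * s)%:E &
    forall N, (0 < N <= M)%N -> ((3 / 4 * (c * s))%:E <= W N (fun y => x y + v y)%R)%E].
Proof.
move=> s0 c0 x2 [mu_ u2] us.
pose w (y : V) : R[i] := (Num.sqrt c)%:C * u y.
have mw : measurable_fun setT w by apply: measurable_cmul => //; exact: measurable_cst.
have ws : sqnorm mu w = (c * s)%:E.
  rewrite sqnormZ// us cabs_real ger0_norm ?sqrtr_ge0//.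
  by rewrite sqr_sqrtr ?(ltW c0)// -EFinM.
have w2 : square_integrable w by split => //; rewrite ws ltry.
have e0 : 0 < c * s / 4 by rewrite !divr_gt0 ?mulr_gt0.
have hs : forall N, N \in iota 0 M -> \forall k \near \oo,
    (sqnorm mu w <= W N.+1 (fun y => x y + dil (a ^+ k) w y)%R + (c * s / 4)%:E)%E.
  by move=> N _; exact: W_bump.
have [k _ /(_ k (leqnn k)) hk] := near_all_seq hs.
have ak : 0 < a ^+ k by rewrite exprn_gt0.
exists (dil (a ^+ k) w); split; first exact: square_integrable_dil.
  by rewrite (sqnorm_dil ak mw).
case=> // N /= NM; have := hk N; rewrite mem_iota add0n => /(_ NM).
rewrite ws -leeBlDr// -EFinB; apply: le_trans.
by rewrite lee_fin; lra.
Qed.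

(** Gliding hump: bumps of energy e_m * s at ever higher frequencies are added
    to g, the m-th one taking care of the layers N with n_m < N <= n_(m+1),
    where e_m is the value of E at n_m + 1. The e_m decay fast enough for the
    later bumps not to destroy the energy that an earlier bump has produced. *)
Theorem gliding_hump (g u : V -> R[i]) (s : R) (E : nat -> R) : 0 < s ->
  square_integrable g -> square_integrable u -> sqnorm mu u = s%:E ->
  decreasing_null_seq E ->
  exists f, [/\ square_integrable f,
    (sqnorm mu (fun x => f x - g x)%R <= (3 * s * E 1%N)%:E)%E &
    forall N, (0 < N)%N -> ((s / 8 * E N)%:E <= W N f)%E].
Proof.
move=> s0 g2 u2 us E0.
have Egt0 := decreasing_null_gt0 E0.
have /choice[next nextP] : forall n, exists n', (n < n')%N /\ E n'.+1 <= E n.+1 / 100.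
  move=> n; have e0 : 0 < E n.+1 / 100 by rewrite divr_gt0// Egt0.
  have [K _ hK] := decreasing_null_small E0 e0.
  exists (maxn n.+1 K); split; first exact: leq_maxl.
  by apply: hK; rewrite /= leqW// leq_maxr.
pose nn m := iter m next 0%N.
pose e m := E (nn m).+1.
have nn_ge m : (m <= nn m)%N.
  by elim: m => // m IH; apply: leq_ltn_trans IH _; case: (nextP (nn m)).
have e_gt0 m : 0 < e m by exact: Egt0.
have e_step m : e m.+1 <= e m / 100 by case: (nextP (nn m)).
have e_geo m : e m <= e 0%N / 4 ^+ m.
  elim: m => [|m IH]; first by rewrite expr0 divr1.
  have -> : e 0%N / 4 ^+ m.+1 = e 0%N / 4 ^+ m / 4 by rewrite exprS invfM mulrCA mulrC.
  apply: le_trans (e_step m) _; have := e_gt0 m.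
  by move: (e 0%N / 4 ^+ m) (e m) IH => p q; lra.
have /choice[v vP] : forall p : nat * (V -> R[i]), exists v, square_integrable p.2 ->
    [/\ square_integrable v, sqnorm mu v = (e p.1 * s)%:E &
    forall N, (0 < N <= nn p.1.+1)%N ->
      ((3 / 4 * (e p.1 * s))%:E <= W N (fun y => p.2 y + v y)%R)%E].
  move=> [m x]; have [x2|] := pselect (square_integrable x).
    have [v hv] := bump (nn m.+1) s0 (e_gt0 m) x2 u2 us.
    by exists v.
  by exists 0.
pose x := fix x m := if m is m'.+1 then (fun y => x m' y + v (m', x m') y) else g.
have x2 m : square_integrable (x m).
  elim: m => //= m IH; apply: square_integrable_add => //.
  by have [] := vP (m, x m) IH.
pose b m := v (m, x m).
have b2 m : square_integrable (b m) by have [] := vP (m, x m) (x2 m).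
have bs m : sqnorm mu (b m) = (e m * s)%:E by have [] := vP (m, x m) (x2 m).
have bW m N : (0 < N <= nn m.+1)%N -> ((3 / 4 * (e m * s))%:E <= W N (x m.+1))%E.
  by have [_ _] := vP (m, x m) (x2 m); apply.
have mx m : measurable_fun setT (x m) by case: (x2 m).
have mb m : measurable_fun setT (b m) by case: (b2 m).
have xS m : x m.+1 = fun y => x m y + b m y by [].
(* Peeling off the first bump costs a factor 2 for the rest, which the decay of
   the e_m compensates: 2 + 2 * 3 / 100 <= 3. *)
have near_x j m : (sqnorm mu (fun y => x (m + j)%N y - x m y)%R <= (3 * (e m * s))%:E)%E.
  elim: j m => [|j IH] m.
    rewrite addn0 /sqnorm; under eq_integral do rewrite subrr cabs0 expr0n.
    by rewrite integral0 lee_fin !mulr_ge0// ltW.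
  have -> : (fun y => x (m + j.+1)%N y - x m y) =
      (fun y => (x (m.+1 + j)%N y - x m.+1 y) + b m y).
    by apply/funext => y; rewrite addSnnS [in RHS]xS; ring.
  apply: le_trans (sqnormD_le mu (measurable_csub (mx _) (mx _)) (mb m)) _.
  rewrite bs -EFinM.
  apply: (@le_trans _ _ (2%:E * (3 * (e m.+1 * s))%:E + (2 * (e m * s))%:E)%E).
    by rewrite leeD2r// lee_wpmul2l.
  rewrite -EFinM -EFinD lee_fin.
  have : e m.+1 * s <= e m / 100 * s by rewrite ler_pM2r.
  have := mulr_gt0 (e_gt0 m) s0.
  by move: (e m.+1 * s) (e m) => p q; lra.
have xK m : (sqnorm mu (fun t => x m.+1 t - x m t)%R <= (e 0%N * s / 4 ^+ m)%:E)%E.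
  have -> : (fun t => x m.+1 t - x m t) = b m.
    by apply/funext => t; rewrite xS; ring.
  by rewrite bs lee_fin mulrAC ler_pM2r.
have [f [mf fP]] := L2_limit mx xK.
have fx m : (sqnorm mu (fun t => f t - x m t)%R <= (3 * (e m * s))%:E)%E.
  apply: fP => //; exists m => // n /= mn.
  by rewrite -(subnKC mn); exact: near_x.
have mg := mx 0%N.
have f2 : square_integrable f.
  have -> : f = fun t => (f t - x 0%N t) + x 0%N t by apply/funext => t; ring.
  apply: square_integrable_add => //; split; first exact: measurable_csub.
  by apply: le_lt_trans (fx 0%N) _; rewrite ltry.
exists f; split => //.
  apply: le_trans (fx 0%N) _; rewrite lee_fin.
  by rewrite mulrA mulrAC.
move=> N N0.
have exm : exists m, (N <= nn m.+1)%N by exists N; exact: leq_trans (leqnSn _) (nn_ge _).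
case: (ex_minnP exm) => m Nm mmin.
have nmN : (nn m < N)%N.
  case: m Nm mmin => [|m] Nm mmin //; rewrite ltnNge; apply/negP => /mmin.
  by rewrite ltnn.
have EN : E N <= e m by exact: (decreasing_null_le E0).
(* The loss is at most 2 * 3 * e_(m+1) * s <= 6 / 100 * e_m * s, hence at least
   (3 / 4 - 6 / 100) / 2 >= 1 / 8 of e_m * s remains. *)
have Wm : ((3 / 4 * (e m * s))%:E <= W N (x m.+1))%E by apply: bW; rewrite N0.
have := W_weighted N ltr01 (x2 m.+1) f2; rewrite invr1.
rewrite sqnorm_sub_sym => /(le_trans Wm) h.
have {h} : ((3 / 4 * (e m * s))%:E <= (1 + 1)%:E * W N f + ((1 + 1) * (3 * (e m.+1 * s)))%:E)%E.
  apply: le_trans h _; rewrite leeD2l// EFinM.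
  by apply: lee_wpmul2l => //; exact: fx.
have := energy_ge0 Psi N f; case: (W N f) => [w| |]// _; last by rewrite leey.
rewrite -EFinM -EFinD !lee_fin.
have : e m.+1 * s <= e m / 100 * s by rewrite ler_pM2r.
have : s * E N <= s * e m by rewrite ler_pM2l.
have := mulr_gt0 (e_gt0 m) s0.
by move: (e m.+1 * s) (e m) (E N) => p q r; lra.
Qed.

End gliding_hump.

(** * Slow decay of the energy remainder *)

Section L2_classes.
Context {R : realType} {d : nat}.
Local Notation V := (Rn R d).
Local Notation mu := (@lebesgue_Rn R d).

Lemma square_integrable_L2 (f : L2 R d) : square_integrable (f : V -> R[i]).
Proof.
split; first exact: measurable_L0.
by apply/(in_Lp2P (f : V -> R[i])); exact/asboolP/L2valP.
Qed.

Lemma L2_class (f : V -> R[i]) : square_integrable f ->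
  exists F : L2 R d, (F : V -> R[i]) = f %[ae mu].
Proof.
move=> [mf f2].
have h : `[< in_Lp 2%:E (mkL0 mf) >].
  apply/asboolP/(in_Lp2P (mkL0 mf : V -> R[i])).
  by rewrite (ae_eq_sqnorm (measurable_L0 _) mf (mkL0E mf)).
by exists (MkL2 h); exact: mkL0E.
Qed.

Lemma ae_eq_csub (f f' g : V -> R[i]) : f = f' %[ae mu] ->
  (fun x => f x - g x) = (fun x => f' x - g x) %[ae mu].
Proof. by apply: filterS => x ff' /ff' ->. Qed.

Lemma L2_ball (f g : L2 R d) (r : R) : 0 < r ->
  ball f r g <-> (sqnorm mu (fun x => f x - g x)%R < (r ^+ 2)%:E)%E.
Proof.
move=> r0; rewrite ballEmdist /=.
have [mf f2] := square_integrable_L2 f; have [mg g2] := square_integrable_L2 g.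
have : (sqnorm mu (fun x => f x - g x)%R < +oo)%E by exact: sqnorm_fin_sub.
rewrite -[mdist f g]/(fine (Lnormc 2%:E (fun x => f x - g x))) -sqr_Lnormc2.
rewrite -/(Lnormc 2%:E (fun x => f x - g x)).
have : (0 <= Lnormc 2%:E (fun x => f x - g x)%R)%E by exact: Lnorm_ge0.
case: (Lnormc _ _) => [l| |] l0.
- by move=> _; rewrite -EFin_expe lte_fin ltr_pXn2r// nnegrE ?ltW// -lee_fin.
- by rewrite expe2 mulyy ltxx.
- by [].
Qed.

Lemma square_integrable_exists (s : R) : 0 < s ->
  exists u : V -> R[i], square_integrable u /\ sqnorm mu u = s%:E.
Proof.
move=> s0; pose B := @box R d 2^-1.
have mB : measurable B by exact: measurable_box.
have B1 : mu B = 1%E by rewrite lebesgue_box// mulfV// expr1n.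
pose u x : R[i] := (Num.sqrt s * \1_B x)%:C.
have mu_ : measurable_fun setT u.
  by apply: measurable_realC; apply: measurable_funM => //; exact: measurable_indic.
suff us : sqnorm mu u = s%:E by exists u; split => //; split => //; rewrite us ltry.
rewrite /sqnorm (_ : (fun x => _) = fun x => (s%:E * (\1_B x)%:E)%E); last first.
  apply/funext => x; rewrite cabs_real real_normK ?num_real// exprMn sqr_sqrtr ?(ltW s0)//.
  by rewrite -EFinM indicE; case: (x \in B); rewrite ?expr1n ?expr0n.
rewrite ge0_integralZl//.
- by rewrite integral_indic// setIT [X in (_ * X)%E](B1 : _ = _) mule1.
- by apply/measurable_EFinP; exact: measurable_indic.
- by rewrite lee_fin ltW.
Qed.

Lemma ae_eq_energy (Psi : set (L0 R d)) N (f g : V -> R[i]) :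
  measurable_fun setT f -> measurable_fun setT g -> f = g %[ae mu] ->
  energy_remainder Psi N f = energy_remainder Psi N g.
Proof.
move=> mf mg fg; case: N => [|N]; first by rewrite !energy0; exact: ae_eq_sqnorm.
rewrite !energyS; apply: eq_esum => F _; rewrite /absconv.
have mF := measurable_L0 F; 
have FF : ((F : L0 R d) : V -> R[i]) = (F : L0 R d) %[ae mu] by exact: aeW.
by rewrite (ae_eq_conv mf mg mF mF fg FF).
Qed.

End L2_classes.

(** What the sequel uses of the wavelet structure: integrability of the filters,
    and stability of their set under dilation by a^k for k >= 0. *)
Lemma wavelet_filters_regular (R : realType) (d : nat) (chi : L0 R d) (Psi : set (L0 R d)) :
  wavelet_generated chi Psi -> exists a : R,
  [/\ 1 < a, (norm1 (@lebesgue_Rn R d) chi < +oo)%E /\ (sqnorm (@lebesgue_Rn R d) chi < +oo)%E,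
    forall F : L0 R d, Psi F -> (norm1 (@lebesgue_Rn R d) F < +oo)%E,
    forall F : L0 R d, Psi F -> (sqnorm (@lebesgue_Rn R d) F < +oo)%E &
    forall (k : nat) (c0 : 0 < a ^+ k) (F : L0 R d), Psi F -> Psi (dilL0 F c0)].
Proof.
move=> [a [G [J [psi [phi [a1 [[_ Gorth _ _ _] _] [[psi1 psi2] [phi1 phi2] _] -> chiE]]]]]].
have a0 : 0 < a := lt_trans ltr01 a1.
move/in_Lp1P in psi1; move/in_Lp1P in phi1.
move/(in_Lp2P (psi : Rn R d -> R[i])) in psi2; move/(in_Lp2P (phi : Rn R d -> R[i])) in phi2.
have hphi := scales_dilateRn d (exprz_gt0 (- J) a0).
have mlow : measurable_fun setT (low_pass phi a J) by exact: measurable_wav hphi.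
have mdil j M : G M -> measurable_fun setT (dilate psi a j M).
  by move=> GM; exact: measurable_wav (scales_wavelet a1 j (Gorth _ GM)).
exists a; split => //.
- split; first by rewrite (ae_eq_norm1 (measurable_L0 _) mlow chiE); exact: norm1_wav hphi _.
  by rewrite (ae_eq_sqnorm (measurable_L0 _) mlow chiE); exact: sqnorm_wav hphi _.
- move=> F [j [M [_ GM FE]]]; rewrite (ae_eq_norm1 (measurable_L0 _) (mdil j M GM) FE).
  exact: norm1_wav (scales_wavelet a1 j (Gorth _ GM)) _.
- move=> F [j [M [_ GM FE]]]; rewrite (ae_eq_sqnorm (measurable_L0 _) (mdil j M GM) FE).
  exact: sqnorm_wav (scales_wavelet a1 j (Gorth _ GM)) _.
- by move=> k c0 F; exact: Wav_dil.
Qed.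

Section energy_decay.
Context {R : realType} {d : nat}.
Local Notation V := (Rn R d).
Local Notation mu := (@lebesgue_Rn R d).
Variables (Psi : set (L0 R d)) (a : R).
Local Notation W := (energy_remainder Psi).
Hypothesis a0 : 0 < a.
Hypothesis W_weighted : forall N (f g : V -> R[i]) (t : R), 0 < t ->
  square_integrable f -> square_integrable g ->
  (W N f <= (1 + t)%:E * W N g + (1 + t^-1)%:E * sqnorm mu (fun x => f x - g x)%R)%E.
Hypothesis W_bump : forall N (x u : V -> R[i]) (e : R),
  square_integrable x -> square_integrable u -> 0 < e -> \forall k \near \oo,
  (sqnorm mu u <= W N.+1 (fun y => x y + dil (a ^+ k) u y)%R + e%:E)%E.

(** The gliding hump along dilates of g itself; if g is null, g is its own
    witness. The constant covers 2 |g|^2 + 6 |g|^2 E_1. *)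
Lemma slow_decay (g : L2 R d) : exists C : R, 0 < C /\
    forall E : nat -> R, decreasing_null_seq E ->
      exists f : L2 R d,
        [/\ (Lnormc 2%:E f ^+ 2 <= (C * (1 + E 1%N))%:E)%E,
            (Lnormc 2%:E (fun x => f x - g x)%R ^+ 2 <= (C * E 1%N)%:E)%E
          & forall N, (0 < N)%N ->
              (Lnormc 2%:E g ^+ 2 * (8^-1)%:E * (E N)%:E
                 <= W N f)%E].
Proof.
have g2 := square_integrable_L2 g; have [mg g2'] := g2.
pose s := fine (sqnorm mu g).
have sE : sqnorm mu g = s%:E by rewrite fineK// ge0_fin_numE ?sqnorm_ge0.
have s_ge0 : 0 <= s by rewrite fine_ge0// sqnorm_ge0.
exists (6 * s + 1); split; first by rewrite ltr_wpDl// mulr_ge0.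
move=> E E0; have E1 := decreasing_null_gt0 E0 (ltn0Sn 0).
have sE1 : 0 <= s * E 1%N by rewrite mulr_ge0// ltW.
rewrite /Lnormc sqr_Lnormc2 sE.
have [s0|s_gt0] := eqVneq s 0.
  exists g; rewrite !sqr_Lnormc2 sE s0; split.
  - by rewrite lee_fin; lra.
  - rewrite /sqnorm; under eq_integral do rewrite subrr cabs0 expr0n.
    by rewrite integral0 lee_fin; lra.
  - by move=> N _; rewrite !mul0e; exact: energy_ge0.
have s0 : 0 < s by rewrite lt_neqAle eq_sym s_gt0.
have [f [f2 fg fW]] := gliding_hump a0 W_weighted W_bump s0 g2 g2 sE E0.
have [F Ff] := L2_class f2; have [mf _] := f2; have mF := measurable_L0 F.
exists F; rewrite !sqr_Lnormc2; split.
- rewrite (ae_eq_sqnorm mF mf Ff).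
  apply: le_trans (sqnorm_weighted mu ltr01 mf mg) _.
  rewrite sE invr1; apply: (@le_trans _ _ ((1 + 1)%:E * s%:E + (1 + 1)%:E * (3 * s * E 1%N)%:E)%E).
    by rewrite leeD2l// lee_wpmul2l.
  rewrite -!EFinM -EFinD lee_fin.
  by move: (E 1%N) E1 sE1 => p q r; nra.
- have mFg := measurable_csub mF mg; have mfg := measurable_csub mf mg.
  rewrite (ae_eq_sqnorm mFg mfg (ae_eq_csub _ Ff)); apply: le_trans fg _.
  by rewrite lee_fin; move: (E 1%N) E1 sE1 => p q r; nra.
- move=> N N0; rewrite (ae_eq_energy Psi N mF mf Ff); apply: le_trans (fW N N0).
  by rewrite -!EFinM lee_fin.
Qed.

(** In every ball around h lies some h + D_k u whose N-th energy, for a large N,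
    is at least half of that of u, far above n E_N. The energies of a limit point
    of the set are bounded by 2 n E_N, so that h + D_k u is none. *)
Lemma fast_decay_nowhere_dense (E : nat -> R) (n : nat) : decreasing_null_seq E ->
  nowhere_dense [set f : L2 R d | forall N, (n <= N)%N -> (W N f <= (n%:R * E N)%:E)%E].
Proof.
move=> E0; set Y := [set f | _].
apply/seteqP; split => // h; rewrite /interior => /nbhs_ballP[r /= r0 hr].
pose s := r ^+ 2 / 2.
have s0 : 0 < s by rewrite divr_gt0// exprn_gt0.
have [u [u2 us]] := @square_integrable_exists R d s s0.
have [mu_ _] := u2.
have n1 : 0 < n%:R + 1 :> R by rewrite ltr_wpDl.
have e0 : 0 < s / 16 / (n%:R + 1) by apply: divr_gt0 => //; exact: divr_gt0.
have [K _ hK] := decreasing_null_small E0 e0.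
pose N := maxn n K.
have EN : E N.+1 <= s / 16 / (n%:R + 1) by apply: hK; rewrite /= leqW// leq_maxr.
have nEN : n%:R * E N.+1 <= s / 16.
  apply: (@le_trans _ _ ((n%:R + 1) * E N.+1)).
    by rewrite ler_wpM2r ?lerDl// ltW// (decreasing_null_gt0 E0).
  by rewrite mulrC -ler_pdivlMr.
have h2 := square_integrable_L2 h; have [mh _] := h2.
have s2 : 0 < s / 2 by rewrite divr_gt0.
have [k _ /(_ k (leqnn k)) hk] := W_bump N h2 u2 s2.
have ak : 0 < a ^+ k by rewrite exprn_gt0.
have du2 := square_integrable_dil ak u2.
have f2 := square_integrable_add h2 du2; have [mf _] := f2.
have [F Ff] := L2_class f2; have F2 := square_integrable_L2 F; have [mF _] := F2.
have : closure Y F.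
  apply: hr; apply/(L2_ball _ _ r0); rewrite sqnorm_sub_sym.
  have mFh := measurable_csub mF mh; have mfh := measurable_csub mf mh.
  rewrite (ae_eq_sqnorm mFh mfh (ae_eq_csub _ Ff)).
  rewrite (_ : (fun x => _) = dil (a ^+ k) u); last by apply/funext => x; ring.
  rewrite (sqnorm_dil ak mu_) us lte_fin.
  by rewrite ltr_pdivrMr// ltr_pMr ?exprn_gt0// ltr1n.
have p0 : 0 < Num.sqrt s / 4 by rewrite divr_gt0// sqrtr_gt0.
move=> /(_ _ (nbhsx_ballx F _ p0))[F' [F'Y]] /(L2_ball _ _ p0).
have F'2 := square_integrable_L2 F'.
have -> : (Num.sqrt s / 4) ^+ 2 = s / 16.
  by rewrite exprMn sqr_sqrtr ?(ltW s0)//; field.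
move=> FF'; have := W_weighted N.+1 ltr01 F2 F'2; rewrite invr1 => WF.
have {WF} : (W N.+1 F <= (1 + 1)%:E * (s / 16)%:E + (1 + 1)%:E * (s / 16)%:E)%E.
  apply: le_trans WF _; apply: leeD; apply: lee_wpmul2l => //; last exact: ltW.
  have nN : (n <= N.+1)%N by rewrite leqW// leq_maxl.
  by apply: le_trans (F'Y _ nN) _; rewrite lee_fin.
move: hk; rewrite us (ae_eq_energy Psi N.+1 mF mf Ff).
case: (W N.+1 _) => [w| |]//; rewrite -!EFinM -!EFinD !lee_fin => h1 h3.
by exfalso; lra.
Qed.

Lemma decreasing_null_sqrt (E : nat -> R) (c : R) : 0 < c ->
  decreasing_null_seq E -> decreasing_null_seq (fun N => c * Num.sqrt (E N)).
Proof.
move=> c0 [E0 dE cE]; split.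
- by move=> N /E0 EN; rewrite mulr_gt0// sqrtr_gt0.
- by move=> N /dE EN; rewrite ler_pM2l// ler_wsqrtr.
- rewrite -(mulr0 c); apply: cvgM; first exact: cvg_cst.
  rewrite -[X in _ --> X](@sqrtr0 R).
  by apply: continuous_cvg => //; exact: sqrt_continuous.
Qed.

(** A gliding hump for a small multiple of sqrt E stays close to h, and sqrt E is
    not O(E) as E tends to 0. *)
Lemma slow_decay_dense (E : nat -> R) : decreasing_null_seq E ->
  dense (~` [set f : L2 R d | is_bigO (fun N => W N f) E]).
Proof.
move=> E0 O [h Oh] oO.
have : nbhs h O by exact: open_nbhs_nbhs.
move=> /nbhs_ballP[r /= r0 hr].
have E1 := decreasing_null_gt0 E0 (ltn0Sn 0).
have sE1 : 0 < Num.sqrt (E 1%N) by rewrite sqrtr_gt0.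
pose c := r ^+ 2 / 4 / Num.sqrt (E 1%N).
have r2 : 0 < r ^+ 2 by rewrite exprn_gt0.
have c0 : 0 < c by rewrite !divr_gt0.
have [u [u2 us]] := @square_integrable_exists R d 1 ltr01.
have h2 := square_integrable_L2 h; have [mh _] := h2.
have E'0 := decreasing_null_sqrt c0 E0.
have [f [f2 fh fW]] := gliding_hump a0 W_weighted W_bump ltr01 h2 u2 us E'0.
have [F Ff] := L2_class f2; have [mF _] := square_integrable_L2 F; have [mf _] := f2.
exists F; split.
  apply: hr; apply/(L2_ball _ _ r0); rewrite sqnorm_sub_sym.
  have mFh := measurable_csub mF mh; have mfh := measurable_csub mf mh.
  rewrite (ae_eq_sqnorm mFh mfh (ae_eq_csub _ Ff)); apply: le_lt_trans fh _.
  by rewrite lte_fin /c divfK ?gt_eqF//; lra.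
move=> [C [N0 [C0 N00 WO]]].
have e0 : 0 < (c / 16 / C) ^+ 2 by rewrite exprn_gt0// !divr_gt0.
have [K _ hK] := decreasing_null_small E0 e0.
pose N := maxn N0 K.
have NN0 : (N0 <= N)%N by exact: leq_maxl.
have N_gt0 : (0 < N)%N by exact: leq_trans NN0.
have := le_trans (fW N N_gt0) _; rewrite -(ae_eq_energy Psi N mF mf Ff).
move=> /(_ _ (WO N NN0)); rewrite lee_fin.
have EN := decreasing_null_gt0 E0 N_gt0.
rewrite -{2}(sqr_sqrtr (ltW EN)) leNgt => /negP; apply.
have q0 : 0 < Num.sqrt (E N) by rewrite sqrtr_gt0.
have : Num.sqrt (E N) <= c / 16 / C.
  rewrite -(@ger0_norm _ (c / 16 / C)) ?(ltW (divr_gt0 _ _)) ?divr_gt0//.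
  by rewrite -sqrtr_sqr ler_wsqrtr// hK //= leq_maxr.
rewrite ler_pdivlMr// => qC.
rewrite expr2 mulrA mulrA ltr_pM2r// mulrC.
by apply: le_lt_trans qC _; lra.
Qed.

Lemma fast_decay_meager (E : nat -> R) : decreasing_null_seq E ->
  countable_union_nowhere_dense [set f : L2 R d | is_bigO (fun N => W N f) E].
Proof.
move=> E0.
exists (fun n => [set f : L2 R d | forall N, (n.+1 <= N)%N -> (W N f <= (n.+1%:R * E N)%:E)%E]).
split; first by move=> n; exact: fast_decay_nowhere_dense.
apply/seteqP; split => [f [C [N0 [C0 N00 WO]]]|f [n _ /= hn]]; last first.
  by exists n.+1%:R, n.+1; split => //; rewrite ltr0n.
have [m Cm] : exists m : nat, C <= m%:R by exists (Num.truncn C).+1; exact/ltW/truncnS_gt.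
exists (maxn N0 m) => //= N hN.
have NN0 : (N0 <= N)%N by rewrite (leq_trans _ hN)// leqW// leq_maxl.
apply: le_trans (WO _ NN0) _; rewrite lee_fin ler_wpM2r//.
  by apply/ltW/(decreasing_null_gt0 E0); exact: leq_trans NN0.
by apply: le_trans Cm _; rewrite ler_nat leqW// leq_maxr.
Qed.

End energy_decay.

Theorem corollary4p6 (R : realType) (d : nat) (d_gt0 : (0 < d)%N)
    (chi : L0 R d) (Psi : set (L0 R d))
    (filters : scattering_filters chi Psi)
    (wavelets : wavelet_generated chi Psi) :
  (forall g : L2 R d, exists C : R, 0 < C /\
    forall E : nat -> R, decreasing_null_seq E ->
      exists f : L2 R d,
        [/\ (Lnormc 2%:E f ^+ 2 <= (C * (1 + E 1%N))%:E)%E,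
            (Lnormc 2%:E (fun x => f x - g x)%R ^+ 2 <= (C * E 1%N)%:E)%E
          & forall N, (0 < N)%N ->
              (Lnormc 2%:E g ^+ 2 * (8^-1)%:E * (E N)%:E
                 <= energy_remainder Psi N f)%E]) /\
  (forall E : nat -> R, decreasing_null_seq E ->
    let Y := [set f : L2 R d |
                is_bigO (fun N => energy_remainder Psi N f) E] in
    countable_union_nowhere_dense Y /\ dense (~` Y)).
Proof.
have [a [a1 [chi1 chi2] Psi1 Psi2 Psi_dil]] := wavelet_filters_regular wavelets.
have a0 : 0 < a := lt_trans ltr01 a1.
have Ww := energy_weighted filters chi1 chi2 Psi1 Psi2.
have Wb := energy_perturbation filters chi1 chi2 Psi1 Psi2 a1 d_gt0 Psi_dil.
split; first exact: slow_decay a0 Ww Wb.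
move=> E E0 Y; split.
  exact: fast_decay_meager a0 Ww Wb E E0.
exact: slow_decay_dense a0 Ww Wb E E0.
Qed.
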